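(* Let $F\colon \mathbb{R}_+^2\to\mathbb{C}$ be a holomorphic function that does not vanish anywhere in $\mathbb{R}_+^2$, and suppose that $|F|$ has non-tangential limit $|\widetilde F|(x)$ for $dx$-a.e. $x\in\mathbb{R}$, with $|\widetilde F|\in A_\infty(\mathbb{R})$. Then $F$ satisfies a Smirnov-type condition in $\mathbb{R}_+^2$ if and only if there exist $m,s\ge 0$ and $q>0$ such that $$\frac{F(z)}{(i+z)^m}\in H^1(\mathbb{R}_+^2,dx)\quad\text{and}\quad \frac{F(z)^{-q}}{(i+z)^s}\in H^1(\mathbb{R}_+^2,dx).$$
   Context: $\mathbb{R}_+^2=\{x+iy\in\mathbb{C}: x\in\mathbb{R},\,y>0\}$. For $x\in\mathbb{R}$ and $\alpha\in(0,\pi/2)$ let $\Gamma_\alpha(x)=\{z_1+iz_2: z_2>0,\ |x-z_1|<\tan(\alpha)\,z_2\}$. A function $G$ on $\mathbb{R}_+^2$ has non-tangential limit at $x$ if $\lim_{z\to x,\,z\in\Gamma_\alpha(x)}G(z)$ exists for some $\alpha\in(0,\pi/2)$; its value is then the non-tangential limit of $G$ at $x$. $A_\infty(\mathbb{R})=\bigcup_{1<r<\infty}A_r(\mathbb{R})$ is the class of Muckenhoupt weights on $\mathbb{R}$. $H^1(\mathbb{R}_+^2,dx)$ is the space of analytic functions $h$ in $\mathbb{R}_+^2$ such that $\mathcal{M}_\alpha(h)(x)=\sup_{z\in\Gamma_\alpha(x)}|h(z)|$ belongs to $L^1(\mathbb{R},dx)$; it is independent of $\alpha\in(0,\pi/2)$,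 and it is equivalent to require $\sup_{y>0}\int_{\mathbb{R}}|h(x+iy)|\,dx<\infty$. The Poisson kernel is $P_y(x)=\frac1\pi\frac{y}{x^2+y^2}$, and $(P_y*f)(x)=\int_{\mathbb{R}}P_y(x-t)f(t)\,dt$ for $f$ with $\int_{\mathbb{R}}\frac{|f(t)|}{1+|t|^2}\,dt<\infty$. (If $w\in A_\infty(\mathbb{R})$ then $\log w\in BMO$, so $P_y*\log w$ is well defined.) Smirnov-type condition: a non-vanishing holomorphic function $F$ in $\mathbb{R}_+^2$ satisfies a Smirnov-type condition if $\log|F(z)|$ has non-tangential limits $\log|\widetilde F|(x)$ for $dx$-a.e. $x$, and $\log|F(z)|=(P_y*\log|\widetilde F|)(x)$ for every $z=x+iy\in\mathbb{R}_+^2$. Real powers of non-vanishing holomorphic functions on the simply connected domain $\mathbb{R}_+^2$ are defined through a holomorphic branch of the logarithm. *)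

(* Defs.v *)
From HB Require Import structures.
From mathcomp Require Import all_boot all_order all_algebra.
From mathcomp Require Import complex.
From mathcomp Require Import all_classical all_reals all_analysis.

Set Implicit Arguments.
Unset Strict Implicit.
Unset Printing Implicit Defensive.

Import Order.TTheory GRing.Theory Num.Theory.
Import numFieldNormedType.Exports.
Import ComplexField.Normc.

Local Open Scope classical_set_scope.
Local Open Scope ring_scope.
Local Open Scope complex_scope.

(* The regular module [R[i]^o] carries the canonical topology and the normed
   space structure over the field R[i] itself; in particular [derivable f z 1]
   below is complex differentiability. *)
Notation CC R := (R[i]^o).

Section HalfPlane.
Variable R : realType.
Local Notation mu := (@lebesgue_measure R).
Implicit Types (x y a alpha : R) (z : CC R) (F G L : CC R -> CC R) (w u : R -> R).

Definition upper_half_plane : set (CC R) := [set z | 0 < complex.Im z].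

Definition cone alpha x : set (CC R) :=
  [set z | 0 < complex.Im z /\
           `|x - complex.Re z| < tan alpha * complex.Im z].

(* [l] is the non-tangential limit of [G] at [x]. *)
Definition nt_limit (T : topologicalType) (G : CC R -> T) x (l : T) : Prop :=
  exists2 alpha : R, 0 < alpha < pi / 2 &
    G z @[z --> within (cone alpha x) (nbhs (x%:C : CC R))] --> l.

Definition holomorphic F : Prop :=
  forall z, upper_half_plane z -> derivable F z 1.

Definition cexp z : CC R :=
  (expR (complex.Re z))%:C * (cos (complex.Im z) +i* sin (complex.Im z)).

Definition log_branch F L : Prop :=
  holomorphic L /\ forall z, upper_half_plane z -> cexp (L z) = F z.

(* [G] is a determination of the real power F^a on the half-plane; it is unique
   up to a multiplicative constant of modulus one. *)
Definition real_power F a G : Prop :=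
  exists2 L, log_branch F L &
    forall z, upper_half_plane z -> G z = cexp (a%:C * L z).

Definition nt_maximal alpha F x : \bar R :=
  ereal_sup [set (normc (F z))%:E | z in cone alpha x].

Definition hardy1 alpha F : Prop :=
  holomorphic F /\ mu.-integrable setT (nt_maximal alpha F).

(* Values outside the a.e. positivity set are irrelevant; note that
   [0 `^ c = 0] for c < 0, which is why a.e. positivity is required here. *)
Definition weight w : Prop :=
  locally_integrable setT w /\ {ae mu, forall x, 0 < w x}.

Definition average w a b : \bar R :=
  (((b - a)^-1)%:E * \int[mu]_(x in `]a, b[) (w x)%:E)%E.

(* The factors are extended reals, so a divergent dual average makes the
   product +oo (the average of a weight is positive). *)
Definition muckenhoupt (r : R) w : Prop :=
  weight w /\
  exists C : R, forall a b, a < b ->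
    (average w a b *
     poweR (average (fun x => powR (w x) (- (r - 1)^-1)) a b) (r - 1) <= C%:E)%E.

Definition muckenhoupt_infty w : Prop := exists2 r : R, 1 < r & muckenhoupt r w.

Definition poisson_kernel y x : R := pi^-1 * (y / (x ^+ 2 + y ^+ 2)).

Definition poisson_integrable u : Prop :=
  mu.-integrable setT (fun t => (u t / (1 + `|t| ^+ 2))%:E).

Definition poisson_extension u y x : R :=
  \int[mu]_(t in setT) (poisson_kernel y (x - t) * u t).

(* [u] plays the role of the boundary function log|F|; it is determined
   a.e. by [F]. *)
Definition smirnov_type F : Prop :=
  exists u : R -> R,
    [/\ {ae mu, forall x, nt_limit (fun z => ln (normc (F z))) x (u x)},
        poisson_integrable u
      & forall z, upper_half_plane z ->
          ln (normc (F z)) =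
          poisson_extension u (complex.Im z) (complex.Re z)].

End HalfPlane.

(* Main.v *)
(* Hardy implies Smirnov.  If g is holomorphic with g / (i + z)^m in H^1, then
   |g|^p, for small p > 0, has a subharmonic majorization |g(z)|^p <= P_y * |g~|^p:
   for g(. + ie) it follows from Cauchy's theorem applied to a root of g against a
   Poisson kernel, and the H^1 bound dominates the limit e -> 0.  Taking g = F and
   g = F^(-q) and letting p -> 0 gives log|F| <= P_y * log|F~| and the reverse
   inequality.

   Smirnov implies Hardy.  Some factor |i + t|^(-m) makes w and w^(1-r') integrable at
   infinity when w is in A_r, because the averages of w and w^(1-r') over the
   intervals (-4^n, 4^n) grow at most geometrically.  As P_y * log|i + t| <=
   log|i + z|, Jensen's inequality gives |F / (i + z)^m|^(1/2) <= P_y * h with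
   h^2 = |F~| / |i + t|^m integrable; the right side is at most a multiple of the
   Hardy-Littlewood maximal function of h on the cones, and that is in L^2.  The
   logarithm of F needed for the powers is a Schwarz integral. *)

Require Import Defs.
From HB Require Import structures.
From mathcomp Require Import all_boot all_order all_algebra.
From mathcomp Require Import complex ring lra.
From mathcomp Require Import all_classical all_reals all_analysis measurable_realfun.

Set Implicit Arguments.
Unset Strict Implicit.
Unset Printing Implicit Defensive.

Import Order.TTheory GRing.Theory Num.Theory.
Import numFieldNormedType.Exports.
Import ComplexField.Normc.

Local Open Scope classical_set_scope.
Local Open Scope ring_scope.
Local Open Scope complex_scope.

(** * Complex differentiation, exponential and logarithm *)

Section ComplexBasics.
Variable R : realType.
Implicit Types (x y a b : R) (z w h D : CC R) (f g F G L : CC R -> CC R).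

(** No theory of subharmonic functions enters. The pole z and its mirror image are put into one
    quotient (f - f(z)) / ((w - z)(w - conj z)), and Cauchy's theorem on rectangles with one
    removable point becomes a Poisson inequality, provided the far sides contribute o(1), that is, f
    grows sublinearly. This is where the constraint mp <= 1/2 comes from: on each half-plane Im w >=
    e > 0 the p-th power of the function then grows at most like |w|^(1/2). The passage p -> 0 is a
    second-order expansion of e^(pu), whose remainder is controlled by the Poisson integrals of both
    e^(du) and e^(-du). So each of the two inequalities uses both Hardy conditions, and the same
    pair gives the Poisson integrability of log|F~|. In the converse, the exponent 1/2 is there
    because the maximal operator is bounded on L^2 and not on L^1: an L^1 bound for the maximal
    function of G is an L^2 bound for that of |G|^(1/2). The exponent q is 1/(r-1), which makes
    |F~|^(-q) the dual weight in the A_r condition. *)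

Lemma normc_normr (z : R[i]) : `|z| = (normc z)%:C.
Proof. by []. Qed.

Lemma normc_ge0 (z : R[i]) : 0 <= normc z.
Proof. by case: z => a b; exact: sqrtr_ge0. Qed.

Lemma normc_eq0 (z : R[i]) : (normc z == 0) = (z == 0).
Proof.
apply/eqP/eqP => [/eq0_normc//|->]; exact: normc0.
Qed.

Lemma normc_gt0 (z : R[i]) : (0 < normc z) = (z != 0).
Proof. by rewrite lt_def normc_ge0 andbT normc_eq0. Qed.

Lemma normcD_le (z w : R[i]) : normc (z + w) <= normc z + normc w.
Proof. by rewrite -lecR rmorphD /=; exact: (ler_normD z w). Qed.

Lemma normcNE (z : R[i]) : normc (- z) = normc z.
Proof. by case: z => a b /=; rewrite !sqrrN. Qed.

Lemma normcBC (z w : R[i]) : normc (z - w) = normc (w - z).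
Proof. by rewrite -normcNE opprB. Qed.

Lemma normcB_ge (z w : R[i]) : normc z - normc w <= normc (z - w).
Proof.
by rewrite lerBlDr; apply: le_trans (normcD_le _ _); rewrite subrK.
Qed.

Lemma normcB_le (z w : R[i]) : normc (z - w) <= normc z + normc w.
Proof. by rewrite -(normcNE w); exact: normcD_le. Qed.

Lemma normcR x : normc x%:C = `|x|.
Proof. by rewrite /= expr0n /= addr0 sqrtr_sqr. Qed.

Lemma normci : normc ('i%C : R[i]) = 1.
Proof. by rewrite /= expr0n expr1n add0r sqrtr1. Qed.

Lemma sqr_normcE (z : R[i]) : normc z ^+ 2 = complex.Re z ^+ 2 + complex.Im z ^+ 2.
Proof. by case: z => a b /=; rewrite sqr_sqrtr// addr_ge0// sqr_ge0. Qed.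

Lemma Re_le_normc (z : R[i]) : `|complex.Re z| <= normc z.
Proof.
rewrite -(@ler_pXn2r _ 2)// ?nnegrE ?normc_ge0//.
by rewrite sqr_normcE real_normK ?num_real// lerDl sqr_ge0.
Qed.

Lemma Im_le_normc (z : R[i]) : `|complex.Im z| <= normc z.
Proof.
rewrite -(@ler_pXn2r _ 2)// ?nnegrE ?normc_ge0//.
by rewrite sqr_normcE real_normK ?num_real// lerDr sqr_ge0.
Qed.

Lemma normc_le_ReIm (z : R[i]) : normc z <= `|complex.Re z| + `|complex.Im z|.
Proof.
case: z => a b; rewrite [X in normc X](_ : _ = a%:C + b%:C * 'i%C).
  apply: (le_trans (normcD_le _ _)).
  by rewrite normcM normci mulr1 !normcR.
by apply/eqP; rewrite eq_complex /= !(mulr0, mul0r, mulr1, addr0, add0r, subr0) !eqxx.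
Qed.

Lemma normcX (z : R[i]) n : normc (z ^+ n) = normc z ^+ n.
Proof. by elim: n => [|n IH]; rewrite ?expr0 ?normc1// !exprS normcM IH. Qed.

Lemma creD (z w : R[i]) : complex.Re (z + w) = complex.Re z + complex.Re w.
Proof. by case: z; case: w. Qed.
Lemma cimD (z w : R[i]) : complex.Im (z + w) = complex.Im z + complex.Im w.
Proof. by case: z; case: w. Qed.
Lemma creN (z : R[i]) : complex.Re (- z) = - complex.Re z.
Proof. by case: z. Qed.
Lemma cimN (z : R[i]) : complex.Im (- z) = - complex.Im z.
Proof. by case: z. Qed.
Lemma creM (z w : R[i]) : complex.Re (z * w) =
  complex.Re z * complex.Re w - complex.Im z * complex.Im w.
Proof. by case: z; case: w. Qed.
Lemma cimM (z w : R[i]) : complex.Im (z * w) =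
  complex.Re z * complex.Im w + complex.Im z * complex.Re w.
Proof. by case: z => a b; case: w => c d. Qed.

Definition creimE := (creD, cimD, creN, cimN, creM, cimM).

Lemma complexP (z w : R[i]) :
  complex.Re z = complex.Re w -> complex.Im z = complex.Im w -> z = w.
Proof. by case: z => a b; case: w => c d /= -> ->. Qed.

(** The norm of [CC R] takes its values in [R[i]]. This form of the derivative keeps every estimate
    in the real field and allows w = z, since nothing is divided by w - z. *)
Definition has_cderiv f z D := forall e, 0 < e -> exists2 d, 0 < d &
  forall w, normc (w - z) < d -> normc (f w - f z - D * (w - z)) <= e * normc (w - z).

Lemma derivable_cderiv f z : derivable f z 1 <-> exists D, has_cderiv f z D.
Proof.
split=> [/cvg_ex[D /cvgrPdist_le H]|[D H]].
  exists D => e e0.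
  have /H : 0 < (e%:C : R[i]) by rewrite ltcR.
  rewrite near_withinE => /nbhs_ballP[d /= d0 Hd].
  have dR : (complex.Re d)%:C = d.
    by move: d0; rewrite ltcE /= => /andP[/eqP d0 _]; apply: complexP => //=.
  exists (complex.Re d); first by rewrite -ltcR dR.
  move=> w wz.
  have [->|wneq] := eqVneq w z.
    by rewrite !subrr mulr0 subr0 normc0 mulr0.
  have wz0 : w - z != 0 by rewrite subr_eq0.
  have := Hd (w - z); rewrite -ball_normE /= sub0r.
  move/(_ _ wz0); rewrite normrN normc_normr -dR ltcR wz => /(_ isT).
  rewrite /= scaler1 subrK.
  rewrite normc_normr lecR => Hle.
  have -> : f w - f z - D * (w - z) = - (w - z) * (D - (w - z)^-1 *: (f w - f z)).
    rewrite -[_ *: _]/(_ * _); apply/esym.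
    by rewrite mulrBr !mulNr mulrA mulfV// mul1r opprK addrC mulrC.
  by rewrite normcM normcNE mulrC ler_pM2r ?normc_gt0.
apply/cvg_ex; exists D; apply/cvgrPdist_le => e e0.
have eR : (complex.Re e)%:C = e.
  by move: e0; rewrite ltcE /= => /andP[/eqP d0 _]; apply: complexP => //=.
have eR0 : 0 < complex.Re e by rewrite -ltcR eR.
have [d d0 Hd] := H _ eR0.
rewrite near_withinE; apply/nbhs_ballP; exists d%:C; first by rewrite /= ltcR.
move=> h; rewrite -ball_normE /= sub0r normrN normc_normr ltcR => hd h0.
have := Hd (h + z); rewrite addrK => /(_ hd) Hle.
rewrite -eR scaler1 normc_normr lecR.
rewrite -(@ler_pM2r _ (normc h)) ?normc_gt0// -normcM.
rewrite [X in normc X](_ : _ = - (f (h + z) - f z - D * h)) ?normcNE//.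
rewrite -[_ *: _]/(_ * _); apply/esym.
by rewrite mulrBl mulrAC mulVf// mul1r opprB.
Qed.




Lemma nbhsCP z (A : set (CC R)) :
  nbhs z A <-> exists2 d, 0 < d & forall w, normc (w - z) < d -> A w.
Proof.
split=> [/nbhs_ballP[d /= d0 Hd]|[d d0 Hd]].
  have dR : (complex.Re d)%:C = d.
    by move: d0; rewrite ltcE /= => /andP[/eqP d0 _]; apply: complexP => //=.
  exists (complex.Re d); first by rewrite -ltcR dR.
  by move=> w wz; apply: Hd; rewrite -ball_normE /= normc_normr -dR ltcR normcBC.
apply/nbhs_ballP; exists d%:C; first by rewrite /= ltcR.
by move=> w; rewrite -ball_normE /= normc_normr ltcR normcBC; exact: Hd.
Qed.

Lemma open_upper_half_plane z : upper_half_plane z -> \forall w \near z, upper_half_plane w.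
Proof.
move=> Uz; apply/nbhsCP; exists (complex.Im z) => // w.
move=> H; have := le_lt_trans (Im_le_normc _) H; rewrite cimD cimN /upper_half_plane /=.
by rewrite ltr_norml => /andP[+ _]; lra.
Qed.

Lemma cvgCRP (p : CC R -> R) z (l : R) :
  (forall e, 0 < e -> exists2 d, 0 < d & forall w, normc (w - z) < d -> `|l - p w| < e) ->
  p w @[w --> z] --> l.
Proof.
move=> H A /nbhs_ballP[e e0 He]; have [d d0 Hd] := H _ e0.
by apply/nbhsCP; exists d => // w /Hd wd; apply: He; rewrite -ball_normE.
Qed.

Lemma continuous_Re : continuous (@complex.Re R : CC R -> R).
Proof.
move=> z; apply: cvgCRP => e e0; exists e => // w.
rewrite normcBC => H; apply: le_lt_trans H; rewrite -creN -creD; exact: Re_le_normc.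
Qed.

Lemma continuous_Im : continuous (@complex.Im R : CC R -> R).
Proof.
move=> z; apply: cvgCRP => e e0; exists e => // w.
rewrite normcBC => H; apply: le_lt_trans H; rewrite -cimN -cimD; exact: Im_le_normc.
Qed.

Lemma continuous_normc : continuous (@normc R : CC R -> R).
Proof.
move=> z; apply: cvgCRP => e e0; exists e => // w.
rewrite normcBC => H; apply: le_lt_trans H; rewrite ler_norml lerNl opprB normcB_ge andbT.
by rewrite normcBC normcB_ge.
Qed.

Lemma has_cderiv_cts f z D : has_cderiv f z D -> {for z, continuous f}.
Proof.
move=> H; have /derivable1_diffP/differentiable_continuous := (derivable_cderiv f z).2 (ex_intro _ D H).
exact.
Qed.

Lemma cvgCP f z (l : CC R) : f w @[w --> z] --> l <->
  forall e, 0 < e -> exists2 d, 0 < d & forall w, normc (w - z) < d -> normc (f w - l) < e.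
Proof.
split=> [H e e0|H].
  have : nbhs l [set u : CC R | normc (u - l) < e] by apply/nbhsCP; exists e.
  by move=> /H /= /nbhsCP.
by move=> A /nbhsCP[e e0 He]; have [d d0 Hd] := H _ e0; apply/nbhsCP; exists d => // w /Hd/He.
Qed.

Lemma cvg_ReIm (T : Type) (Fi : set_system T) {FF : Filter Fi} (p q : T -> R) a b :
  p x @[x --> Fi] --> a -> q x @[x --> Fi] --> b ->
  ((p x +i* q x) : CC R) @[x --> Fi] --> ((a +i* b) : CC R).
Proof.
move=> Hp Hq A /nbhsCP[e e0 He].
have e20 : 0 < e / 2 by rewrite divr_gt0.
move/cvgrPdist_lt : Hp => /(_ _ e20) Hp; move/cvgrPdist_lt : Hq => /(_ _ e20) Hq.
move: Hp Hq; apply: filterS2 => x Hp Hq.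
apply: He; apply: (le_lt_trans (normc_le_ReIm _)); rewrite !creimE /=.
rewrite distrC in Hp; rewrite distrC in Hq; lra.
Qed.

Lemma is_derive_eps (p : R -> R) x (D : R) : is_derive x 1 p D -> forall e, 0 < e ->
  exists2 d, 0 < d & forall h : R, `|h| < d -> `|p (h + x) - p x - D * h| <= e * `|h|.
Proof.
move=> Hp e e0; have [pd /esym Dp] := Hp.
have /cvgrPdist_le : h^-1 *: ((p \o shift x) (h *: (1 : R)) - p x) @[h --> (0:R)^'] --> D.
  by move/derivable_nbhsP : pd => _; rewrite Dp; case: Hp => + _; exact.
move=> /(_ _ e0); rewrite near_withinE => /nbhs_ballP[d d0 Hd].
exists d => // h hd; have [->|h0] := eqVneq h 0.
  by rewrite add0r subrr mulr0 subr0 normr0 mulr0.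
have := Hd h; rewrite -ball_normE /= sub0r normrN hd => /(_ isT h0).
rewrite [h%:A]mulr1 distrC => H.
rewrite -(@ler_pM2r _ (`|h|^-1)) ?invr_gt0 ?normr_gt0// mulfK ?normr_eq0//.
by rewrite -normfV -normrM mulrBl mulfK// mulrC.
Qed.

(** * The complex exponential and the logarithm on the half-plane *)

Lemma cexp0 : cexp (0 : CC R) = 1.
Proof. by rewrite /cexp /= expR0 cos0 sin0 mul1r. Qed.

Lemma cexpD z w : cexp (z + w) = cexp z * cexp w.
Proof.
rewrite /cexp creD cimD expRD; apply: complexP; rewrite !creimE /=.
  by rewrite cosD; ring.
by rewrite sinD; ring.
Qed.

Lemma normc_cexp z : normc (cexp z) = expR (complex.Re z).
Proof.
rewrite normcM normcR ger0_norm ?expR_ge0//=.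
by rewrite cos2Dsin2 sqrtr1 mulr1.
Qed.

Lemma cexp_neq0 z : cexp z != 0.
Proof. by rewrite -normc_gt0 normc_cexp expR_gt0. Qed.

Lemma has_cderiv_cexp0 : has_cderiv (@cexp R) 0 1.
Proof.
(* The real and the imaginary part of the remainder are each at most 3 e' |w|, whence e/6; the bound
   e' <= 1 gives |e^a - 1| <= 2|a| <= e'. *)
move=> e e0; set e' := Num.min 1 (e / 6).
have e'0 : 0 < e' by rewrite lt_min ltr01 divr_gt0.
have [d1 d10 H1] := is_derive_eps (is_derive_expR (0:R)) e'0.
have [d2 d20 H2] := is_derive_eps (is_derive_cos (0:R)) e'0.
have [d3 d30 H3] := is_derive_eps (is_derive_sin (0:R)) e'0.
exists (Num.min (Num.min d1 (e' / 2)) (Num.min d2 d3)).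
  by rewrite !lt_min d10 d20 d30 divr_gt0.
move=> w; rewrite subr0 !lt_min => /andP[/andP[w1 w4] /andP[w2 w3]].
rewrite cexp0 mul1r.
have [e1 e6] : e' <= 1 /\ e' <= e / 6 by rewrite !ge_min !lexx orbT.
move: (Re_le_normc w) (Im_le_normc w); set a := complex.Re w; set b := complex.Im w => aw bw.
have {}H1 := H1 a (le_lt_trans aw w1).
have {}H2 := H2 b (le_lt_trans bw w2).
have {}H3 := H3 b (le_lt_trans bw w3).
move: H1 H2 H3; rewrite !addr0 expR0 cos0 sin0 !mul1r oppr0 mul0r !(subr0, addr0).
move=> H1 H2 H3.
have E1 : `|expR a - 1| <= e'.
  rewrite -(subrK a (expR a - 1)); apply: le_trans (ler_normD _ _) _.
  have : e' * `|a| <= 1 * `|a| by rewrite ler_wpM2r.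
  by lra.
have E2 : expR a <= 2 by move: E1; rewrite ler_norml; lra.
have c1 : `|cos b| <= 1 by rewrite ler_norml cos_geN1 cos_le1.
have R1 : `|expR a * cos b - 1 - a| <= 3 * e' * normc w.
  rewrite [X in `|X|](_ : _ = (expR a - 1 - a) * cos b + (1 + a) * (cos b - 1)); last by ring.
  apply: le_trans (ler_normD _ _) _; rewrite !normrM.
  have M1 : `|expR a - 1 - a| * `|cos b| <= (e' * `|a|) * 1 by apply: ler_pM.
  have M2 : `|1 + a| * `|cos b - 1| <= 2 * (e' * `|b|).
    apply: ler_pM => //; apply: le_trans (ler_normD _ _) _; rewrite normr1.
    by lra.
  have : e' * `|a| <= e' * normc w by rewrite ler_pM2l.
  have : e' * `|b| <= e' * normc w by rewrite ler_pM2l.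
  by lra.
have R2 : `|expR a * sin b - b| <= 3 * e' * normc w.
  rewrite [X in `|X|](_ : _ = expR a * (sin b - b) + (expR a - 1) * b); last by ring.
  apply: le_trans (ler_normD _ _) _; rewrite !normrM.
  have M1 : `|expR a| * `|sin b - b| <= 2 * (e' * `|b|).
    apply: ler_pM => //; first by rewrite ger0_norm ?expR_ge0.
  have M2 : `|expR a - 1| * `|b| <= e' * `|b| by rewrite ler_wpM2r.
  have : e' * `|b| <= e' * normc w by rewrite ler_pM2l.
  by lra.
apply: (le_trans (normc_le_ReIm _)); rewrite /cexp !creimE /= -/a -/b.
rewrite !(mul0r, subr0, addr0, oppr0).
have : e' * normc w <= e / 6 * normc w by rewrite ler_wpM2r ?normc_ge0.
by lra.
Qed.

Lemma has_cderiv_cexp z : has_cderiv (@cexp R) z (cexp z).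
Proof.
move=> e e0; have n0 : 0 < normc (cexp z) by rewrite normc_gt0 cexp_neq0.
have [d d0 Hd] := has_cderiv_cexp0 (divr_gt0 e0 n0).
exists d => // w wz; have := Hd (w - z); rewrite subr0 => /(_ wz).
rewrite cexp0 mul1r -(ler_pM2l n0) -normcM mulrA [_ * (e / _)]mulrC divfK ?gt_eqF// .
by rewrite !mulrBr -cexpD [z + _]addrC subrK mulr1.
Qed.

Lemma derivable_cexp f z : derivable f z 1 -> derivable (fun w => cexp (f w)) z 1.
Proof.
move=> /derivable1_diffP hf; apply/derivable1_diffP.
apply: (differentiable_comp hf); apply/derivable1_diffP/derivable_cderiv.
exact: ex_intro (has_cderiv_cexp _).
Qed.

(* The branch of the logarithm on the upper half-plane with argument in (0, pi);
   the formula for the argument has no junk value there since [Im z > 0]. *)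
Definition clog z : CC R :=
  ln (normc z) +i* (pi / 2 - atan (complex.Re z / complex.Im z)).

Lemma cexp_clog z : upper_half_plane z -> cexp (clog z) = z.
Proof.
rewrite /upper_half_plane /= => Iz.
have nz : 0 < normc z by apply: lt_le_trans (Im_le_normc z); rewrite normr_gt0 gt_eqF.
rewrite /cexp /clog /= lnK ?posrE//.
set q := complex.Re z / _.
have -> : cos (pi / 2 - atan q) = sin (atan q) by rewrite -cosN opprB cosBpihalf.
have -> : sin (pi / 2 - atan q) = cos (atan q).
  by rewrite -[LHS]opprK -sinN opprB sinBpihalf opprK.
have c : cos (atan q) = complex.Im z / normc z.
  rewrite cos_atan.
  have -> : 1 + q ^+ 2 = (normc z / complex.Im z) ^+ 2.
    rewrite /q !expr_div_n sqr_normcE mulrDl mulfV ?expf_neq0 ?gt_eqF//.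
    by rewrite addrC.
  by rewrite sqrtr_sqr ger0_norm ?divr_ge0 ?ltW// invf_div.
have s : sin (atan q) = complex.Re z / normc z.
  have <- : tan (atan q) * cos (atan q) = sin (atan q).
    rewrite /tan mulfVK// c mulf_neq0 ?invr_eq0 ?gt_eqF//.
  rewrite atanK c /q mulrA divfK ?gt_eqF//.
rewrite c s; apply: complexP; rewrite !creimE /= !(mul0r, subr0, addr0) mulrC divfK ?gt_eqF//.
Qed.

Lemma continuous_clog z : upper_half_plane z -> {for z, continuous clog}.
Proof.
move=> Uz; have nz : 0 < normc z by rewrite (lt_le_trans _ (Im_le_normc z))// normr_gt0 gt_eqF.
apply: (@cvg_ReIm _ (nbhs z)).
  apply: (@continuous_comp _ _ _ (@normc R : CC R -> R) (@ln R) z).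
    exact: continuous_normc.
  exact: continuous_ln.
apply: (@cvgB _ _ _ (nbhs z)); first exact: cvg_cst.
apply: (@continuous_comp _ _ _ (fun z : CC R => complex.Re z / complex.Im z) (@atan R));
  last exact: continuous_atan.
apply: (@cvgM _ _ (nbhs z)); first exact: continuous_Re.
by apply: (@cvgV _ _ (nbhs z)); [rewrite gt_eqF|exact: continuous_Im].
Qed.

(* A continuous logarithm of a differentiable function is differentiable:
   the increment k of L satisfies F(w)/F(z) - 1 = cexp k - 1 = k + o(k). *)
Lemma derivable_log L F z : {for z, continuous L} ->
  (\forall w \near z, cexp (L w) = F w) -> derivable F z 1 -> derivable L z 1.
Proof.
move=> /cvgCP cL /[dup] /nbhs_singleton Lz /nbhsCP[d0 d00 LF] /derivable_cderiv[D HF].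
have Fz : F z != 0 by rewrite -Lz cexp_neq0.
apply/derivable_cderiv; exists (D / F z).
set E := D / F z.
have HF' e : 0 < e -> exists2 d, 0 < d & forall w, normc (w - z) < d ->
    normc (F w / F z - 1 - E * (w - z)) <= e * normc (w - z).
  move=> e0; have nF : 0 < normc (F z) by rewrite normc_gt0.
  have [d dp Hd] := HF _ (mulr_gt0 e0 nF).
  exists d => // w /Hd H.
  rewrite -(ler_pM2r nF) -normcM [leRHS]mulrAC.
  rewrite [X in normc X](_ : _ = F w - F z - D * (w - z))//.
  by rewrite /E [LHS]mulrBl [X in X - _]mulrBl divfK// mul1r mulrAC divfK.
(* [B] bounds |k| / |w - z| for the increment k of [L]: the error e1 |k| with e1 <= 1/2 is absorbed
   on the left, which doubles |E| + 1. *)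
move=> e e0; set B := 2 * (normc E + 1).
have B0 : 0 < B by rewrite mulr_gt0// ltr_wpDl// normc_ge0.
set e1 := Num.min (1/2) (e / (2 * B)).
have e10 : 0 < e1 by rewrite lt_min divr_gt0//= divr_gt0// mulr_gt0.
have e1B : e1 * B <= e / 2.
  rewrite -ler_pdivlMr// [leRHS](_ : _ = e / (2 * B)); first by rewrite ge_min lexx orbT.
  by field; rewrite gt_eqF.
have e12 : e1 <= 1 / 2 by rewrite ge_min lexx.
have [d1 d10 H1] := has_cderiv_cexp0 e10.
have [d2 d20 H2] := cL _ d10.
set e3 := Num.min 1 (e / 2).
have e30 : 0 < e3 by rewrite lt_min ltr01 divr_gt0.
have [d3 d30 H3] := HF' _ e30.
exists (Num.min d0 (Num.min d2 d3)); first by rewrite !lt_min d00 d20.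
move=> w; rewrite !lt_min => /andP[/LF w0 /andP[/H2 w2 /H3 w3]].
set k := L w - L z in w2 *.
have := H1 k; rewrite subr0 cexp0 mul1r => /(_ w2) {}H1.
have Ek : cexp k = F w / F z.
  apply: (mulIf Fz); rewrite divfK// -Lz -cexpD /k subrK w0 //.
rewrite Ek in H1.
set u := w - z in w3 *.
have e31 : e3 * normc u <= normc u.
  by rewrite -[leRHS]mul1r ler_wpM2r ?normc_ge0// ge_min lexx.
have e32 : e3 * normc u <= e / 2 * normc u.
  by rewrite ler_wpM2r ?normc_ge0// ge_min lexx orbT.
have kB : normc k <= B * normc u.
  have T1 : normc k <= normc (F w / F z - 1 - k) + normc (F w / F z - 1).
    rewrite -[X in X <= _]normcNE -{1}[- k](subrK (- (F w / F z - 1))).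
    rewrite opprK; apply: le_trans (normcD_le _ _) _; rewrite normcNE lerD2r.
    by rewrite addrC.
  have T2 : normc (F w / F z - 1) <= normc (F w / F z - 1 - E * u) + normc E * normc u.
    by rewrite -normcM -{1}(subrK (E * u) (F w / F z - 1)) normcD_le.
  have T3 : e1 * normc k <= 1 / 2 * normc k by rewrite ler_wpM2r ?normc_ge0.
  by rewrite /B; lra.
rewrite [X in normc X](_ : _ = (F w / F z - 1 - E * u) - (F w / F z - 1 - k)); last by ring.
apply: le_trans (normcB_le _ _) _.
have : e1 * normc k <= e / 2 * normc u.
  apply: (@le_trans _ _ (e1 * (B * normc u))); first by rewrite ler_pM2l.
  by rewrite mulrA ler_wpM2r ?normc_ge0.
by lra.
Qed.

Lemma holomorphic_clog : holomorphic clog.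
Proof.
move=> z Uz; apply: (@derivable_log _ id); first exact: continuous_clog.
  by apply: filterS (open_upper_half_plane Uz) => w; exact: cexp_clog.
exact: derivable_id.
Qed.

(** The half-plane is convex, so the mean value theorem along the segment from z to w applies to the
    real and to the imaginary part of f. *)
Lemma cderiv0_cst f : (forall z, upper_half_plane z -> has_cderiv f z 0) ->
  forall z w, upper_half_plane z -> upper_half_plane w -> f z = f w.
Proof.
move=> H z w Uz Uw.
pose l (t : R) : CC R := z + t%:C * (w - z).
have Ul t : 0 <= t <= 1 -> upper_half_plane (l t).
  move=> /andP[t0 t1]; rewrite /upper_half_plane /= /l !creimE /=.
  rewrite /upper_half_plane /= in Uz Uw.
  rewrite mul0r addr0; have : 0 <= t * complex.Im w by rewrite mulr_ge0// ltW.
  have [->|t1'] := eqVneq t 1; first by rewrite !mul1r; lra.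
  have : 0 < (1 - t) * complex.Im z by rewrite mulr_gt0// subr_gt0 lt_neqAle t1'.
  by lra.
suff K : forall (p : CC R -> R), (forall u v, p (u + v) = p u + p v) ->
    (forall u, `|p u| <= normc u) -> p (f z) = p (f w).
  by apply: complexP; [apply: (K (@complex.Re R)) => [u v|u]; [exact: creD|exact: Re_le_normc]
    |apply: (K (@complex.Im R)) => [u v|u]; [exact: cimD|exact: Im_le_normc]].
move=> p pD pn.
have pB u v : p (u - v) = p u - p v.
  by apply/eqP; rewrite -(inj_eq (addIr (p v))) -pD !subrK.
have dp (t : R) : 0 <= t <= 1 -> is_derive t 1 (fun t : R => p (f (l t))) 0.
  move=> t01; have {}H := H _ (Ul _ t01).
  have C : h^-1 *: (p (f (l (h%:A + t))) - p (f (l t))) @[h --> (0:R)^'] --> (0:R).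
    apply/cvgrPdist_le => e e0.
    have n0 : 0 < normc (w - z) + 1 by rewrite ltr_wpDl// normc_ge0.
    have [d d0 Hd] := H _ (divr_gt0 e0 n0).
    rewrite near_withinE; apply/nbhs_ballP; exists (d / (normc (w - z) + 1)).
      by rewrite /= divr_gt0.
    move=> h; rewrite -ball_normE /= sub0r normrN ltr_pdivlMr// => hd h0.
    rewrite sub0r normrN normrM normfV ler_pdivrMl ?normr_gt0// -pB.
    apply: le_trans (pn _) _.
    have E : l (h%:A + t) - l t = h%:C * (w - z).
      rewrite /l [h%:A]mulr1 rmorphD /=; ring.
    have := Hd (l (h%:A + t)); rewrite E mul0r subr0 normcM normcR => Hd'.
    apply: le_trans (Hd' _) _.
      by apply: le_lt_trans hd; rewrite ler_wpM2l// lerDl.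
    rewrite mulrC -mulrA ler_wpM2l// mulrC -mulrA ger_pMr//.
    rewrite mulrC ler_pdivrMr// mul1r lerDl//.
  split.
    apply/cvg_ex; exists 0; exact: C.
  exact: (cvg_lim _ C).
have [|||c _] := @MVT_segment _ (fun t => p (f (l t))) (cst 0) 0 1.
- exact: ler01.
- move=> t; rewrite in_itv /= => /andP[/ltW a1 /ltW a2]; apply: dp; by rewrite a1.
- apply: continuous_subspace_itv => t; rewrite in_itv /= => t01.
  have [dt _] := dp _ t01.
  exact/differentiable_continuous/derivable1_diffP.
rewrite /= mul0r /l mul1r mul0r addr0 [z + _]addrC subrK => /eqP; rewrite subr_eq0 => /eqP ->.
by [].
Qed.

(** A derivative D <> 0 at z would push |f| above 1: a step h of length t with D h = t |D| f(z)
    raises the modulus by t |D| to first order, while the error is at most half of that. *)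
Lemma unimodular_cst f : holomorphic f ->
  (forall z, upper_half_plane z -> normc (f z) = 1) ->
  forall z w, upper_half_plane z -> upper_half_plane w -> f z = f w.
Proof.
move=> hf f1; apply: cderiv0_cst => z Uz.
have /derivable_cderiv[D HD] := hf _ Uz.
suff -> : 0 = D by [].
apply/esym/eqP/negPn/negP => D0.
have fz : f z != 0 by rewrite -normc_gt0 f1.
have nD : 0 < normc D by rewrite normc_gt0.
have [d d0 Hd] := HD _ (divr_gt0 nD (ltr0n _ 2)).
have [d2 d20 Hd2] := (nbhsCP _ _).1 (open_upper_half_plane Uz).
pose t := Num.min d d2 / 2.
have t0 : 0 < t by rewrite divr_gt0// lt_min d0.
have [td td2] : t < d /\ t < d2.
  have : t < Num.min d d2.
    rewrite /t; have : 0 < Num.min d d2 by rewrite lt_min d0 d20.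
    by move: (Num.min _ _) => m m0; lra.
  by rewrite lt_min => /andP.
pose h : CC R := (t * normc D)%:C * f z / D.
have nh : normc h = t.
  rewrite /h !normcM normcV normcR f1// mulr1 (ger0_norm (mulr_ge0 (ltW t0) (normc_ge0 D))).
  by rewrite mulfK// gt_eqF.
have := Hd (h + z); rewrite addrK nh => /(_ td).
have U : upper_half_plane (h + z) by apply: Hd2; rewrite addrK nh.
have Dh : D * h = (t * normc D)%:C * f z by rewrite /h mulrC divfK.
have N : normc (f z + D * h) = 1 + t * normc D.
  rewrite Dh -{1}(mul1r (f z)) -mulrDl normcM f1// mulr1.
  by rewrite -(rmorph1 (real_complex R)) -rmorphD normcR (ger0_norm (addr_ge0 ler01 (mulr_ge0 (ltW t0) (normc_ge0 D)))).
have := normcB_ge (f z + D * h) (f (h + z)).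
rewrite N f1// normcBC opprD addrA => K1 K2.
have : 0 < normc D * t by rewrite mulr_gt0.
by lra.
Qed.
End ComplexBasics.

(** * Cauchy theorem on rectangles *)

Section Goursat.
Variable R : realType.
Local Notation mu := (@lebesgue_measure R).
Implicit Types (a b c d t s M : R) (f : CC R -> CC R) (g : R -> CC R).

Definition cint a b g : CC R :=
  (\int[mu]_(t in `[a, b]) complex.Re (g t)) +i*
  (\int[mu]_(t in `[a, b]) complex.Im (g t)).

Definition ccont a b g := forall t, a <= t <= b -> {for t, continuous g}.

Lemma cvg_Re g t (l : CC R) : g s @[s --> t] --> l -> complex.Re (g s) @[s --> t] --> complex.Re l.
Proof. by move=> h; apply: (cvg_comp _ _ h); exact: continuous_Re. Qed.

Lemma cvg_Im g t (l : CC R) : g s @[s --> t] --> l -> complex.Im (g s) @[s --> t] --> complex.Im l.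
Proof. by move=> h; apply: (cvg_comp _ _ h); exact: continuous_Im. Qed.

Lemma ccont_int a b g : ccont a b g ->
  mu.-integrable `[a, b] (EFin \o (fun t => complex.Re (g t))) /\
  mu.-integrable `[a, b] (EFin \o (fun t => complex.Im (g t))).
Proof.
move=> cg; split; apply: continuous_compact_integrable; try exact: segment_compact.
  apply: continuous_in_subspaceT => t; rewrite inE /= in_itv /= => /cg gt.
  exact: (cvg_Re gt).
apply: continuous_in_subspaceT => t; rewrite inE /= in_itv /= => /cg gt.
exact: (cvg_Im gt).
Qed.

Lemma ccontB a b g1 g2 : ccont a b g1 -> ccont a b g2 -> ccont a b (fun t => g1 t - g2 t).
Proof. by move=> h1 h2 t tab; apply: cvgB; [exact: h1|exact: h2]. Qed.

Lemma ccont_cst a b (A : CC R) : ccont a b (fun=> A).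
Proof. by move=> t _; exact: cvg_cst. Qed.

Lemma cintD a b g1 g2 : ccont a b g1 -> ccont a b g2 ->
  cint a b (fun t => g1 t + g2 t) = cint a b g1 + cint a b g2.
Proof.
move=> /ccont_int[r1 i1] /ccont_int[r2 i2]; rewrite /cint; apply: complexP; rewrite !creimE /=.
  by rewrite -RintegralD//; apply: eq_Rintegral => t _; rewrite creD.
by rewrite -RintegralD//; apply: eq_Rintegral => t _; rewrite cimD.
Qed.

Lemma cintB a b g1 g2 : ccont a b g1 -> ccont a b g2 ->
  cint a b (fun t => g1 t - g2 t) = cint a b g1 - cint a b g2.
Proof.
move=> /ccont_int[r1 i1] /ccont_int[r2 i2]; rewrite /cint; apply: complexP; rewrite !creimE /=.
  by rewrite -RintegralB//; apply: eq_Rintegral => t _; rewrite !creimE.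
by rewrite -RintegralB//; apply: eq_Rintegral => t _; rewrite !creimE.
Qed.

Lemma cint_cst a b (A : CC R) : a <= b -> cint a b (fun=> A) = (b - a)%:C * A.
Proof.
move=> ab; rewrite /cint !Rintegral_cst//.
rewrite /= lebesgue_measure_itv /= lte_fin.
have -> : fine (if a < b then (b%:E - a%:E)%E else 0%E) = b - a.
  move: ab; rewrite le_eqVlt => /orP[/eqP->|->//]; by rewrite ltxx subrr.
by apply: complexP; rewrite !creimE /=; ring.
Qed.

Lemma Rint_split (p : R -> R) a b c : a <= b -> b <= c ->
  mu.-integrable `[a, c] (EFin \o p) ->
  \int[mu]_(t in `[a, c]) p t =
  \int[mu]_(t in `[a, b]) p t + \int[mu]_(t in `[b, c]) p t.
Proof.
move=> ab bc ip; have := @Rintegral_itvB _ p (BLeft a) (BRight c) b ip.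
rewrite !bnd_simp => /(_ ab bc) /eqP; rewrite subr_eq => /eqP ->.
rewrite addrC; congr (_ + _); apply: Rintegral_itv_obnd_cbnd.
apply: integrableS ip => //.
by apply: subset_itvr; rewrite bnd_simp.
Qed.

Lemma cint_split a b c g : a <= b -> b <= c -> ccont a c g ->
  cint a c g = cint a b g + cint b c g.
Proof.
move=> ab bc /ccont_int[r1 i1]; rewrite /cint; apply: complexP; rewrite !creimE /=;
exact: Rint_split.
Qed.

Lemma Rint_le (p : R -> R) a b M : a <= b -> mu.-integrable `[a, b] (EFin \o p) ->
  (forall t, a <= t <= b -> `|p t| <= M) -> `|\int[mu]_(t in `[a, b]) p t| <= M * (b - a).
Proof.
move=> ab ip pM; apply: le_trans (le_normr_Rintegral _ ip) _ => //.
apply: (@le_trans _ _ (\int[mu]_(t in `[a, b]) M)).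
  apply: le_Rintegral => //.
  - exact: integrable_norm.
  - apply: continuous_compact_integrable; first exact: segment_compact.
    by move=> ?; exact: cvg_cst.
rewrite Rintegral_cst// /= lebesgue_measure_itv /= lte_fin.
move: ab; rewrite le_eqVlt => /orP[/eqP->|->//]; by rewrite ltxx subrr !mulr0.
Qed.

Lemma cint_le a b g M : a <= b -> ccont a b g ->
  (forall t, a <= t <= b -> normc (g t) <= M) ->
  normc (cint a b g) <= 2 * (M * (b - a)).
Proof.
move=> ab /ccont_int[r1 i1] gM; apply: (le_trans (normc_le_ReIm _)) => /=.
have := Rint_le ab r1 (fun t tab => le_trans (Re_le_normc _) (gM t tab)).
have := Rint_le ab i1 (fun t tab => le_trans (Im_le_normc _) (gM t tab)).
lra.
Qed.

Definition in_rect a b c d (z : CC R) :=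
  (a <= complex.Re z <= b) /\ (c <= complex.Im z <= d).

(** The counterclockwise contour integral, with opposite sides paired under one integral; on
    vertical sides dz = i ds. *)
Definition rect f a b c d : CC R :=
  cint a b (fun t => f (t +i* c) - f (t +i* d)) +
  'i%C * cint c d (fun s => f (b +i* s) - f (a +i* s)).

Lemma continuous_hline c : continuous (fun t => (t +i* c) : CC R).
Proof. by move=> t; apply: (@cvg_ReIm _ _ (nbhs t)); [exact: cvg_id|exact: cvg_cst]. Qed.

Lemma continuous_vline a : continuous (fun s => (a +i* s) : CC R).
Proof. by move=> t; apply: (@cvg_ReIm _ _ (nbhs t)); [exact: cvg_cst|exact: cvg_id]. Qed.

Lemma ccont_h f a b c : (forall t, a <= t <= b -> {for (t +i* c : CC R), continuous f}) ->
  ccont a b (fun t => f (t +i* c)).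
Proof. by move=> h t /h cf; apply: continuous_comp cf; exact: continuous_hline. Qed.

Lemma ccont_v f a c d : (forall s, c <= s <= d -> {for (a +i* s : CC R), continuous f}) ->
  ccont c d (fun s => f (a +i* s)).
Proof. by move=> h t /h cf; apply: continuous_comp cf; exact: continuous_vline. Qed.

Definition rcont f a b c d := forall z, in_rect a b c d z -> {for z, continuous f}.

Lemma rcont_h f a b c d s : rcont f a b c d -> c <= s <= d -> ccont a b (fun t => f (t +i* s)).
Proof. by move=> h scd; apply: ccont_h => t tab; apply: h. Qed.

Lemma rcont_v f a b c d t : rcont f a b c d -> a <= t <= b -> ccont c d (fun s => f (t +i* s)).
Proof. by move=> h tab; apply: ccont_v => s scd; apply: h. Qed.

Lemma rcontS f a b c d a' b' c' d' : a <= a' -> b' <= b -> c <= c' -> d' <= d ->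
  rcont f a b c d -> rcont f a' b' c' d'.
Proof. by move=> aa bb cc dd h z [h1 h2]; apply: h; split; lra. Qed.

Lemma rect_vsplit f a m b c d : a <= m -> m <= b -> c <= d -> rcont f a b c d ->
  rect f a b c d = rect f a m c d + rect f m b c d.
Proof.
move=> am mb cd h; rewrite /rect (@cint_split a m b)//; last first.
  by apply: ccontB; apply: rcont_h h _; lra.
have -> : (fun s => f (b +i* s) - f (a +i* s)) =
    (fun s => (f (m +i* s) - f (a +i* s)) + (f (b +i* s) - f (m +i* s))).
  by apply/funext => s; ring.
rewrite (@cintD c d); first by rewrite mulrDr addrACA.
  by apply: ccontB; apply: rcont_v h _; lra.
by apply: ccontB; apply: rcont_v h _; lra.
Qed.

Lemma rect_hsplit f a b c m d : a <= b -> c <= m -> m <= d -> rcont f a b c d ->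
  rect f a b c d = rect f a b c m + rect f a b m d.
Proof.
move=> ab cm md h; rewrite /rect (@cint_split c m d)//; last first.
  by apply: ccontB; apply: rcont_v h _; lra.
have -> : (fun s => f (s +i* c) - f (s +i* d)) =
    (fun s => (f (s +i* c) - f (s +i* m)) + (f (s +i* m) - f (s +i* d))).
  by apply/funext => s; ring.
rewrite (@cintD a b); first by rewrite mulrDr addrACA.
  by apply: ccontB; apply: rcont_h h _; lra.
by apply: ccontB; apply: rcont_h h _; lra.
Qed.

(** Affine functions have contour integral zero by direct computation, so only the error M is
    integrated. One factor 2 comes from pairing opposite sides, the other from |z| <= |Re z| + |Im
    z|. *)
Lemma rect_affine_le f a b c d (A B : CC R) M : a <= b -> c <= d -> rcont f a b c d ->
  (forall z, in_rect a b c d z -> normc (f z - A - B * z) <= M) ->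
  normc (rect f a b c d) <= 4 * M * ((b - a) + (d - c)).
Proof.
move=> ab cd h fM.
set u : CC R := B * ('i%C * (c - d)%:C); set v : CC R := B * (b - a)%:C.
have E1 : (fun t => f (t +i* c) - f (t +i* d)) = (fun t => u + (f (t +i* c) - f (t +i* d) - u)).
  by apply/funext => t; rewrite [RHS]addrC subrK.
have E2 : (fun s => f (b +i* s) - f (a +i* s)) = (fun s => v + (f (b +i* s) - f (a +i* s) - v)).
  by apply/funext => s; rewrite [RHS]addrC subrK.
have C1 : ccont a b (fun t => f (t +i* c) - f (t +i* d) - u).
  by apply: ccontB; [apply: ccontB|exact: ccont_cst]; apply: rcont_h h _; lra.
have C2 : ccont c d (fun s => f (b +i* s) - f (a +i* s) - v).
  by apply: ccontB; [apply: ccontB|exact: ccont_cst]; apply: rcont_v h _; lra.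
rewrite /rect E1 E2 (cintD (@ccont_cst a b u) C1) (cintD (@ccont_cst c d v) C2) !cint_cst//.
set X := cint a b _; set Y := cint c d _.
have -> : (b - a)%:C * u + X + 'i%C * ((d - c)%:C * v + Y) = X + 'i%C * Y.
  by rewrite /u /v !rmorphB /=; ring.
have NX : normc X <= 2 * ((2 * M) * (b - a)).
  apply: cint_le => // t tab.
  rewrite [X in normc X](_ : _ = (f (t +i* c) - A - B * (t +i* c)) - (f (t +i* d) - A - B * (t +i* d))).
    apply: le_trans (normcB_le _ _) _.
    have := fM (t +i* c); have := fM (t +i* d); rewrite /in_rect /= !lexx cd => H1 H2.
    by have := H1 (conj tab isT); have := H2 (conj tab isT); lra.
  by rewrite [t +i* c]complexE [t +i* d]complexE /u /= rmorphB /=; ring.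
have NY : normc Y <= 2 * ((2 * M) * (d - c)).
  apply: cint_le => // s tab.
  rewrite [X in normc X](_ : _ = (f (b +i* s) - A - B * (b +i* s)) - (f (a +i* s) - A - B * (a +i* s))).
    apply: le_trans (normcB_le _ _) _.
    have := fM (b +i* s); have := fM (a +i* s); rewrite /in_rect /= !lexx ab => H1 H2.
    by have := H1 (conj isT tab); have := H2 (conj isT tab); lra.
  by rewrite [a +i* s]complexE [b +i* s]complexE /v /= rmorphB /=; ring.
by apply: le_trans (normcD_le _ _) _; rewrite normcM normci mul1r; lra.
Qed.

Lemma rect_le f a b c d M : a <= b -> c <= d -> rcont f a b c d ->
  (forall z, in_rect a b c d z -> normc (f z) <= M) ->
  normc (rect f a b c d) <= 4 * M * ((b - a) + (d - c)).
Proof.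
move=> ab cd h fM; apply: (rect_affine_le (A := 0) (B := 0) ab cd h) => z /fM.
by rewrite mul0r !subr0.
Qed.

(** * Goursat's bisection *)

Section Bisection.
Variables (f : CC R -> CC R) (a b c d : R).
Hypotheses (ab : a < b) (cd : c < d) (fc : rcont f a b c d).

Let W n := (b - a) / 2 ^+ n.
Let H n := (d - c) / 2 ^+ n.
Let r n (p : R * R) := normc (rect f p.1 (p.1 + W n) p.2 (p.2 + H n)).

(** The lower left corner encodes the whole rectangle, the side lengths [W n] and [H n] being fixed
    at stage n. The chosen quarter carries at least a fourth of the contour integral; for the last
    branch this is proved in [bisect_rect]. *)
Definition bisect_step n (p : R * R) : R * R :=
  let w := W n.+1 in let h := H n.+1 in
  if r n p <= 4 * r n.+1 p then p else
  if r n p <= 4 * r n.+1 (p.1 + w, p.2) then (p.1 + w, p.2) else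
  if r n p <= 4 * r n.+1 (p.1, p.2 + h) then (p.1, p.2 + h) else (p.1 + w, p.2 + h).

Fixpoint bisect n : R * R := if n is m.+1 then bisect_step m (bisect m) else (a, c).

Let W_gt0 n : 0 < W n. Proof. by rewrite divr_gt0 ?exprn_gt0// subr_gt0. Qed.
Let H_gt0 n : 0 < H n. Proof. by rewrite divr_gt0 ?exprn_gt0// subr_gt0. Qed.
Let WS n : W n = W n.+1 + W n.+1. Proof. by rewrite /W exprS invfM; field. Qed.
Let HS n : H n = H n.+1 + H n.+1. Proof. by rewrite /H exprS invfM; field. Qed.

Lemma bisect_range n : [/\ (bisect n).1 <= (bisect n.+1).1,
   (bisect n.+1).1 + W n.+1 <= (bisect n).1 + W n,
   (bisect n).2 <= (bisect n.+1).2 & (bisect n.+1).2 + H n.+1 <= (bisect n).2 + H n].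
Proof.
have := W_gt0 n.+1; have := H_gt0 n.+1; rewrite (WS n) (HS n) /= /bisect_step.
by case: ifP => _; [|case: ifP => _; [|case: ifP => _]]; move=> /= h w; split; lra.
Qed.

Lemma bisect_rangeD n k : [/\ (bisect n).1 <= (bisect (n + k)).1,
   (bisect (n + k)).1 + W (n + k) <= (bisect n).1 + W n,
   (bisect n).2 <= (bisect (n + k)).2 & (bisect (n + k)).2 + H (n + k) <= (bisect n).2 + H n].
Proof.
elim: k => [|k [h1 h2 h3 h4]]; first by rewrite addn0.
have [k1 k2 k3 k4] := bisect_range (n + k); rewrite addnS; split; lra.
Qed.

Let in0 n : [/\ a <= (bisect n).1, (bisect n).1 + W n <= b, c <= (bisect n).2 & (bisect n).2 + H n <= d].
Proof.
have := bisect_rangeD 0 n; rewrite add0n /= /W /H expr0 !divr1 => -[]; split; lra.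
Qed.

Lemma bisect_rect n : normc (rect f a b c d) <= 4 ^+ n * r n (bisect n).
Proof.
elim: n => [|n IH].
  by rewrite expr0 mul1r /r /= /W /H expr0 !divr1 ![_ + (_ - _)]addrC !subrK.
apply: (le_trans IH); rewrite exprS [4 * _]mulrC -mulrA ler_wpM2l ?exprn_ge0//.
rewrite /= /bisect_step.
have [i1 i2 i3 i4] := in0 n; have w0 := W_gt0 n.+1; have h0 := H_gt0 n.+1.
move: (WS n) (HS n) => WSn HSn; set p := bisect n in i1 i2 i3 i4 *.
have E : rect f p.1 (p.1 + W n) p.2 (p.2 + H n) =
  rect f p.1 (p.1 + W n.+1) p.2 (p.2 + H n.+1) +
  rect f p.1 (p.1 + W n.+1) (p.2 + H n.+1) (p.2 + H n.+1 + H n.+1) +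
  (rect f (p.1 + W n.+1) (p.1 + W n.+1 + W n.+1) p.2 (p.2 + H n.+1) +
  rect f (p.1 + W n.+1) (p.1 + W n.+1 + W n.+1) (p.2 + H n.+1) (p.2 + H n.+1 + H n.+1)).
  rewrite WSn HSn !(addrA p.1) !(addrA p.2).
  move: (W n.+1) (H n.+1) (W n) (H n) w0 h0 WSn HSn i1 i2 i3 i4 => w h W' H' w0 h0 ? ? i1 i2 i3 i4.
  have K : rcont f p.1 (p.1 + w + w) p.2 (p.2 + h + h) by apply: rcontS fc; lra.
  move: (p.1) (p.2) w0 h0 K {i1 i2 i3 i4} => x y w0 h0 K.
  have [? ? ? ?] : [/\ x <= x + w, x + w <= x + w + w, y <= y + h & y + h <= y + h + h] by split; lra.
  rewrite (@rect_vsplit f x (x + w))//; last lra.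
  rewrite (@rect_hsplit f x (x + w) y (y + h))//; last by apply: rcontS K; lra.
  have K2 : rcont f (x + w) (x + w + w) y (y + h + h) by apply: rcontS K; lra.
  by rewrite (@rect_hsplit f (x + w) (x + w + w) y (y + h) (y + h + h)).
case: ifP => // /negbT; rewrite -ltNge => h1.
case: ifP => // /negbT; rewrite -ltNge => h2.
case: ifP => // /negbT; rewrite -ltNge => h3.
(* If the fourth quarter failed as well, the four contour integrals would sum to less than the
   whole. *)
rewrite leNgt; apply/negP => h4.
suff : r n p <= r n.+1 p + r n.+1 (p.1, p.2 + H n.+1) + (r n.+1 (p.1 + W n.+1, p.2) +
    r n.+1 (p.1 + W n.+1, p.2 + H n.+1)) by clear -h1 h2 h3 h4 => K; lra.
rewrite {1}/r E; apply: le_trans (normcD_le _ _) _; apply: lerD; exact: normcD_le.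
Qed.

Lemma bisect_limit : exists z : CC R, forall n,
  in_rect (bisect n).1 ((bisect n).1 + W n) (bisect n).2 ((bisect n).2 + H n) z.
Proof.
suff K (u w : R^nat) : (forall n k, u n <= u (n + k)%N) -> (forall n k, u (n + k)%N <= w n) ->
    exists l, forall n, u n <= l <= w n.
  have [x Hx] : exists x, forall n, (bisect n).1 <= x <= (bisect n).1 + W n.
    apply: K => n k; have [] := bisect_rangeD n k; have := W_gt0 (n + k); lra.
  have [y Hy] : exists y, forall n, (bisect n).2 <= y <= (bisect n).2 + H n.
    apply: K => n k; have [] := bisect_rangeD n k; have := H_gt0 (n + k); lra.
  by exists (x +i* y) => n; split => /=.
move=> uu uw; exists (sup (range u)) => n.
have us : has_sup (range u).
  split; first by exists (u 0%N), 0%N.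
  by exists (w 0%N) => _ [m _ <-]; exact: (uw 0%N m).
apply/andP; split; first by apply: sup_upper_bound => //; exists n.
apply: ge_sup; first by exists (u 0%N), 0%N.
move=> _ [m _ <-]; apply: (le_trans _ (uw n m)); rewrite addnC; exact: uu.
Qed.

Lemma goursat_strict : (forall z, in_rect a b c d z -> derivable f z 1) -> rect f a b c d = 0.
Proof.
move=> df; apply/eqP; rewrite -normc_eq0; apply/negPn/negP => R0.
have {}R0 : 0 < normc (rect f a b c d) by rewrite lt_def R0 normc_ge0.
have [z zn] := bisect_limit.
have zr : in_rect a b c d z by case: (zn 0%N) => /=; rewrite /W /H expr0 !divr1; split; lra.
have /derivable_cderiv[D HD] := df _ zr.
set S := (b - a) + (d - c); have S0 : 0 < S by rewrite addr_gt0// subr_gt0.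
(* With tolerance |rect| / (8 S^2), a rectangle of semiperimeter S / 2^n has contour integral at
   most 4 |rect| / (8 * 4^n), so 4^n such bounds give only half of |rect|. *)
have [e e0 He] := HD _ (divr_gt0 R0 (mulr_gt0 (ltr0n _ 8) (exprn_gt0 2 S0))).
have [n Hn] : exists n : nat, S / 2 ^+ n < e.
  have : S / e < (2 : R) ^+ (Num.trunc (S / e)).+1.
    apply: (lt_le_trans (truncnS_gt _)).
    by rewrite -natrX ler_nat ltnW// ltn_expl.
  rewrite ltr_pdivrMr// => h; exists (Num.trunc (S / e)).+1.
  by rewrite ltr_pdivrMr ?exprn_gt0// mulrC.
have [i1 i2 i3 i4] := in0 n.
have SE : W n + H n = S / 2 ^+ n by rewrite /W /H -mulrDl.
have := bisect_rect n; rewrite leNgt => /negP; apply.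
have X : r n (bisect n) <= 4 * (normc (rect f a b c d) / (8 * S ^+ 2) * (W n + H n)) * (W n + H n).
  rewrite /r.
  have -> : W n + H n = ((bisect n).1 + W n - (bisect n).1) + ((bisect n).2 + H n - (bisect n).2) by ring.
  apply: (@rect_affine_le _ _ _ _ _ (f z - D * z) D).
  - by rewrite lerDl ltW.
  - by rewrite lerDl ltW.
  - by apply: rcontS fc; lra.
  move=> w [w1 w2].
  have wz : normc (w - z) <= W n + H n.
    apply: (le_trans (normc_le_ReIm _)); rewrite !creimE; have [z1 z2] := zn n.
    by apply: lerD; rewrite ler_norml; lra.
  have -> : f w - (f z - D * z) - D * w = f w - f z - D * (w - z) by ring.
  apply: le_trans (He _ _) _; first by rewrite (le_lt_trans wz)// SE.
  apply: ler_wpM2l; last lra.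
  by rewrite divr_ge0 ?mulr_ge0 ?normc_ge0 ?exprn_ge0 ?ltW.
apply: (@le_lt_trans _ _ (4 ^+ n * (4 * (normc (rect f a b c d) / (8 * S ^+ 2) * (W n + H n)) * (W n + H n)))).
  by rewrite ler_wpM2l// exprn_ge0.
rewrite SE.
have -> : (4 : R) ^+ n = 2 ^+ n * 2 ^+ n by rewrite -exprMn -natrM.
have p0 : (2 : R) ^+ n != 0 by rewrite expf_neq0.
rewrite [ltLHS](_ : _ = normc (rect f a b c d) / 2); first lra.
by field; rewrite p0 gt_eqF.
Qed.

End Bisection.

Lemma cint_pt a g : cint a a g = 0.
Proof. by rewrite /cint set_itv1 !Rintegral_set1. Qed.

Lemma rect_degenv f a c d : c <= d -> rect f a a c d = 0.
Proof.
move=> cd; rewrite /rect cint_pt.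
have -> : (fun s => f (a +i* s) - f (a +i* s)) = (fun=> 0) by apply/funext => s; rewrite subrr.
by rewrite cint_cst// !mulr0 addr0.
Qed.

Lemma rect_degenh f a b c : a <= b -> rect f a b c c = 0.
Proof.
move=> ab; rewrite /rect cint_pt.
have -> : (fun s => f (s +i* c) - f (s +i* c)) = (fun=> 0) by apply/funext => s; rewrite subrr.
by rewrite cint_cst// !mulr0 addr0.
Qed.

Lemma goursat f a b c d : a <= b -> c <= d ->
  (forall z, in_rect a b c d z -> derivable f z 1) -> rect f a b c d = 0.
Proof.
rewrite le_eqVlt => /orP[/eqP -> cd _|ab]; first exact: rect_degenv.
rewrite le_eqVlt => /orP[/eqP -> _|cd df]; first exact: rect_degenh (ltW ab).
apply: (goursat_strict ab cd _ df) => z zr.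
by have /derivable_cderiv[D HD] := df z zr; exact: has_cderiv_cts HD.
Qed.

(** Serves for difference quotients, which are only known to be continuous at their centre. Cutting
    out a square of half-side t leaves four rectangles free of the point; continuity bounds the
    contour integral over the square by 16 M t. *)
Lemma goursat_punctured f a b c d (z0 : CC R) :
  a < complex.Re z0 < b -> c < complex.Im z0 < d -> rcont f a b c d ->
  (forall z, in_rect a b c d z -> z != z0 -> derivable f z 1) -> rect f a b c d = 0.
Proof.
case: z0 => p q /= /andP[ap pb] /andP[cq qd] fc df.
have G a' b' c' d' : a <= a' -> a' <= b' -> b' <= b -> c <= c' -> c' <= d' -> d' <= d ->
    [|| b' < p, p < a', d' < q | q < c'] -> rect f a' b' c' d' = 0.
  move=> h1 h2 h3 h4 h5 h6 out; apply: goursat => // z [z1 z2].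
  apply: df; first by split; lra.
  apply/eqP => zp; move: out z1 z2; rewrite zp /= => /or4P[] ? ? ?; lra.
have /fc/cvgCP/(_ _ ltr01)[e e0 He] : in_rect a b c d (p +i* q) by split => /=; lra.
set M := normc (f (p +i* q)) + 1.
have M0 : 0 < M by rewrite /M ltr_wpDl// normc_ge0.
apply/eqP; rewrite -normc_eq0; apply/negPn/negP => R0.
have {}R0 : 0 < normc (rect f a b c d) by rewrite lt_def R0 normc_ge0.
have [t t0 [t1 t2 t3 t4 t5]] : exists2 t, 0 < t &
    [/\ 3 * t < e, 16 * M * t < normc (rect f a b c d), a < p - t /\ p + t < b, c < q - t & q + t < d].
  pose m := Num.min (Num.min (e / 3) (normc (rect f a b c d) / (16 * M)))
    (Num.min (Num.min (p - a) (b - p)) (Num.min (q - c) (d - q))).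
  have m0 : 0 < m.
    by rewrite !lt_min !subr_gt0 ap pb cq qd !divr_gt0// mulr_gt0.
  exists (m / 2); first by rewrite divr_gt0.
  have : m / 2 < m by lra.
  move: (m / 2) => t; rewrite !lt_min => /andP[/andP[t1 t2] /andP[/andP[t3 t4] /andP[t5 t6]]].
  move: t2; rewrite ltr_pdivlMr ?mulr_gt0// mulrC => t2.
  by split; [lra|exact: t2|split; lra|lra|lra].
case: t3 => t31 t32.
have [s1 s2] : p - t <= p + t /\ q - t <= q + t by lra.
have E : rect f a b c d = rect f (p - t) (p + t) (q - t) (q + t).
  rewrite (@rect_vsplit f a (p - t)) //; [|lra|lra|lra].
  rewrite (@rect_vsplit f (p - t) (p + t)) //; [|lra|lra|apply: rcontS fc; lra].
  rewrite (@rect_hsplit f (p - t) (p + t) c (q - t)) //; [|lra|lra|apply: rcontS fc; lra].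
  rewrite (@rect_hsplit f (p - t) (p + t) (q - t) (q + t)) //; [|lra|apply: rcontS fc; lra].
  have Z1 : rect f a (p - t) c d = 0 by apply: G; lra.
  have Z2 : rect f (p + t) b c d = 0 by apply: G; lra.
  have Z3 : rect f (p - t) (p + t) c (q - t) = 0 by apply: G; lra.
  have Z4 : rect f (p - t) (p + t) (q + t) d = 0 by apply: G; lra.
  by rewrite Z1 Z2 Z3 Z4 !add0r !addr0.
suff : normc (rect f a b c d) <= 4 * M * (((p + t) - (p - t)) + ((q + t) - (q - t))) by lra.
rewrite E; apply: rect_le => //; first by apply: rcontS fc; lra.
move=> z [z1 z2].
have : normc (z - p +i* q) < e.
  apply: (le_lt_trans (normc_le_ReIm _)); rewrite !creimE /=.
  have [] : `|complex.Re z - p| <= t /\ `|complex.Im z - q| <= t by rewrite !ler_norml; lra.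
  by lra.
move=> /He; have := normcB_ge (f z) (f (p +i* q)); rewrite /M; lra.
Qed.

End Goursat.

(** * Poisson majorization *)

Section SubPoisson.
Variable R : realType.
Local Notation mu := (@lebesgue_measure R).
Implicit Types (x y t N : R) (z : CC R) (f : CC R -> CC R).

Lemma FTC2_everywhere (f F : R -> R) a b : a < b -> continuous f ->
  (forall t, is_derive t 1 F (f t)) ->
  (\int[mu]_(t in `[a, b]) (f t)%:E = (F b - F a)%:E)%E.
Proof.
move=> ab cf dF.
have cF : continuous F.
  by move=> t; apply/differentiable_continuous/derivable1_diffP; case: (dF t).
rewrite EFinB; apply: continuous_FTC2 => //.
- exact: continuous_subspaceT.
- split => //.
  + exact/cvg_at_right_filter/cF.
  + exact/cvg_at_left_filter/cF.
- by move=> t _; rewrite derive1E; case: (dF t).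
Qed.

Lemma continuous_poisson_kernel y x : 0 < y -> continuous (fun t => poisson_kernel y (x - t)).
Proof.
move=> y0 t; rewrite /poisson_kernel; apply: cvgM; first exact: cvg_cst.
apply: cvgM; first exact: cvg_cst.
apply: cvgV; first by rewrite gt_eqF// ltr_wpDl ?sqr_ge0// exprn_gt0.
apply: cvgD; last exact: cvg_cst.
by apply: (@continuous_comp _ _ _ (fun t => x - t) (fun s => s ^+ 2));
  [apply: cvgB; [exact: cvg_cst|exact: cvg_id]|exact: exprn_continuous].
Qed.

Lemma poisson_kernel_gt0 y x : 0 < y -> 0 < poisson_kernel y x.
Proof.
move=> y0; rewrite /poisson_kernel mulr_gt0 ?invr_gt0 ?pi_gt0// divr_gt0//.
by rewrite ltr_wpDl ?sqr_ge0// exprn_gt0.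
Qed.

Lemma is_derive_poisson_primitive y x t : 0 < y ->
  is_derive t 1 (fun t => pi^-1 * atan ((t - x) / y)) (poisson_kernel y (x - t)).
Proof.
move=> y0.
have d1 : is_derive t 1 (fun t => (t - x) / y) y^-1.
  have -> : (fun t => (t - x) / y) = (fun t => y^-1 *: (t - x)).
    by apply/funext => s; rewrite mulrC.
  apply: is_derive_eq; by rewrite subr0 [_ *: _]mulr1.
have d2 := is_derive1_atan ((t - x) / y).
have := @is_derive1_comp _ (@atan R) (fun t => (t - x) / y) t _ _ d2 d1.
move=> d3; apply: is_derive_eq.
rewrite /poisson_kernel -[_ *: _]/(pi^-1 * _) /=.
have n0 : (x - t) ^+ 2 + y ^+ 2 != 0.
  by rewrite gt_eqF// ltr_wpDl ?sqr_ge0// exprn_gt0.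
congr (_ * _); rewrite expr_div_n -[t - x]opprB sqrrN.
rewrite -[1](@divff _ (y ^+ 2)) ?expf_neq0 ?gt_eqF// -mulrDl invf_div addrC.
by field; rewrite n0 gt_eqF.
Qed.

Lemma integral_poisson_kernel_ball y x N : 0 < y -> 0 < N ->
  (\int[mu]_(t in `[(x - N)%R, (x + N)%R]) (poisson_kernel y (x - t))%:E =
   (2 / pi * atan (N / y))%:E)%E.
Proof.
move=> y0 N0.
have ab : x - N < x + N by rewrite ltrD2l; lra.
rewrite (FTC2_everywhere ab (continuous_poisson_kernel (x := x) y0)
  (fun t => is_derive_poisson_primitive x t y0)).
congr (_%:E); rewrite [x + N]addrC addrK [x - N]addrC addrK mulNr atanN.
by ring.
Qed.

Lemma derivable_subc f z (c : CC R) : derivable f z 1 -> derivable (fun w => f w - c) z 1.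
Proof.
move=> /derivable_cderiv[D HD]; apply/derivable_cderiv; exists D => e /HD[d d0 Hd].
by exists d => // w /Hd; rewrite opprB addrA subrK.
Qed.

Lemma has_cderiv_near f (g : CC R -> CC R) z D d : 0 < d ->
  (forall w, normc (w - z) < d -> f w = g w) -> has_cderiv f z D -> has_cderiv g z D.
Proof.
move=> d0 fg H e e0; have [d' d'0 Hd] := H _ e0.
exists (Num.min d d'); first by rewrite lt_min d0.
move=> w; rewrite lt_min => /andP[/fg <- /Hd].
by rewrite -(fg z) // subrr normc0.
Qed.

Lemma derivable_near f (g : CC R -> CC R) z d : 0 < d ->
  (forall w, normc (w - z) < d -> f w = g w) -> derivable f z 1 -> derivable g z 1.
Proof.
move=> d0 fg /derivable_cderiv[D HD]; apply/derivable_cderiv; exists D.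
exact: (has_cderiv_near d0 fg).
Qed.

Lemma derivable_cts f z : derivable f z 1 -> {for z, continuous f}.
Proof. by move=> /derivable_cderiv[D HD]; exact: has_cderiv_cts HD. Qed.

(** * Cauchy's theorem against the Poisson kernel *)

Section Reflection.
Variables (f : CC R -> CC R) (z : CC R).
Hypothesis y0 : 0 < complex.Im z.
Hypothesis df : forall w : CC R, 0 <= complex.Im w -> derivable f w 1.
Local Notation x := (complex.Re z).
Local Notation y := (complex.Im z).

(* The quotient (f - f(z)) / ((w - z)(w - conj z)), extended by continuity to [w = z]:
   on the real line its denominator is (pi / y) times the inverse Poisson kernel. *)
Definition poisson_quotient (D w : CC R) : CC R :=
  (if w == z then D else (f w - f z) / (w - z)) / (w - z^*).

Let refl_neq0 (w : CC R) : 0 <= complex.Im w -> w - z^* != 0.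
Proof.
move=> w0; apply/eqP => /(congr1 (@complex.Im R)); case: z y0 => a b /= b0.
rewrite !creimE /= opprK => h; lra.
Qed.

Lemma derivable_poisson_quotient D (w : CC R) : 0 <= complex.Im w -> w != z ->
  derivable (poisson_quotient D) w 1.
Proof.
move=> w0 wz; have wz0 : w - z != 0 by rewrite subr_eq0.
have d0 : 0 < normc (w - z) by rewrite normc_gt0.
apply: (@derivable_near (fun v => (f v - f z) / (v - z) / (v - z^*)) _ w (normc (w - z)) d0).
  move=> v vw; rewrite /poisson_quotient; case: eqP => // E.
  by move: vw; rewrite E normcBC ltxx.
apply: derivableM; last first.
  by apply: derivableV; [exact: refl_neq0|apply: derivable_subc; exact: derivable_id].
apply: derivableM; first by apply: derivable_subc; exact: df.
by apply: derivableV => //; apply: derivable_subc; exact: derivable_id.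
Qed.

Lemma continuous_poisson_quotient D : has_cderiv f z D -> {for z, continuous (poisson_quotient D)}.
Proof.
move=> HD; have zz := refl_neq0 (ltW y0).
apply: (@cvgM _ _ (nbhs z)); last first.
  by apply: (@cvgV _ _ (nbhs z)) => //; apply: (@cvgB _ _ _ (nbhs z)); [exact: cvg_id|exact: cvg_cst].
apply/cvgCP => e e0; rewrite eqxx.
have [d d0 Hd] := HD _ (divr_gt0 e0 (ltr0n _ 2)).
exists d => // w /Hd; case: eqP => [_ _|/eqP wz]; first by rewrite subrr normc0.
have wz0 : 0 < normc (w - z) by rewrite normc_gt0 subr_eq0.
move=> H; rewrite -(@ltr_pM2r _ (normc (w - z)))// -normcM mulrBl divfK ?subr_eq0//.
by apply: (le_lt_trans H); rewrite ltr_pM2r//; lra.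
Qed.

(** The contour is that of [x - N, x + N] x [0, N]. Its bottom side yields the Poisson integral of f
    - f(z), and 2/pi atan(N/y) is the mass of the kernel there. On the other sides both z and conj z
    are at distance at least N/2, so |q| <= 8M / N^2: the top contributes 32 M/N and the two
    vertical sides together 32 M/N. *)
Lemma poisson_quotient_le D N M : 0 < N -> 2 * y <= N ->
  has_cderiv f z D ->
  (forall w : CC R, 0 <= complex.Im w -> normc (w - x%:C) <= 2 * N -> normc (f w) <= M) ->
  complex.Re (f z) * (2 / pi * atan (N / y)) <=
  \int[mu]_(t in `[x - N, x + N]) (poisson_kernel y (x - t) * normc (f t%:C)) +
  64 * (y / pi) * M / N.
Proof.
move=> N0 yN HD fM.
set q := poisson_quotient D.
have pi0 : 0 < (pi : R) by exact: pi_gt0.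
have yy : (0 : R) < y := y0.
have M0 : 0 <= M.
  apply: (le_trans (normc_ge0 (f x%:C))); apply: fM => /=; first by [].
  by rewrite !subrr expr0n addr0 sqrtr0; lra.
have fzM : normc (f z) <= M.
  apply: fM; first exact: ltW.
  apply: (le_trans (normc_le_ReIm _)); rewrite !creimE /= subrr normr0 add0r subr0.
  by rewrite (ger0_norm (ltW y0)); move: yN y0; move: y => v; lra.
have xN : x - N <= x + N by lra.
have qc : rcont q (x - N) (x + N) 0 N.
  move=> w [_ /andP[w0 _]]; have [->|wz] := eqVneq w z; first exact: continuous_poisson_quotient.
  by apply: derivable_cts; exact: derivable_poisson_quotient.
have R0 : rect q (x - N) (x + N) 0 N = 0.
  apply: (@goursat_punctured _ _ _ _ _ _ z) => //; [lra|lra|].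
  by move=> w [_ /andP[w0 _]]; exact: derivable_poisson_quotient.
have qM (w : CC R) : 0 <= complex.Im w -> N / 2 <= normc (w - z) -> N / 2 <= normc (w - z^*) ->
    normc (w - x%:C) <= 2 * N -> normc (q w) <= 8 * M / N ^+ 2.
  move=> w0 wz wzc wN; have N20 : 0 < N / 2 by lra.
  have wz0 : 0 < normc (w - z) by apply: lt_le_trans wz.
  have wzc0 : 0 < normc (w - z^*) by apply: lt_le_trans wzc.
  rewrite /q /poisson_quotient ifN; last by rewrite -subr_eq0 -normc_gt0.
  rewrite !normcM !normcV -mulrA -invfM ler_pdivrMr ?mulr_gt0//.
  have : normc (f w - f z) <= 2 * M.
    by apply: (le_trans (normcB_le _ _)); have := fM _ w0 wN; lra.
  move=> h; apply: (le_trans h).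
  have : N / 2 * (N / 2) <= normc (w - z) * normc (w - z^*) by apply: ler_pM => //; exact: ltW.
  move=> h2; apply: (@le_trans _ _ (8 * M / N ^+ 2 * (N / 2 * (N / 2)))); last first.
    by rewrite ler_wpM2l// divr_ge0 ?mulr_ge0 ?exprn_ge0// ltW.
  by rewrite le_eqVlt; apply/orP; left; apply/eqP; field; rewrite gt_eqF.
have Rezc : complex.Re (z^*) = x by case: (z).
have Imzc : complex.Im (z^*) = - y by case: (z).
have top t : x - N <= t <= x + N -> normc (q (t +i* N)) <= 8 * M / N ^+ 2.
  move=> tN; apply: qM; first by rewrite /=; lra.
  - apply: le_trans (Im_le_normc _); rewrite !creimE /= ger0_norm; lra.
  - apply: le_trans (Im_le_normc _); rewrite !creimE /= Imzc ger0_norm; lra.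
  apply: (le_trans (normc_le_ReIm _)); rewrite !creimE /= subr0 (ger0_norm (ltW N0)).
  suff : `|t - x| <= N by lra.
  by rewrite ler_norml; lra.
have right s : 0 <= s <= N -> normc (q ((x + N) +i* s)) <= 8 * M / N ^+ 2.
  move=> sN; apply: qM; first by rewrite /=; lra.
  - apply: le_trans (Re_le_normc _); rewrite !creimE /= ger0_norm; lra.
  - apply: le_trans (Re_le_normc _); rewrite !creimE /= Rezc ger0_norm; lra.
  apply: (le_trans (normc_le_ReIm _)); rewrite !creimE /= subr0.
  by rewrite !ger0_norm; lra.
have left s : 0 <= s <= N -> normc (q ((x - N) +i* s)) <= 8 * M / N ^+ 2.
  move=> sN; apply: qM; first by rewrite /=; lra.
  - apply: le_trans (Re_le_normc _); rewrite !creimE /= ler0_norm; lra.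
  - apply: le_trans (Re_le_normc _); rewrite !creimE /= Rezc ler0_norm; lra.
  apply: (le_trans (normc_le_ReIm _)); rewrite !creimE /= subr0.
  by rewrite ler0_norm ?ger0_norm; lra.
have [N00 N0N] : 0 <= N /\ (N : R) <= N by split; [exact: ltW|].
have c0 : ccont (x - N) (x + N) (fun t => q (t +i* 0)) by apply: rcont_h qc _; rewrite lexx.
have cN : ccont (x - N) (x + N) (fun t => q (t +i* N)) by apply: rcont_h qc _; rewrite lexx N00.
have cR : ccont 0 N (fun t => q ((x + N) +i* t)) by apply: rcont_v qc _; rewrite lexx xN.
have cL : ccont 0 N (fun t => q ((x - N) +i* t)) by apply: rcont_v qc _; rewrite lexx xN.
have A : normc (cint (x - N) (x + N) (fun t => q (t +i* 0))) <= 64 * M / N.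
  move: R0; rewrite /rect (cintB c0 cN) => /eqP.
  rewrite -addrA addr_eq0 => /eqP ->; rewrite normcNE.
  have := cint_le xN cN top.
  have := cint_le N00 (ccontB cR cL) (fun s sN => le_trans (normcB_le _ _) (lerD (right s sN) (left s sN))).
  move=> h1 h2; apply: le_trans (normcD_le _ _) _; rewrite normcNE normcM normci mul1r.
  apply: (le_trans (lerD h2 h1)).
  by rewrite le_eqVlt; apply/orP; left; apply/eqP; field; rewrite gt_eqF.
have {}A := le_trans (Re_le_normc _) A; rewrite /cint /= in A.
have iP : mu.-integrable `[x - N, x + N] (EFin \o (fun t => poisson_kernel y (x - t))).
  apply: continuous_compact_integrable; first exact: segment_compact.
  by apply: continuous_subspaceT; exact: continuous_poisson_kernel.
have cf : ccont (x - N) (x + N) (fun t => f (t +i* 0)).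
  by apply: ccont_h => t _; apply: derivable_cts; apply: df.
have iPf : mu.-integrable `[x - N, x + N] (EFin \o (fun t => poisson_kernel y (x - t) * complex.Re (f t%:C))).
  apply: continuous_compact_integrable; first exact: segment_compact.
  apply: continuous_in_subspaceT => t; rewrite inE /= in_itv /= => tN; apply: cvgM.
    exact: continuous_poisson_kernel.
  by apply: cvg_Re; exact: cf.
have iPn : mu.-integrable `[x - N, x + N] (EFin \o (fun t => poisson_kernel y (x - t) * normc (f t%:C))).
  apply: continuous_compact_integrable; first exact: segment_compact.
  apply: continuous_in_subspaceT => t; rewrite inE /= in_itv /= => tN; apply: cvgM.
    exact: continuous_poisson_kernel.
  by apply: (cvg_comp _ _ (cf t tN)); exact: continuous_normc.
have PE : \int[mu]_(t in `[x - N, x + N]) poisson_kernel y (x - t) = 2 / pi * atan (N / y).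
  by rewrite /Rintegral integral_poisson_kernel_ball.
have E : y / pi * (\int[mu]_(t in `[x - N, x + N]) complex.Re (q (t +i* 0))) =
  \int[mu]_(t in `[x - N, x + N]) (poisson_kernel y (x - t) * complex.Re (f t%:C)) -
  complex.Re (f z) * (2 / pi * atan (N / y)).
  rewrite -PE -RintegralZl//; last by have [] := ccont_int c0.
  rewrite -RintegralZl// -RintegralB//; last first.
    by rewrite (_ : _ \o _ = (fun t => (complex.Re (f z))%:E *
      (EFin \o (fun t => poisson_kernel y (x - t))) t)%E) //; exact: integrableZl.
  apply: eq_Rintegral => t _; rewrite /q /poisson_quotient.
  have tz : (t +i* 0 == z) = false.
    by apply/eqP => tz; move: y0; rewrite -tz /= ltxx.
  rewrite tz.
  have K : (t%:C - z) * (t%:C - z^*) = ((x - t) ^+ 2 + y ^+ 2)%:C.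
    by case: (z) => a b /=; apply: complexP; rewrite !creimE /=; ring.
  have -> : (f t%:C - f z) / (t%:C - z) / (t%:C - z^*) =
      (((x - t) ^+ 2 + y ^+ 2)^-1)%:C * (f t%:C - f z).
    have -> : (((x - t) ^+ 2 + y ^+ 2)^-1)%:C = ((t%:C - z) * (t%:C - z^*))^-1.
      by rewrite K fmorphV.
    by rewrite -mulrA -invfM [LHS]mulrC.
  rewrite creM /= mul0r subr0 creD creN /poisson_kernel.
  ring.
have B : \int[mu]_(t in `[x - N, x + N]) (poisson_kernel y (x - t) * complex.Re (f t%:C)) <=
    \int[mu]_(t in `[x - N, x + N]) (poisson_kernel y (x - t) * normc (f t%:C)).
  apply: le_Rintegral => // t _; rewrite ler_pM2l ?poisson_kernel_gt0//.
  by apply: le_trans (Re_le_normc _); exact: ler_norm.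
have yp : 0 < y / pi by rewrite divr_gt0.
have : - (y / pi * \int[mu]_(t in `[x - N, x + N]) complex.Re (q (t +i* 0))) <= y / pi * (64 * M / N).
  rewrite -mulrN ler_pM2l//; apply: le_trans A; by rewrite -normrN ler_norm.
rewrite E.
have -> : 64 * (y / pi) * M / N = y / pi * (64 * M / N) by ring.
rewrite opprB lerBlDr => h; apply: (le_trans h).
by rewrite [leRHS]addrC lerD2l.
Qed.

(** Let N tend to infinity in [poisson_quotient_le]. On the half-disc of radius 2N sublinear growth
    allows M = K + 2 e' N with e' arbitrarily small, so the error M/N becomes arbitrarily small. The
    integral is extended, so it may diverge. *)
Lemma Re_poisson_le :
  (forall e, 0 < e -> exists K, forall w : CC R, 0 <= complex.Im w ->
     normc (f w) <= K + e * normc (w - x%:C)) ->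
  ((complex.Re (f z))%:E <=
   \int[mu]_t (poisson_kernel y (x - t) * normc (f t%:C))%:E)%E.
Proof.
move=> sublin.
have /derivable_cderiv[D HD] := df (ltW y0).
have yp : 0 < y / pi by rewrite divr_gt0// pi_gt0.
have mf : measurable_fun setT (fun t => poisson_kernel y (x - t) * normc (f t%:C)).
  apply: continuous_measurable_fun => t; apply: cvgM; first exact: continuous_poisson_kernel.
  apply: (@continuous_comp _ _ _ (fun t => f t%:C) (@normc R : CC R -> R)); last exact: continuous_normc.
  apply: (@continuous_comp _ _ _ (fun t => t%:C : CC R) f); last by apply: derivable_cts; exact: df.
  by apply: continuous_hline.
have P0 t : 0 <= poisson_kernel y (x - t) * normc (f t%:C).
  by rewrite mulr_ge0 ?normc_ge0// ltW// poisson_kernel_gt0.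
set I := (\int[mu]_t (poisson_kernel y (x - t) * normc (f t%:C))%:E)%E.
have I0 : (0 <= I)%E by apply: integral_ge0 => t _; rewrite lee_fin.
have [->|If] := eqVneq I +oo%E; first by rewrite leey.
have Ifin : I \is a fin_num by rewrite ge0_fin_numE// ltey.
rewrite -(fineK Ifin) lee_fin.
have step N M : 0 < N -> 2 * y <= N ->
    (forall w : CC R, 0 <= complex.Im w -> normc (w - x%:C) <= 2 * N -> normc (f w) <= M) ->
    complex.Re (f z) * (2 / pi * atan (N / y)) <= fine I + 64 * (y / pi) * M / N.
  move=> N0 yN fM; apply: le_trans (poisson_quotient_le N0 yN HD fM) _.
  rewrite lerD2r /Rintegral fine_le//.
  - rewrite ge0_fin_numE; last by apply: integral_ge0 => t _; rewrite lee_fin.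
    apply: le_lt_trans (_ : (_ <= I)%E) _; last by rewrite ltey.
    apply: ge0_subset_integral => //; first exact/measurable_EFinP.
    by move=> t _; rewrite lee_fin.
  apply: ge0_subset_integral => //; first exact/measurable_EFinP.
  by move=> t _; rewrite lee_fin.
apply/ler_addgt0Pr => e e0.
set c := 64 * (y / pi); have c0 : 0 < c by rewrite mulr_gt0.
(* This slope makes the linear part of the bound contribute exactly e: c * (e / (2c) * 2N) / N =
   e. *)
have [K HK] := sublin (e / (2 * c)) (divr_gt0 e0 (mulr_gt0 (ltr0n _ 2) c0)).
have L1 : complex.Re (f z) * (2 / pi * atan (N / y)) @[N --> +oo] --> complex.Re (f z).
  rewrite -[X in _ --> X]mulr1; apply: cvgM; first exact: cvg_cst.
  rewrite [X in _ --> X](_ : _ = 2 / pi * (pi / 2)); last first.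
    by rewrite mulrA divfK ?mulfV// gt_eqF// pi_gt0.
  apply: cvgM; first exact: cvg_cst.
  apply: (cvg_comp (fun N : R => N / y) (@atan R)); last exact: cvgy_atan.
  apply: gt0_cvgMly; last exact: cvg_id.
  by rewrite invr_gt0.
have L2 : fine I + (c * `|K| / N + e) @[N --> +oo] --> fine I + (c * `|K| * 0 + e).
  apply: cvgD; first exact: cvg_cst.
  apply: cvgD; last exact: cvg_cst.
  apply: cvgM; first exact: cvg_cst.
  apply/gtr0_cvgV0; [exact: nbhs_pinfty_gt|exact: cvg_id].
rewrite -[e]add0r -[X in _ + (X + _)](mulr0 (c * `|K|)).
apply: (ler_cvg_to L1 L2); near=> N.
have N0 : 0 < N by near: N; exact: nbhs_pinfty_gt.
have Ny : 2 * y <= N by near: N; apply: nbhs_pinfty_ge; exact: num_real.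
apply: le_trans (step N (`|K| + e / (2 * c) * (2 * N)) N0 Ny _) _.
  move=> w w0 wN; apply: le_trans (HK _ w0) _; apply: lerD; first exact: ler_norm.
  by rewrite ler_pM2l// divr_gt0// mulr_gt0.
rewrite lerD2l -/c le_eqVlt; apply/orP; left; apply/eqP.
by field; rewrite !gt_eqF.
Unshelve. all: by end_near. Qed.

End Reflection.

(* Multiplying f by a unimodular constant turns the bound on [Re f(z)] into one on [|f(z)|]. *)
Lemma normc_poisson_le f z : 0 < complex.Im z ->
  (forall w : CC R, 0 <= complex.Im w -> derivable f w 1) ->
  (forall e, 0 < e -> exists K, forall w : CC R, 0 <= complex.Im w ->
     normc (f w) <= K + e * normc (w - (complex.Re z)%:C)) ->
  ((normc (f z))%:E <=
   \int[mu]_t (poisson_kernel (complex.Im z) (complex.Re z - t) * normc (f t%:C))%:E)%E.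
Proof.
move=> y0 df sublin.
have [fz0|fz0] := eqVneq (f z) 0.
  rewrite fz0 normc0; apply: integral_ge0 => t _.
  by rewrite lee_fin mulr_ge0 ?normc_ge0// ltW// poisson_kernel_gt0.
pose c : CC R := (normc (f z))%:C / f z.
have nc : normc c = 1.
  by rewrite normcM normcV normcR ger0_norm ?normc_ge0// mulfV// normc_eq0.
have ncf w : normc (c * f w) = normc (f w) by rewrite normcM nc mul1r.
have := @Re_poisson_le (fun w => c * f w) z y0.
rewrite divfK//= => /(_ _ _)/le_trans; apply.
- by move=> w w0; apply: derivableM; [exact: derivable_cst|exact: df].
- by move=> e /sublin[K HK]; exists K => w; rewrite ncf; exact: HK.
- by under eq_integral do rewrite ncf.
Qed.

End SubPoisson.

(** * Integrals against the Poisson kernel *)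

Section KernelIntegrals.
Variable R : realType.
Local Notation mu := (@lebesgue_measure R).
Implicit Types (x y t : R) (f u w : R -> R).

Lemma sum_half_le2 n : \sum_(0 <= k < n) (2^-1 : R) ^+ k <= 2.
Proof.
suff -> : \sum_(0 <= k < n) (2^-1 : R) ^+ k = 2 - 2 * 2^-1 ^+ n.
  by rewrite lerBlDr lerDl mulr_ge0// exprn_ge0// invr_ge0.
elim: n => [|n IH]; first by rewrite big_geq// expr0; ring.
by rewrite big_nat_recr//= IH exprS; field.
Qed.

Lemma dyadic_index (r : R) : 1 <= r -> exists n : nat, 4 ^+ n <= r < 4 ^+ n.+1.
Proof.
move=> r1.
have ex : exists n : nat, r < (4 : R) ^+ n.
  exists (Num.trunc r).+1; apply: (lt_le_trans (truncnS_gt _)).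
  by rewrite -natrX ler_nat ltnW// ltn_expl.
case: (ex_minnP ex) => -[|m] rm min; first by move: rm; rewrite expr0 ltNge r1.
exists m; rewrite rm andbT leNgt; apply/negP => /min; by rewrite ltnn.
Qed.

(* The layer t with 4^(n-1) y <= |t - x| < 4^n y contributes at most
   (c k^n) (K A^n) <= c K 2^-n. *)
Lemma integral_layer_le (r f : R -> R) x y (c k K A : R) :
  0 < y -> 0 <= k -> 0 <= K -> 0 <= A -> k * A <= 2^-1 ->
  measurable_fun setT r -> measurable_fun setT f -> (forall t, 0 <= f t) ->
  (forall t, 0 <= r t <= c) ->
  (forall n t, 4 ^+ n * y <= `|t - x| -> r t <= c * k ^+ n.+1) ->
  (forall n, \int[mu]_(t in ball x (4 ^+ n * y)) (f t)%:E <= (K * A ^+ n)%:E)%E ->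
  (\int[mu]_t (r t * f t)%:E <= (2 * (c * K))%:E)%E.
Proof.
move=> y0 k0 K0 A0 kA mr mf f0 rc rn fK.
have c0 : 0 <= c by have /andP[a b] := rc 0; exact: le_trans b.
pose B n := ball x (4 ^+ n * y) : set R.
pose g n t : \bar R := ((c * k ^+ n)%:E * ((f t)%:E * (\1_(B n) t)%:E))%E.
have mB n : measurable (B n) by exact: measurable_ball.
have g0 n t : (0 <= g n t)%E.
  by rewrite /g !mule_ge0 ?lee_fin ?mulr_ge0 ?exprn_ge0.
have mfB n : measurable_fun setT (fun t => (f t)%:E * (\1_(B n) t)%:E)%E.
  by apply: emeasurable_funM; apply/measurable_EFinP.
have mg n : measurable_fun setT (g n).
  apply: emeasurable_funM; first exact: measurable_cst.
  exact: mfB.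
apply: (@le_trans _ _ (\int[mu]_t (\sum_(n <oo) g n t))%E).
  apply: ge0_le_integral => //.
  - by move=> t _; rewrite lee_fin mulr_ge0//; case/andP: (rc t).
  - by apply/measurable_EFinP; apply: measurable_funM.
  - exact: (@ge0_emeasurable_sum _ _ _ setT g xpredT).
  move=> t _.
  suff [n Bn rtn] : exists2 n, B n t & r t <= c * k ^+ n.
    apply: le_trans (nneseries_lim_ge n.+1 _) => //.
    rewrite big_nat_recr//=; apply: le_trans (leeDr _ _); last by apply: sume_ge0 => i _.
    rewrite /g indicE mem_set// mule1 -EFinM lee_fin; exact: ler_wpM2r.
  have [ty|ty] := ltP `|t - x| y.
    exists 0%N; last by rewrite expr0 mulr1; case/andP: (rc t).
    by rewrite /B expr0 mul1r /ball /= distrC.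
  have [|m /andP[m1 m2]] := @dyadic_index (`|t - x| / y); first by rewrite ler_pdivlMr// mul1r.
  exists m.+1; last by apply: rn; rewrite -ler_pdivlMr.
  by rewrite /B /ball /= distrC -ltr_pdivrMr.
rewrite integral_nneseries//.
have gi n : (\int[mu]_t g n t <= (c * K * 2^-1 ^+ n)%:E)%E.
  rewrite /g ge0_integralZl//; last first.
  - by rewrite lee_fin mulr_ge0// exprn_ge0.
  - by move=> t _; rewrite mule_ge0 ?lee_fin.
  - exact: mfB.
  have -> : (\int[mu]_t ((f t)%:E * (\1_(B n) t)%:E) = \int[mu]_(t in B n) (f t)%:E)%E.
    by rewrite [RHS]integral_mkcond epatch_indic.
  apply: le_trans (lee_wpmul2l _ (fK n)) _; first by rewrite lee_fin mulr_ge0// exprn_ge0.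
  rewrite -EFinM lee_fin.
  have -> : c * k ^+ n * (K * A ^+ n) = c * K * (k * A) ^+ n by rewrite exprMn; ring.
  rewrite ler_wpM2l ?mulr_ge0// lerXn2r// ?nnegrE ?mulr_ge0// invr_ge0//.
apply: lime_le.
  by apply: is_cvg_nneseries => n _ _; apply: integral_ge0.
apply: nearW => n; apply: (@le_trans _ _ (\sum_(0 <= i < n) (c * K * 2^-1 ^+ i)%:E)%E).
  by apply: lee_sum => i _; exact: gi.
rewrite sumEFin lee_fin -mulr_sumr [leRHS]mulrC ler_wpM2l ?mulr_ge0//.
exact: sum_half_le2.
Qed.

Lemma integral_poisson_kernel x y : 0 < y ->
  (\int[mu]_t (poisson_kernel y (x - t))%:E = 1)%E.
Proof.
move=> y0; pose F n := `[x - n.+1%:R, x + n.+1%:R]%classic : set R.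
have UF : \bigcup_n F n = setT.
  apply/seteqP; split => // t _; exists (Num.trunc `|t - x|) => //.
  rewrite /F /= in_itv /=; have := truncnS_gt `|t - x|; rewrite ltr_norml; lra.
have mP : measurable_fun setT (fun t => (poisson_kernel y (x - t))%:E).
  apply/measurable_EFinP; apply: continuous_measurable_fun; exact: continuous_poisson_kernel.
have : (\int[mu]_(t in F n) (poisson_kernel y (x - t))%:E)%E @[n --> \oo] -->
    (\int[mu]_(t in \bigcup_n F n) (poisson_kernel y (x - t))%:E)%E.
  apply: ge0_nondecreasing_set_cvg_integral => //.
  - move=> m n mn; rewrite subsetEset => t; rewrite /F /= !in_itv /=.
    have : m.+1%:R <= n.+1%:R :> R by rewrite ler_nat.
    by lra.
  - by move=> n; exact: measurable_itv.
  - by move=> n; exact: measurable_funTS.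
  - by move=> n t _; rewrite lee_fin ltW// poisson_kernel_gt0.
rewrite UF => H; apply: (@cvg_unique _ (@ereal_hausdorff R) _ _ _ _ H).
rewrite (_ : (fun n => _) = (fun n => (2 / pi * atan (n.+1%:R / y))%:E)); last first.
  by apply/funext => n; rewrite integral_poisson_kernel_ball.
apply: cvg_EFin; first exact: nearW.
rewrite [X in _ --> X](_ : _ = 2 / pi * (pi / 2)); last first.
  by rewrite mulrA divfK ?mulfV// gt_eqF// pi_gt0.
apply: cvgM; first exact: cvg_cst.
apply: (cvg_comp (fun n : nat => n.+1%:R / y) (@atan R)); last exact: cvgy_atan.
have N : (n.+1%:R : R) @[n --> \oo] --> +oo by have := @cvgr_idn R; rewrite -cvg_shiftS.
apply: (cvg_comp _ (fun s : R => s / y) N).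
by apply: gt0_cvgMly; [rewrite invr_gt0|exact: cvg_id].
Qed.

(** From 1 + t^2 <= 2 (x - t)^2 + (1 + 2 x^2), divided by (x - t)^2 + y^2. *)
Definition poisson_const x y : R := pi^-1 * (y * (2 + (1 + 2 * x ^+ 2) / y ^+ 2)).

Lemma poisson_kernel_le x y t : 0 < y ->
  poisson_kernel y (x - t) <= poisson_const x y / (1 + t ^+ 2).
Proof.
move=> y0; rewrite /poisson_kernel /poisson_const -mulrA ler_pM2l ?invr_gt0 ?pi_gt0//.
rewrite -mulrA ler_pM2l// ler_pdivlMr; last by rewrite ltr_pwDl// sqr_ge0.
set D := (x - t) ^+ 2 + y ^+ 2.
have y20 : 0 < y ^+ 2 by rewrite exprn_gt0.
have D0 : 0 < D by rewrite ltr_wpDl ?sqr_ge0.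
rewrite mulrC ler_pdivrMr//.
have h1 : 1 + 2 * x ^+ 2 <= (1 + 2 * x ^+ 2) / y ^+ 2 * D.
  rewrite mulrAC ler_pdivlMr// ler_wpM2l ?lerDr ?sqr_ge0//.
  by rewrite addr_ge0// mulr_ge0// sqr_ge0.
have h2 : 1 + t ^+ 2 <= 2 * (x - t) ^+ 2 + (1 + 2 * x ^+ 2).
  by have := sqr_ge0 (t - 2 * x); rewrite !expr2; lra.
have h3 : 0 <= y ^+ 2 by exact: ltW.
rewrite mulrDl; move: (_ / _ * D) h1 => q h1; rewrite /D; lra.
Qed.

Lemma poisson_const_gt0 x y : 0 < y -> 0 < poisson_const x y.
Proof.
move=> y0; rewrite /poisson_const mulr_gt0 ?invr_gt0 ?pi_gt0// mulr_gt0//.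
by rewrite ltr_pwDl// divr_ge0 ?sqr_ge0// addr_ge0// mulr_ge0// sqr_ge0.
Qed.

(** Dominates |i + t + ie|^(1/2) for 0 <= e <= 1, because |i + t + ie| <= 2 + |t|, and it is still
    integrable against dt / (1 + t^2). *)
Definition growth t : R := Num.sqrt (2 + `|t|).

Lemma growth_ge1 t : 1 <= growth t.
Proof. by rewrite /growth -[leLHS]sqrtr1 ler_sqrt ?addr_ge0//; have := normr_ge0 t; lra. Qed.

Lemma continuous_growth_ratio : continuous (fun t => growth t / (1 + t ^+ 2)).
Proof.
move=> t; apply: cvgM.
  apply: (@continuous_comp _ _ _ (fun t => 2 + `|t|) (@Num.sqrt R)); last exact: sqrt_continuous.
  by apply: cvgD; [exact: cvg_cst|exact: norm_continuous].
apply: cvgV; first by rewrite gt_eqF// ltr_pwDl// sqr_ge0.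
by apply: cvgD; [exact: cvg_cst|exact: exprn_continuous].
Qed.

Lemma integrable_growth : mu.-integrable setT (fun t => (growth t / (1 + t ^+ 2))%:E).
Proof.
have D0 t : 0 < 1 + t ^+ 2 by rewrite ltr_pwDl// sqr_ge0.
have G0 t : 0 <= growth t / (1 + t ^+ 2) by rewrite divr_ge0 ?sqrtr_ge0// ltW.
have mG : measurable_fun setT (fun t => growth t / (1 + t ^+ 2)).
  by apply: continuous_measurable_fun; exact: continuous_growth_ratio.
apply/integrableP; split; first exact/measurable_EFinP.
under eq_integral do rewrite gee0_abs ?lee_fin//.
apply: (@le_lt_trans _ _ ((2 * (16 * 2))%:E)%E); last exact: ltry.
under eq_integral do rewrite -[growth _ / _]mulr1.
(* For |t| >= 4^n the ratio is at most 2 |t|^(-3/2) <= 2 * 8^-n = 16 * 8^-(n+1), while the ball has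
   length 2 * 4^n; the layers decay like (4/8)^n. *)
apply: (@integral_layer_le _ (cst 1) 0 1 16 8^-1 2 4) => //.
- lra.
- move=> t; rewrite G0 ler_pdivrMr//.
  apply: (@le_trans _ _ (2 + `|t|)).
    rewrite /growth -{2}(sqr_sqrtr (_ : 0 <= 2 + `|t|)) ?addr_ge0// expr2 ler_peMl ?sqrtr_ge0//.
    exact: growth_ge1.
  have E : `|t| ^+ 2 = t ^+ 2 := real_normK (num_real t).
  by have := sqr_ge0 (`|t| - 1); rewrite sqrrB E; have := sqr_ge0 t; lra.
- move=> n t; rewrite mulr1 subr0 => tn.
  have t1 : 1 <= `|t| by apply: le_trans tn; rewrite exprn_ege1//; lra.
  set u := Num.sqrt `|t|; have uu : `|t| = u ^+ 2 by rewrite sqr_sqrtr.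
  have un : 2 ^+ n <= u.
    rewrite -(@ler_pXn2r _ 2)// ?nnegrE ?exprn_ge0 ?sqrtr_ge0// -uu -exprM mulnC exprM.
    by rewrite (_ : 2 ^+ 2 = 4)//; ring.
  have u0 : 0 < u by apply: lt_le_trans un; rewrite exprn_gt0.
  have g2 : growth t <= 2 * u.
    rewrite -(@ler_pXn2r _ 2)// ?nnegrE ?mulr_ge0 ?sqrtr_ge0//.
    by rewrite /growth sqr_sqrtr ?addr_ge0// exprMn -uu; lra.
  rewrite ler_pdivrMr// (le_trans g2)// exprS.
  have -> : 1 + t ^+ 2 = 1 + u * u ^+ 3 by rewrite -(real_normK (num_real t)) uu; ring.
  have h : 1 <= 8^-1 ^+ n * u ^+ 3.
    have -> : 8^-1 ^+ n = ((2 ^+ n) ^+ 3)^-1 :> R.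
      by rewrite -exprM mulnC exprM exprVn; congr ((_ ^+ _)^-1); ring.
    by rewrite mulrC ler_pdivlMr ?exprn_gt0// mul1r lerXn2r ?nnegrE ?exprn_ge0// ltW.
  have e0 : 0 <= 8^-1 ^+ n :> R by rewrite exprn_ge0.
  have : u * 1 <= u * (8^-1 ^+ n * u ^+ 3) by rewrite ler_pM2l.
  by lra.
- move=> n; rewrite (eq_integral (cst 1%E))// integral_cst//=; last exact: measurable_ball.
  by rewrite lebesgue_measure_ball ?mulr_ge0 ?exprn_ge0// mul1e lee_fin; lra.
Qed.

Lemma expR_le_taylor x : expR x <= 1 + x + x ^+ 2 * expR `|x|.
Proof.
have h : expR x - 1 <= x * expR x.
  have := expR_ge1Dx (- x); rewrite expRN => h.
  have : expR x * (1 - x) <= expR x * (expR x)^-1 by rewrite ler_pM2l ?expR_gt0.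
  by rewrite mulfV ?gt_eqF ?expR_gt0//; lra.
have [x0|x0] := leP 0 x.
  rewrite ger0_norm//.
  have : x * (expR x - 1) <= x * (x * expR x) by rewrite ler_wpM2l.
  by rewrite expr2; lra.
rewrite ltr0_norm//.
have k := expR_ge1Dx x.
have : - x * (1 - expR x) <= - x * (- x) by rewrite ler_wpM2l; lra.
have : 1 <= expR (- x) by rewrite -expR0 ler_expR; lra.
move=> e1; have : x ^+ 2 * 1 <= x ^+ 2 * expR (- x) by rewrite ler_wpM2l// sqr_ge0.
by rewrite !expr2; lra.
Qed.

Lemma sqr_le_expR x : x ^+ 2 <= 4 * expR `|x|.
Proof.
rewrite -(real_normK (num_real x)).
have h := expR_ge1Dx (`|x| / 2).
have x0 := normr_ge0 x.
have -> : expR `|x| = expR (`|x| / 2) ^+ 2 by rewrite expr2 -expRD -mulrDl -mulr2n -[_ *+ 2]mulr_natr mulfK.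
have : (`|x| / 2) ^+ 2 <= expR (`|x| / 2) ^+ 2 by rewrite lerXn2r ?nnegrE ?expR_ge0//; lra.
by rewrite !expr2; lra.
Qed.

Lemma expR_norm_le x : expR `|x| <= expR x + expR (- x).
Proof.
have [x0|x0] := leP 0 x; first by rewrite ger0_norm// lerDl expR_ge0.
by rewrite ltr0_norm// lerDr expR_ge0.
Qed.

Lemma integrable_RZ f k : mu.-integrable setT (EFin \o f) ->
  mu.-integrable setT (EFin \o (fun t => k * f t)).
Proof. exact: (integrableZl measurableT). Qed.

Lemma integrable_RD f (g : R -> R) : mu.-integrable setT (EFin \o f) ->
  mu.-integrable setT (EFin \o g) -> mu.-integrable setT (EFin \o (fun t => f t + g t)).
Proof. exact: (integrableD measurableT). Qed.

(** * Exponential means against the Poisson kernel *)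

Section PoissonMean.
Variables (x y : R).
Hypothesis y0 : 0 < y.
Local Notation P := (fun t => poisson_kernel y (x - t)).

Let P0 t : 0 < poisson_kernel y (x - t). Proof. exact: poisson_kernel_gt0. Qed.
Let mP : measurable_fun setT P.
Proof. by apply: continuous_measurable_fun; exact: continuous_poisson_kernel. Qed.

Lemma integrable_poisson_kernel : mu.-integrable setT (EFin \o P).
Proof.
apply/integrableP; split; first exact/measurable_EFinP.
under eq_integral do rewrite /= ger0_norm ?ltW//.
by rewrite integral_poisson_kernel// ltry.
Qed.

Lemma Rintegral_poisson_kernel : \int[mu]_t poisson_kernel y (x - t) = 1.
Proof. by rewrite /Rintegral integral_poisson_kernel. Qed.

(* d |u| <= e^(d |u|) *)
Lemma integrable_of_exp u d : 0 < d -> measurable_fun setT u ->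
  mu.-integrable setT (EFin \o (fun t => P t * expR (d * u t))) ->
  mu.-integrable setT (EFin \o (fun t => P t * expR (- d * u t))) ->
  mu.-integrable setT (EFin \o (fun t => P t * u t)).
Proof.
move=> d0 mu_ i1 i2.
have i3 := integrable_RZ d^-1 (integrable_RD i1 i2).
apply: le_integrable i3 => //.
  by apply/measurable_EFinP; exact: measurable_funM.
move=> t _ /=; rewrite lee_fin -mulrDr [X in X <= _]normrM (gtr0_norm (P0 t)).
rewrite mulrCA [leRHS]ger0_norm; last first.
  apply: mulr_ge0; first exact: ltW.
  by apply: mulr_ge0; rewrite ?addr_ge0 ?expR_ge0 ?invr_ge0 ?(ltW d0).
apply: ler_wpM2l; first exact: ltW.
rewrite mulrC ler_pdivlMr// mulrC -{1}(gtr0_norm d0) -normrM.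
apply: (@le_trans _ _ (expR `|d * u t|)); first by have := expR_ge1Dx `|d * u t|; lra.
by rewrite mulNr expR_norm_le.
Qed.

(** Compare 1 + ev <= e^(ev) with P_y * e^(eu) <= 1 + e (P_y * u) + O(e^2), cancel 1, divide by e
    and let e tend to 0. The two exponential integrability hypotheses control the quadratic term. *)
Lemma poisson_log_le u d v : 0 < d -> measurable_fun setT u ->
  mu.-integrable setT (EFin \o (fun t => P t * expR (d * u t))) ->
  mu.-integrable setT (EFin \o (fun t => P t * expR (- d * u t))) ->
  (forall e, 0 < e <= d -> ((expR (e * v))%:E <= \int[mu]_t (P t * expR (e * u t))%:E)%E) ->
  v <= \int[mu]_t (P t * u t).
Proof.
move=> d0 mu_ i1 i2 H.
have iu := integrable_of_exp d0 mu_ i1 i2.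
have i3 := integrable_RD i1 i2.
set K := \int[mu]_t (P t * expR (d * u t) + P t * expR (- d * u t)).
have K0 : 0 <= K.
  by apply: Rintegral_ge0 => t _; rewrite addr_ge0// mulr_ge0 ?expR_ge0// ltW.
(* Half of the exponent d|u| pays for the square, as u^2 = (4/d^2) (du/2)^2 <= (16/d^2) e^(d|u|/2);
   the other half pays for e^(e|u|), since e <= d/2. *)
set C := 16 / d ^+ 2; have C0 : 0 < C by rewrite divr_gt0// exprn_gt0.
suff S e : 0 < e <= d / 2 -> v <= \int[mu]_t (P t * u t) + e * (C * K).
  apply/ler_addgt0Pr => e e0.
  have B0 : 0 < C * K + 1 by rewrite ltr_wpDl// mulr_ge0// ltW.
  pose e' := Num.min (d / 2) (e / (C * K + 1)).
  have e'0 : 0 < e' by rewrite lt_min !divr_gt0.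
  apply: (le_trans (S e' _)); first by rewrite e'0 ge_min lexx.
  rewrite lerD2l; apply: (@le_trans _ _ (e' * (C * K + 1))); first by rewrite ler_pM2l//; lra.
  by rewrite -ler_pdivlMr// ge_min lexx orbT.
move=> /andP[e0 ed].
have point t : P t * expR (e * u t) <= P t + e * (P t * u t) +
    e ^+ 2 * C * (P t * expR (d * u t) + P t * expR (- d * u t)).
  suff : expR (e * u t) <= 1 + e * u t + e ^+ 2 * C * (expR (d * u t) + expR (- d * u t)).
    move=> h; have : P t * expR (e * u t) <=
        P t * (1 + e * u t + e ^+ 2 * C * (expR (d * u t) + expR (- d * u t))).
      by rewrite ler_wpM2l// ltW.
    by lra.
  apply: le_trans (expR_le_taylor _) _; rewrite lerD2l.
  have -> : (e * u t) ^+ 2 * expR `|e * u t| = e ^+ 2 * (u t ^+ 2 * expR `|e * u t|) by ring.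
  rewrite -[leRHS]mulrA; apply: ler_wpM2l; first exact: sqr_ge0.
  apply: (@le_trans _ _ (C * expR `|d * u t|)); last first.
    by apply: ler_wpM2l; [exact: ltW|rewrite mulNr; exact: expR_norm_le].
  set a := `|d * u t| / 2.
  have -> : expR `|d * u t| = expR a * expR a by rewrite -expRD /a -mulrDl -mulr2n -[_ *+ 2]mulr_natr mulfK.
  rewrite mulrA; apply: ler_pM; rewrite ?sqr_ge0 ?expR_ge0//.
    have := sqr_le_expR (d * u t / 2); rewrite normrM (ger0_norm (_ : 0 <= 2^-1)) ?invr_ge0// -/a.
    have -> : u t ^+ 2 = 4 / d ^+ 2 * (d * u t / 2) ^+ 2 by field; rewrite gt_eqF.
    have -> : C * expR a = 4 / d ^+ 2 * (4 * expR a) by rewrite /C; ring.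
    by move=> h; apply: ler_wpM2l => //; rewrite divr_ge0// sqr_ge0.
  rewrite ler_expR /a normrM (gtr0_norm e0) normrM (gtr0_norm d0).
  have : e * `|u t| <= d / 2 * `|u t| by rewrite ler_wpM2r.
  lra.
have ie : mu.-integrable setT (EFin \o (fun t => P t + e * (P t * u t) +
    e ^+ 2 * C * (P t * expR (d * u t) + P t * expR (- d * u t)))).
  apply: integrable_RD; last exact: integrable_RZ.
  by apply: integrable_RD; [exact: integrable_poisson_kernel|exact: integrable_RZ].
have L := H e; rewrite e0 /= in L.
have {}L : ((expR (e * v))%:E <= (1 + e * \int[mu]_t (P t * u t) + e ^+ 2 * C * K)%:E)%E.
  apply: (le_trans (L _)); first by lra.
  have -> : 1 + e * \int[mu]_t (P t * u t) + e ^+ 2 * C * K =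
    \int[mu]_t (P t + e * (P t * u t) + e ^+ 2 * C * (P t * expR (d * u t) + P t * expR (- d * u t))).
    rewrite RintegralD//; last 2 first.
    - by apply: integrable_RD; [exact: integrable_poisson_kernel|exact: integrable_RZ].
    - exact: integrable_RZ.
    rewrite RintegralZl// RintegralD//; last 2 first.
    - exact: integrable_poisson_kernel.
    - exact: integrable_RZ.
    by rewrite Rintegral_poisson_kernel RintegralZl.
  rewrite /Rintegral fineK; last exact: (integrable_fin_num _ ie).
  apply: ge0_le_integral => //.
  - by move=> t _; rewrite lee_fin mulr_ge0 ?expR_ge0// ltW.
  - apply/measurable_EFinP; apply: measurable_funM => //.
    by apply: measurableT_comp => //; exact: measurable_funM.
  - exact: (measurable_int _ ie).
  - by move=> t _; rewrite lee_fin.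
move: L; rewrite lee_fin => L.
have := le_trans (expR_ge1Dx (e * v)) L; rewrite -!addrA lerD2l.
have -> : e * \int[mu]_t (P t * u t) + e ^+ 2 * C * K = e * (\int[mu]_t (P t * u t) + e * (C * K)).
  by ring.
by rewrite ler_pM2l.
Qed.

(** Integrate the tangent inequality e^u >= e^b (1 + u - b) at the mean b; the kernel has mass one,
    so the smaller side integrates to e^b. The larger side is allowed to be infinite. *)
Lemma poisson_jensen u : measurable_fun setT u ->
  mu.-integrable setT (EFin \o (fun t => P t * u t)) ->
  ((expR (\int[mu]_t (P t * u t)))%:E <= \int[mu]_t (P t * expR (u t))%:E)%E.
Proof.
move=> mu_ iu; set b := \int[mu]_t (P t * u t).
have -> : expR b = \int[mu]_t (expR b * (P t * u t + (1 - b) * P t)).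
  rewrite RintegralZl//; last first.
    by apply: (integrable_RD iu); apply: integrable_RZ; exact: integrable_poisson_kernel.
  rewrite RintegralD//; last by apply: integrable_RZ; exact: integrable_poisson_kernel.
  rewrite RintegralZl//; last exact: integrable_poisson_kernel.
  by rewrite Rintegral_poisson_kernel -/b; ring.
have ib : mu.-integrable setT (EFin \o (fun t => expR b * (P t * u t + (1 - b) * P t))).
  apply: integrable_RZ; apply: (integrable_RD iu).
  by apply: integrable_RZ; exact: integrable_poisson_kernel.
rewrite /Rintegral fineK; last exact: (integrable_fin_num _ ib).
have [->|fin] := eqVneq (\int[mu]_t (P t * expR (u t))%:E)%E +oo%E; first by rewrite leey.
have me : measurable_fun setT (fun t => P t * expR (u t)).
  by apply: measurable_funM => //; exact: measurableT_comp.
have Pe0 t : 0 <= P t * expR (u t) by rewrite mulr_ge0 ?expR_ge0// ltW.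
apply: le_integral => //.
  apply/integrableP; split; first exact/measurable_EFinP.
  by under eq_integral do rewrite gee0_abs ?lee_fin//; rewrite ltey.
move=> t _; rewrite lee_fin.
have -> : expR b * (P t * u t + (1 - b) * P t) = P t * (expR b * (1 + (u t - b))) by ring.
rewrite ler_wpM2l ?(ltW (P0 t))//.
by rewrite -{2}(subrK b (u t)) expRD mulrC ler_wpM2r ?expR_ge0// expR_ge1Dx.
Qed.

End PoissonMean.

End KernelIntegrals.

(** * Functions of the Hardy class *)

Section HardyToPoisson.
Variable R : realType.
Local Notation mu := (@lebesgue_measure R).
Implicit Types (x y t a alpha : R) (z w : CC R) (F G : CC R -> CC R).

Lemma tan_cone_gt0 alpha : 0 < alpha < pi / 2 -> 0 < tan alpha.
Proof.
move=> /andP[a0 a1]; rewrite /tan divr_gt0//.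
  by apply: sin_gt0_pi; rewrite a0/=; have := pi_gt0 R; lra.
by apply: cos_gt0_pihalf; rewrite a1 andbT; lra.
Qed.

(** The vertical sequence lies in every cone with vertex x, so limits taken in cones of different
    apertures can be compared along it, and dominated convergence applies to it. *)
Lemma nt_limit_vertical (T : topologicalType) (G : CC R -> T) x (l : T) :
  nt_limit G x l -> G (x +i* n.+1%:R^-1) @[n --> \oo] --> l.
Proof.
move=> [a /tan_cone_gt0 a0 H].
have K : ((x +i* n.+1%:R^-1) : CC R) @[n --> \oo] --> within (cone a x) (nbhs (x%:C : CC R)).
  move=> A /nbhsCP[d d0 Hd].
  have [N HN] : exists N : nat, N.+1%:R^-1 < d.
    exists (Num.trunc d^-1); rewrite invf_plt ?posrE//; exact: truncnS_gt.
  exists N => // n /= Nn; apply: Hd.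
    apply: (le_lt_trans (normc_le_ReIm _)); rewrite !creimE /= subrr normr0 add0r subr0.
    rewrite ger0_norm ?invr_ge0//; apply: le_lt_trans HN.
    by rewrite lef_pV2 ?posrE// ler_nat.
  rewrite /cone /= subrr normr0 invr_gt0 ltr0n; split => //.
  by rewrite mulr_gt0// invr_gt0.
exact: (cvg_comp _ _ K H).
Qed.

Lemma nt_limit_comp (T U : topologicalType) (G : CC R -> T) (H : CC R -> U) (phi : T -> U) x (l : T) :
  nt_limit G x l -> {for l, continuous phi} ->
  (forall z, upper_half_plane z -> H z = phi (G z)) -> nt_limit H x (phi l).
Proof.
move=> [a a0 K] cphi E; exists a => //.
have L : phi (G z) @[z --> within (cone a x) (nbhs (x%:C : CC R))] --> phi l.
  exact: (cvg_comp _ _ K cphi).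
move=> A /L hA; have /nbhsCP[d d0 Hd] : nbhs (x%:C : CC R) (fun z => cone a x z -> A (phi (G z))) := hA.
have : nbhs (x%:C : CC R) (fun z => cone a x z -> A (H z)).
  by apply/nbhsCP; exists d => // z /Hd h cz; rewrite E; [exact: h|case: cz].
exact.
Qed.

Lemma nt_maximal_ge alpha F x z : cone alpha x z -> ((normc (F z))%:E <= nt_maximal alpha F x)%E.
Proof. by move=> cz; apply: ereal_sup_ubound; exists z. Qed.

Lemma nt_maximal_ge0 alpha F x : 0 < alpha < pi / 2 -> (0 <= nt_maximal alpha F x)%E.
Proof.
move=> /tan_cone_gt0 a0; apply: le_trans (@nt_maximal_ge alpha F x (x +i* 1) _).
  by rewrite lee_fin normc_ge0.
by rewrite /cone /= subrr normr0 mulr1.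
Qed.

(** The point z lies in the cone of every x with |x - Re z| < tan(alpha) Im z, so the maximal
    function is at least |G(z)| on an interval of length 2 tan(alpha) Im z. *)
Lemma hardy1_pointwise_bound alpha G : 0 < alpha < pi / 2 -> hardy1 alpha G ->
  exists2 I : R, 0 <= I & forall z, upper_half_plane z -> complex.Im z * normc (G z) <= I.
Proof.
move=> a0 [_ iM]; have T0 := tan_cone_gt0 a0.
set J := (\int[mu]_x nt_maximal alpha G x)%E.
have J0 : (0 <= J)%E by apply: integral_ge0 => x _; exact: nt_maximal_ge0.
have Jfin : J \is a fin_num by exact: integrable_fin_num iM.
have J1 : 0 <= fine J by exact: fine_ge0.
exists (fine J / (2 * tan alpha)); first by rewrite divr_ge0// mulr_ge0// ltW.
move=> z Uz; have y0 : 0 < complex.Im z := Uz.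
have TT : 0 < 2 * tan alpha by exact: mulr_gt0.
rewrite ler_pdivlMr//.
suff : ((complex.Im z * normc (G z) * (2 * tan alpha))%:E <= J)%E.
  by rewrite -{1}(fineK Jfin) lee_fin.
set r := tan alpha * complex.Im z; have r0 : 0 < r by rewrite mulr_gt0.
apply: (@le_trans _ _ (\int[mu]_(x in ball (complex.Re z) r) (normc (G z))%:E)%E).
  rewrite integral_cst//=; last exact: measurable_ball.
  rewrite lebesgue_measure_ball ?(ltW r0)// -EFinM lee_fin /r le_eqVlt; apply/orP; left.
  by apply/eqP; ring.
have mM := measurable_int _ iM.
apply: (@le_trans _ _ (\int[mu]_(x in ball (complex.Re z) r) nt_maximal alpha G x)%E).
  apply: ge0_le_integral => //.
  - exact: measurable_ball.
  - by move=> x _; rewrite lee_fin normc_ge0.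
  - exact: measurable_funTS.
  - move=> x; rewrite /ball /= => zx; apply: nt_maximal_ge; split => //.
    by rewrite distrC.
apply: ge0_subset_integral => //; first exact: measurable_ball.
by move=> x _; exact: nt_maximal_ge0.
Qed.

Lemma derivable_shiftc F z (c : CC R) : derivable F (z + c) 1 -> derivable (fun w => F (w + c)) z 1.
Proof.
move=> /derivable_cderiv[D HD]; apply/derivable_cderiv; exists D => e /HD[d d0 Hd].
exists d => // w wz; have -> : w - z = (w + c) - (z + c) by rewrite opprD addrACA subrr addr0.
by apply: Hd; rewrite opprD addrACA subrr addr0.
Qed.

Lemma derivable_scale (c : CC R) F z : derivable F z 1 -> derivable (fun w => c * F w) z 1.
Proof. by move=> h; apply: derivableM; [exact: derivable_cst|exact: h]. Qed.

Lemma expR_scale_le p a : 0 <= p <= 1 -> expR (p * a) <= 1 + expR a.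
Proof.
move=> /andP[p0 p1]; have [a0|a0] := leP 0 a.
  apply: (@le_trans _ _ (expR a)); last by rewrite lerDr.
  by rewrite ler_expR ler_piMl.
apply: (@le_trans _ _ 1); last by rewrite lerDl expR_ge0.
by rewrite -expR0 ler_expR mulr_ge0_le0// ltW.
Qed.

Lemma ae_imp (A B : R -> Prop) : (forall t, A t -> B t) ->
  {ae mu, forall t, A t} -> {ae mu, forall t, B t}.
Proof. by move=> AB; apply: filterS => //; exact: (ae_filter_ringOfSetsType mu). Qed.

Lemma ae_imp2 (A B C : R -> Prop) : (forall t, A t -> B t -> C t) ->
  {ae mu, forall t, A t} -> {ae mu, forall t, B t} -> {ae mu, forall t, C t}.
Proof. by move=> ABC; apply: filterS2 => //; exact: (ae_filter_ringOfSetsType mu). Qed.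

Lemma ae_all (A : R -> Prop) : (forall t, A t) -> {ae mu, forall t, A t}.
Proof. by move=> h; apply: (@filterE _ _ (ae_filter_ringOfSetsType mu)). Qed.

(** * Poisson majorization of small powers *)

Section Majorant.
Variables (alpha m p : R) (f P l : CC R -> CC R) (b : R -> R).
Hypotheses (ha : 0 < alpha < pi / 2) (m0 : 0 <= m) (p0 : 0 < p <= 1) (mp : m * p <= 2^-1).
Hypotheses (hl : holomorphic l) (fl : forall z, upper_half_plane z -> f z = cexp (l z)).
Hypothesis hP : forall z, upper_half_plane z -> normc (P z) = expR (m * ln (normc ('i%C + z))).
Hypothesis hH : hardy1 alpha (fun z => f z / P z).
Hypothesis mb : measurable_fun setT b.
Hypothesis hb : {ae mu, forall x, nt_limit (fun z => normc (f z)) x (expR (b x))}.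

Let g z := cexp (p%:C * l z).

Let normc_g z : normc (g z) = expR (p * complex.Re (l z)).
Proof. by rewrite /g normc_cexp creM /= mul0r subr0. Qed.

Let g_hol z : upper_half_plane z -> derivable g z 1.
Proof. by move=> Uz; apply: derivable_cexp; apply: derivable_scale; exact: hl. Qed.

Let shift_ge1 z : upper_half_plane z -> 1 <= normc ('i%C + z).
Proof.
move=> Uz; apply: le_trans (Im_le_normc _); rewrite !creimE /= ger0_norm.
  by rewrite lerDl ltW.
by rewrite addr_ge0// ltW.
Qed.

(** Here |g| = |f|^p = |f/P|^p |i + z|^(mp), with |f/P|^p <= 1 + |f/P| and mp <= 1/2. The power 1/2
    serves twice: for the sublinear growth and for the dominating function. *)
Let g_le z : upper_half_plane z ->
  normc (g z) <= (1 + normc (f z / P z)) * Num.sqrt (normc ('i%C + z)).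
Proof.
move=> Uz; have N1 := shift_ge1 Uz; set N := normc _ in N1 *.
have N0 : 0 < N by apply: lt_le_trans N1.
have lnN : 0 <= ln N by apply: ln_ge0.
rewrite normc_g normcM normcV hP// fl// normc_cexp -/N -expRN -expRD.
set a := complex.Re (l z).
have -> : p * a = p * (a - m * ln N) + m * p * ln N by ring.
rewrite [X in X <= _]expRD; apply: ler_pM; rewrite ?expR_ge0//.
  by apply: expR_scale_le; case/andP: p0 => /ltW -> ->.
have -> : Num.sqrt N = expR (2^-1 * ln N).
  by rewrite mulrC expRM lnK ?posrE// powR12_sqrt// ltW.
by rewrite ler_expR ler_wpM2r.
Qed.

Lemma poisson_majorant z : upper_half_plane z ->
  mu.-integrable setT (EFin \o (fun t =>
    poisson_kernel (complex.Im z) (complex.Re z - t) * expR (p * b t))) /\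
  ((expR (p * complex.Re (l z)))%:E <=
    \int[mu]_t (poisson_kernel (complex.Im z) (complex.Re z - t) * expR (p * b t))%:E)%E.
Proof.
move=> Uz; have y0 : 0 < complex.Im z := Uz.
set x := complex.Re z; set y := complex.Im z in y0 *.
pose e n : R := n.+1%:R^-1.
have e0 n : 0 < e n by rewrite invr_gt0.
have e1 n : e n <= 1 by rewrite invf_le1// ler1n.
pose fn n t := (poisson_kernel y (x - t) * normc (g (t +i* e n)))%:E.
have Ut n t : upper_half_plane (t +i* e n) by exact: e0.
have step n : ((normc (g (z + (0 +i* e n))))%:E <= \int[mu]_t fn n t)%E.
  have := @normc_poisson_le _ (fun w => g (w + (0 +i* e n))) z Uz.
  rewrite -/x -/y; have E t : t%:C + (0 +i* e n) = t +i* e n by apply: complexP; rewrite !creimE /= ?addr0 ?add0r.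
  under eq_integral do rewrite E.
  apply.
    move=> w w0; apply: derivable_shiftc; apply: g_hol.
    by rewrite /upper_half_plane /= creimE /= ltr_wpDl.
  (* The translate only sees heights at least [e n], where |f/P| <= I / e n. Hence it is at most A
     N^(1/2) with N = |i + w + i e n|, and A N^(1/2) <= d N + A^2 / (4d). *)
  move=> d d0; have [I I0 HI] := hardy1_pointwise_bound ha hH.
  pose A := 1 + I / e n; have A0 : 0 < A by rewrite ltr_wpDr// divr_ge0// ltW.
  exists (d * (2 + `|x|) + A ^+ 2 / (4 * d)) => w w0.
  have Uw : upper_half_plane (w + (0 +i* e n)) by rewrite /upper_half_plane /= creimE /= ltr_wpDl.
  apply: (le_trans (g_le Uw)).
  set N := normc ('i%C + _).
  have N0 : 0 <= N := normc_ge0 _.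
  have NN : N <= 2 + `|x| + normc (w - x%:C).
    have -> : N = normc ((w - x%:C) + (x%:C + (0 +i* (1 + e n)))).
      by congr normc; apply: complexP; rewrite !creimE /=; ring.
    apply: le_trans (normcD_le _ _) _; rewrite addrC lerD2r.
    apply: le_trans (normcD_le _ _) _; rewrite normcR addrC lerD2r /=.
    by rewrite expr0n add0r sqrtr_sqr ger0_norm ?addr_ge0 ?(ltW (e0 n))//; have := e1 n; lra.
  have r1 : 1 + normc (f (w + (0 +i* e n)) / P (w + (0 +i* e n))) <= A.
    rewrite lerD2l ler_pdivlMr// mulrC; apply: le_trans (HI _ Uw).
    by rewrite ler_wpM2r ?normc_ge0// creimE /= lerDr.
  apply: (@le_trans _ _ (A * Num.sqrt N)); first by rewrite ler_wpM2r ?sqrtr_ge0.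
  apply: (@le_trans _ _ (d * N + A ^+ 2 / (4 * d))); last first.
    have : d * N <= d * (2 + `|x| + normc (w - x%:C)) by rewrite ler_pM2l.
    by lra.
  set s := Num.sqrt N; have -> : N = s ^+ 2 by rewrite sqr_sqrtr.
  rewrite -subr_ge0; have -> : d * s ^+ 2 + A ^+ 2 / (4 * d) - A * s = (2 * d * s - A) ^+ 2 / (4 * d).
    by field; rewrite gt_eqF.
  by rewrite divr_ge0 ?sqr_ge0// mulr_ge0// ltW.
pose M := nt_maximal alpha (fun z => f z / P z).
have iM : mu.-integrable setT M by case: hH.
pose C := poisson_const x y; have C0 : 0 < C by exact: poisson_const_gt0.
(* Product of P_y <= C / (1 + t^2) and |g| <= (1 + r) [growth t] with r <= M t; the factor 4 bounds
   growth / (1 + t^2) in front of r. *)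
pose D t : \bar R := (C%:E * ((growth t / (1 + t ^+ 2))%:E + (4 : R)%:E * M t))%E.
have iD : mu.-integrable setT D.
  apply: (integrableZl measurableT); apply: (integrableD measurableT).
    exact: integrable_growth.
  exact: (integrableZl measurableT).
have P0 t : 0 < poisson_kernel y (x - t) by exact: poisson_kernel_gt0.
have fn0 n t : (0 <= fn n t)%E by rewrite lee_fin mulr_ge0 ?normc_ge0// ltW.
have fnD n t : (fn n t <= D t)%E.
  pose r := normc (f (t +i* e n) / P (t +i* e n)).
  have r0 : 0 <= r := normc_ge0 _.
  have rM : (r%:E <= M t)%E.
    apply: (@nt_maximal_ge alpha (fun z => f z / P z) t (t +i* e n)); split; first exact: e0.
    by rewrite /= subrr normr0 mulr_gt0// tan_cone_gt0.
  apply: (@le_trans _ _ (C%:E * ((growth t / (1 + t ^+ 2))%:E + (4 : R)%:E * r%:E))%E); last first.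
    apply: lee_wpmul2l; first by rewrite lee_fin ltW.
    by apply: leeD => //; apply: lee_wpmul2l; rewrite ?lee_fin.
  have -> : (C%:E * ((growth t / (1 + t ^+ 2))%:E + (4 : R)%:E * r%:E))%E =
      (C * (growth t / (1 + t ^+ 2) + 4 * r))%:E by [].
  rewrite /fn lee_fin.
  have t0 : 0 < 1 + t ^+ 2 by rewrite ltr_pwDl// sqr_ge0.
  have G : normc (g (t +i* e n)) <= (1 + r) * growth t.
    apply: (le_trans (g_le (Ut n t))); apply: ler_wpM2l; first by rewrite addr_ge0.
    rewrite /growth ler_sqrt ?addr_ge0//.
    have -> : 'i%C + (t +i* e n) = t%:C + (0 +i* (1 + e n)) by apply: complexP; rewrite !creimE /=; ring.
    apply: le_trans (normcD_le _ _) _; rewrite normcR addrC lerD2r /=.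
    by rewrite expr0n add0r sqrtr_sqr ger0_norm ?addr_ge0 ?(ltW (e0 n))//; have := e1 n; lra.
  have g4 : growth t / (1 + t ^+ 2) <= 4.
    rewrite ler_pdivrMr//; apply: (@le_trans _ _ (2 + `|t|)).
      rewrite /growth -{2}(sqr_sqrtr (_ : 0 <= 2 + `|t|)) ?addr_ge0// expr2 ler_peMl ?sqrtr_ge0//.
      exact: growth_ge1.
    have E : `|t| ^+ 2 = t ^+ 2 := real_normK (num_real t).
    by have := sqr_ge0 (`|t| - 1); rewrite sqrrB E; have := sqr_ge0 t; lra.
  apply: (@le_trans _ _ (C / (1 + t ^+ 2) * ((1 + r) * growth t))).
    by apply: ler_pM; rewrite ?normc_ge0 ?(ltW (P0 t))//; exact: poisson_kernel_le.
  have -> : C / (1 + t ^+ 2) * ((1 + r) * growth t) =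
      C * (growth t / (1 + t ^+ 2) + growth t / (1 + t ^+ 2) * r) by ring.
  by rewrite ler_pM2l// lerD2l ler_wpM2r.
have mfn n : measurable_fun setT (fn n).
  apply/measurable_EFinP; apply: continuous_measurable_fun => t; apply: cvgM.
    exact: continuous_poisson_kernel.
  apply: (@continuous_comp _ _ _ (fun t => g (t +i* e n)) (@normc R : CC R -> R)); last exact: continuous_normc.
  apply: (@continuous_comp _ _ _ (fun t => (t +i* e n) : CC R) g); first exact: continuous_hline.
  by apply: derivable_cts; exact: g_hol.
have mlim : measurable_fun setT (EFin \o (fun t => poisson_kernel y (x - t) * expR (p * b t))).
  apply/measurable_EFinP; apply: measurable_funM.
    by apply: continuous_measurable_fun; exact: continuous_poisson_kernel.
  by apply: measurableT_comp => //; exact: measurable_funM.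
have cvg_fn : {ae mu, forall t, setT t -> fn n t @[n --> \oo] -->
     (EFin \o (fun t => poisson_kernel y (x - t) * expR (p * b t))) t}.
  apply: ae_imp hb => t /nt_limit_vertical ht _.
  apply: cvg_EFin; first exact: nearW.
  apply: cvgM; first exact: cvg_cst.
  have L1 : ln (normc (f (t +i* e n))) @[n --> \oo] --> b t.
    rewrite -[b t]expRK; apply: (cvg_comp _ _ ht); apply: continuous_ln; exact: expR_gt0.
  have -> : (fun n => normc (g (t +i* e n))) = (fun n => expR (p * ln (normc (f (t +i* e n))))).
    by apply/funext => n; rewrite normc_g fl ?normc_cexp ?expRK//; exact: Ut.
  apply: (cvg_comp _ _ (cvgM (cvg_cst p) L1)); exact: continuous_expR.
have dom : {ae mu, forall t n, setT t -> (`|fn n t| <= D t)%E}.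
  by apply: ae_all => t n _; rewrite gee0_abs.
have [i1 _ i3] := @dominated_convergence _ _ _ mu setT measurableT fn
  (EFin \o (fun t => poisson_kernel y (x - t) * expR (p * b t))) D mfn mlim cvg_fn iD dom.
split; first exact: i1.
have L : (normc (g (z + (0 +i* e n))))%:E @[n --> \oo] --> (normc (g z))%:E.
  apply: cvg_EFin; first exact: nearW.
  have gz : normc (g w) @[w --> z] --> normc (g z).
    apply: (@continuous_comp _ _ _ g (@normc R : CC R -> R)); last exact: continuous_normc.
    by apply: derivable_cts; exact: g_hol.
  apply: (cvg_comp _ _ _ gz) => A /nbhsCP[d d0 Hd].
  have [N HN] : exists N : nat, N.+1%:R^-1 < d.
    exists (Num.trunc d^-1); rewrite invf_plt ?posrE//; exact: truncnS_gt.
  exists N => // n /= Nn; apply: Hd.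
  rewrite [z + _]addrC addrK /= expr0n add0r sqrtr_sqr ger0_norm ?(ltW (e0 n))//.
  by apply: le_lt_trans HN; rewrite lef_pV2 ?posrE// ler_nat.
rewrite -normc_g; apply: (lee_cvg_to L i3); exact: nearW.
Qed.

End Majorant.

End HardyToPoisson.

(** * From the Hardy condition to the Smirnov condition *)

Section HardyToSmirnov.
Variable R : realType.
Local Notation mu := (@lebesgue_measure R).
Implicit Types (x y t a alpha m : R) (z w : CC R) (F G P : CC R -> CC R).

Lemma normc_real_power F a G z : real_power F a G -> upper_half_plane z ->
  F z != 0 /\ normc (G z) = expR (a * ln (normc (F z))).
Proof.
move=> [L [_ FL] GL] Uz; rewrite -FL// cexp_neq0; split => //.
by rewrite GL// !normc_cexp expRK creM /= mul0r subr0.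
Qed.

Lemma weight_measurable (w : R -> R) : weight w -> measurable_fun setT w.
Proof. by case => -[]. Qed.

Lemma small_exponent m : 0 <= m -> exists2 d : R, 0 < d <= 1 & forall e, 0 < e <= d -> m * e <= 2^-1.
Proof.
move=> m0; have M0 : 0 < 2 * (m + 1) by rewrite mulr_gt0// ltr_wpDl.
exists (Num.min 1 (2 * (m + 1))^-1); first by rewrite lt_min ltr01 invr_gt0 M0 ge_min lexx.
move=> e /andP[e0]; rewrite le_min => /andP[_ ed].
have : (m + 1) * e <= (m + 1) * (2 * (m + 1))^-1 by rewrite ler_wpM2l// addr_ge0.
have -> : (m + 1) * (2 * (m + 1))^-1 = 2^-1 by field; rewrite gt_eqF// ltr_wpDl.
by lra.
Qed.

Lemma hardy_smirnov alpha F Fbd m s q (Pm Ps Fq : CC R -> CC R) : 0 < alpha < pi / 2 ->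
  {ae mu, forall x, nt_limit (fun z => normc (F z)) x (Fbd x)} -> weight Fbd ->
  0 <= m -> 0 <= s -> 0 < q ->
  real_power (fun z => 'i%C + z) m Pm -> real_power (fun z => 'i%C + z) s Ps ->
  real_power F (- q) Fq ->
  hardy1 alpha (fun z => F z / Pm z) -> hardy1 alpha (fun z => Fq z / Ps z) ->
  smirnov_type F.
Proof.
move=> ha hlim wF m0 s0 q0 hPm hPs [L [hL FL] FqL] H1 H2.
have q1 : q != 0 by rewrite gt_eqF.
pose u t := ln (Fbd t).
have mF := weight_measurable wF; have [_ Fpos] := wF.
have mu_ : measurable_fun setT u by apply: measurableT_comp => //; exact: measurable_ln.
have nF z : upper_half_plane z -> normc (F z) = expR (complex.Re (L z)).
  by move=> Uz; rewrite -FL// normc_cexp.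
have nFq z : upper_half_plane z -> normc (Fq z) = expR (- q * complex.Re (L z)).
  by move=> Uz; rewrite FqL// normc_cexp creM /= mul0r subr0.
have hb1 : {ae mu, forall x, nt_limit (fun z => normc (F z)) x (expR (u x))}.
  by apply: ae_imp2 hlim Fpos => t ht t0; rewrite /u lnK.
have hb2 : {ae mu, forall x, nt_limit (fun z => normc (Fq z)) x (expR (- q * u x))}.
  apply: ae_imp2 hlim Fpos => t ht t0.
  apply: (nt_limit_comp (phi := fun r => expR (- q * ln r)) ht).
    apply: (cvg_comp _ _ (cvgM (cvg_cst (- q)) (continuous_ln t0))); exact: continuous_expR.
  by move=> z Uz; rewrite nFq// nF// expRK.
have [d1 /andP[d10 d11] Hd1] := small_exponent m0.
have [d2 /andP[d20 d21] Hd2] := small_exponent s0.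
(* The power F^(-e) is reached as (F^(-q))^(e/q), so the second Hardy condition requires e/q <=
   d2. *)
pose d := Num.min d1 (q * d2).
have d0 : 0 < d by rewrite lt_min d10 mulr_gt0.
have M1 e z : 0 < e <= d -> upper_half_plane z ->
    mu.-integrable setT (EFin \o (fun t =>
      poisson_kernel (complex.Im z) (complex.Re z - t) * expR (e * u t))) /\
    ((expR (e * complex.Re (L z)))%:E <=
      \int[mu]_t (poisson_kernel (complex.Im z) (complex.Re z - t) * expR (e * u t))%:E)%E.
  rewrite le_min => /and3P[e0 ed1 _] Uz.
  apply: (poisson_majorant ha _ _ hL _ _ H1 mu_ hb1 Uz).
  - by rewrite e0 (le_trans ed1).
  - by apply: Hd1; rewrite e0.
  - by move=> w /FL.
  - by move=> w Uw; have [] := normc_real_power hPm Uw.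
have hLq : holomorphic (fun z => (- q)%:C * L z).
  by move=> z Uz; apply: derivable_scale; exact: hL.
have muq : measurable_fun setT (fun t => - q * u t) by exact: measurable_funM.
have M2 e z : 0 < e <= d -> upper_half_plane z ->
    mu.-integrable setT (EFin \o (fun t =>
      poisson_kernel (complex.Im z) (complex.Re z - t) * expR (- e * u t))) /\
    ((expR (- e * complex.Re (L z)))%:E <=
      \int[mu]_t (poisson_kernel (complex.Im z) (complex.Re z - t) * expR (- e * u t))%:E)%E.
  rewrite le_min => /and3P[e0 _ ed2] Uz.
  have E r : e / q * (- q * r) = - e * r by field.
  have eq0 : 0 < e / q <= d2 by rewrite divr_gt0//= ler_pdivrMr// mulrC.
  have [] := @poisson_majorant R alpha s (e / q) Fq Ps _ _ ha _ (Hd2 _ eq0) hLq FqL _ H2 muq hb2 z Uz.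
  - by move/andP: eq0 => [-> /= h]; exact: le_trans h d21.
  - by move=> w Uw; have [] := normc_real_power hPs Uw.
  move=> i1 i2; split.
    by move: i1; congr (_.-integrable _ _); apply/funext => t /=; rewrite E.
  move: i2; rewrite creM /= mul0r subr0 E.
  by under eq_integral do rewrite E.
have d00 : 0 < d <= d by rewrite d0 lexx.
exists u; split.
- apply: ae_imp2 hlim Fpos => t ht t0.
  by apply: (nt_limit_comp (phi := fun r => ln r) ht) => //; exact: continuous_ln.
(* At the point i the Poisson kernel is 1 / (pi (1 + t^2)), so Poisson integrability is the
   integrability of P u there. *)
- have Ui : upper_half_plane (0 +i* 1 : CC R) by rewrite /upper_half_plane /=.
  have [i1 _] := M1 d _ d00 Ui; have [i2 _] := M2 d _ d00 Ui; rewrite /= in i1 i2.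
  have := integrable_RZ pi (integrable_of_exp ltr01 d0 mu_ i1 i2).
  rewrite /poisson_integrable; congr (_.-integrable _ _); apply/funext => t /=.
  rewrite /poisson_kernel sub0r sqrrN expr1n (real_normK (num_real t)) [1 + _]addrC.
  by rewrite !mulrA mulfV ?gt_eqF ?pi_gt0// mul1r mul1r mulrC.
move=> z Uz; have y0 : 0 < complex.Im z := Uz.
have [i1 _] := M1 d z d00 Uz; have [i2 _] := M2 d z d00 Uz.
rewrite nF// expRK /poisson_extension; apply/eqP; rewrite eq_le; apply/andP; split.
  apply: (poisson_log_le y0 d0 mu_ i1 i2) => e ed; by have [] := M1 e z ed Uz.
(* The reverse inequality is the same one for 1/F, with [- u] in place of [u]; [M1] and [M2]
   exchange their roles. *)
rewrite -lerN2.
have iu := integrable_of_exp y0 d0 mu_ i1 i2.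
have -> : - (\int[mu]_t (poisson_kernel (complex.Im z) (complex.Re z - t) * u t)) =
    \int[mu]_t (poisson_kernel (complex.Im z) (complex.Re z - t) * (- u t)).
  rewrite -mulN1r -RintegralZl//; apply: eq_Rintegral => t _; by rewrite mulN1r mulrN.
have mNu : measurable_fun setT (fun t => - u t) by exact: measurable_funN.
apply: (poisson_log_le y0 d0 mNu).
- by move: i2; congr (_.-integrable _ _); apply/funext => t /=; rewrite mulrN mulNr.
- by move: i1; congr (_.-integrable _ _); apply/funext => t /=; rewrite mulrNN.
move=> e ed; have [_] := M2 e z ed Uz; rewrite mulrN mulNr.
by under eq_integral do rewrite mulNr -mulrN.
Qed.

End HardyToSmirnov.

(** * The Schwarz integral *)

Section SchwarzIntegral.
Variable R : realType.
Local Notation mu := (@lebesgue_measure R).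
Implicit Types (x y t : R) (z w : CC R) (F L : CC R -> CC R).

(** * Integration of bounded kernels against an integrable density *)

Section WeightedIntegral.
Variable U : R -> R.
Hypothesis iU : mu.-integrable setT (EFin \o U).

Definition bounded_cts (k : R -> CC R) := continuous k /\ exists B, forall t, normc (k t) <= B.

Definition wint (k : R -> CC R) : CC R :=
  (\int[mu]_t (complex.Re (k t) * U t)) +i* (\int[mu]_t (complex.Im (k t) * U t)).

Lemma integrable_bounded_mul (p : R -> R) B : continuous p -> (forall t, `|p t| <= B) ->
  mu.-integrable setT (EFin \o (fun t => p t * U t)).
Proof.
move=> cp pB; have iB := integrable_RZ B iU.
have mU : measurable_fun setT U by apply/measurable_EFinP; exact: measurable_int iU.
apply: le_integrable iB => //.
  by apply/measurable_EFinP; apply: measurable_funM => //; exact: continuous_measurable_fun.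
move=> t _ /=; rewrite lee_fin [X in X <= _]normrM [leRHS]normrM; apply: ler_wpM2r => //.
exact: le_trans (ler_norm _).
Qed.

Lemma wint_int k : bounded_cts k ->
  mu.-integrable setT (EFin \o (fun t => complex.Re (k t) * U t)) /\
  mu.-integrable setT (EFin \o (fun t => complex.Im (k t) * U t)).
Proof.
move=> [ck [B kB]]; split; apply: (@integrable_bounded_mul _ B).
- by move=> t; apply: cvg_Re; exact: ck.
- by move=> t; apply: le_trans (kB t); exact: Re_le_normc.
- by move=> t; apply: cvg_Im; exact: ck.
- by move=> t; apply: le_trans (kB t); exact: Im_le_normc.
Qed.

Lemma wintB k1 k2 : bounded_cts k1 -> bounded_cts k2 ->
  wint (fun t => k1 t - k2 t) = wint k1 - wint k2.
Proof.
move=> /wint_int[r1 i1] /wint_int[r2 i2]; rewrite /wint; apply: complexP; rewrite !creimE /=.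
  by rewrite -RintegralB//; apply: eq_Rintegral => t _; rewrite !creimE mulrBl.
by rewrite -RintegralB//; apply: eq_Rintegral => t _; rewrite !creimE mulrBl.
Qed.

Lemma wintZ (c : CC R) k : bounded_cts k -> wint (fun t => c * k t) = c * wint k.
Proof.
move=> /wint_int[r1 i1]; rewrite /wint; apply: complexP; rewrite !creimE /=.
  rewrite -!RintegralZl// -RintegralB//; [|exact: integrable_RZ|exact: integrable_RZ].
  by apply: eq_Rintegral => t _; rewrite !creimE; ring.
rewrite -!RintegralZl// -RintegralD//; [|exact: integrable_RZ|exact: integrable_RZ].
by apply: eq_Rintegral => t _; rewrite !creimE; ring.
Qed.

Lemma wint_le k M : bounded_cts k -> (forall t, normc (k t) <= M) ->
  normc (wint k) <= 2 * (M * \int[mu]_t `|U t|).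
Proof.
move=> bk kM; have [r1 i1] := wint_int bk.
have iN : mu.-integrable setT (EFin \o (fun t => `|U t|)) by exact: integrable_norm.
have B (p : R -> R) : mu.-integrable setT (EFin \o (fun t => p t * U t)) ->
    (forall t, `|p t| <= M) -> `|\int[mu]_t (p t * U t)| <= M * \int[mu]_t `|U t|.
  move=> ip pM; apply: le_trans (le_normr_Rintegral _ ip) _ => //.
  rewrite -RintegralZl//; apply: le_Rintegral => //.
  - exact: integrable_norm.
  - exact: integrable_RZ.
  by move=> t _; rewrite [X in X <= _]normrM; apply: ler_wpM2r.
apply: (le_trans (normc_le_ReIm _)) => /=.
have := B _ r1 (fun t => le_trans (Re_le_normc _) (kM t)).
have := B _ i1 (fun t => le_trans (Im_le_normc _) (kM t)).
move=> hI hR; apply: le_trans (lerD hR hI) _.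
by rewrite -mulr2n -[_ *+ 2]mulr_natl.
Qed.

Lemma bounded_ctsB k1 k2 : bounded_cts k1 -> bounded_cts k2 -> bounded_cts (fun t => k1 t - k2 t).
Proof.
move=> [c1 [B1 k1B]] [c2 [B2 k2B]]; split; first by move=> t; apply: cvgB; [exact: c1|exact: c2].
by exists (B1 + B2) => t; apply: le_trans (normcB_le _ _) _; exact: lerD.
Qed.

Lemma bounded_ctsZ (c : CC R) k : bounded_cts k -> bounded_cts (fun t => c * k t).
Proof.
move=> [c1 [B1 k1B]]; split; first by move=> t; apply: cvgM; [exact: cvg_cst|exact: c1].
by exists (normc c * B1) => t; rewrite normcM ler_wpM2l ?normc_ge0.
Qed.

End WeightedIntegral.

Definition schwarz_const : CC R := 0 -i* pi^-1.

(* (1 + t^2) times the Schwarz kernel (1 / (pi i)) (1 / (t - z) - t / (1 + t^2)),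
   whose real part is the Poisson kernel. *)
Definition schwarz_kernel z t : CC R := schwarz_const * ((1 + t%:C * z) / (t%:C - z)).

(** The derivative of [schwarz_kernel] in z. *)
Definition schwarz_kernel' z t : CC R := schwarz_const * ((1 + t%:C ^+ 2) / (t%:C - z) ^+ 2).

Lemma real_sub_neq0 z t : upper_half_plane z -> t%:C - z != 0.
Proof.
move=> Uz; apply/eqP => /(congr1 (@complex.Im R)); rewrite !creimE /= => h.
by have : 0 < complex.Im z := Uz; lra.
Qed.

Lemma Im_le_dist z t : upper_half_plane z -> complex.Im z <= normc (t%:C - z).
Proof.
move=> Uz; apply: le_trans (Im_le_normc _); rewrite !creimE /= add0r normrN.
exact: ler_norm.
Qed.

(** A rewriting of [poisson_kernel_le], as the kernel at t is Im z / (pi |t - z|^2). *)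
Lemma quad_le_dist z : upper_half_plane z -> exists2 A, 0 < A &
  forall t, 1 + t ^+ 2 <= A * normc (t%:C - z) ^+ 2.
Proof.
move=> Uz; have y0 : 0 < complex.Im z := Uz.
exists (pi * poisson_const (complex.Re z) (complex.Im z) / complex.Im z).
  by rewrite divr_gt0// mulr_gt0 ?pi_gt0// poisson_const_gt0.
move=> t; have := poisson_kernel_le (complex.Re z) t y0; rewrite /poisson_kernel.
rewrite sqr_normcE !creimE /= add0r sqrrN -[t - _]opprB sqrrN.
set D := _ + complex.Im z ^+ 2; set C := poisson_const _ _.
have D0 : 0 < D by rewrite ltr_wpDl ?sqr_ge0 ?exprn_gt0.
have t0 : 0 < 1 + t ^+ 2 by rewrite ltr_pwDl// sqr_ge0.
rewrite ler_pdivlMr// => h.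
have -> : pi * C / complex.Im z * D = C * (pi * D / complex.Im z) by ring.
have p0 : 0 < pi * D / complex.Im z by rewrite divr_gt0// mulr_gt0// pi_gt0.
apply: le_trans (_ : _ <= (pi^-1 * (complex.Im z / D) * (1 + t ^+ 2)) * (pi * D / complex.Im z)) _.
  rewrite le_eqVlt; apply/orP; left; apply/eqP; clear h p0.
  by move: (pi_gt0 R); move: (pi : R) => q q0; field; rewrite !gt_eqF.
by rewrite ler_pM2r.
Qed.

Lemma continuous_realC : continuous (fun t => t%:C : CC R).
Proof. exact: continuous_hline. Qed.

Lemma bounded_schwarz_kernel z : upper_half_plane z -> bounded_cts (schwarz_kernel z).
Proof.
move=> Uz; split.
  move=> t; apply: cvgM; first exact: cvg_cst.
  apply: cvgM; last first.
    apply: cvgV; first exact: real_sub_neq0.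
    by apply: cvgB; [exact: continuous_realC|exact: cvg_cst].
  apply: cvgD; first exact: cvg_cst.
  by apply: cvgM; [exact: continuous_realC|exact: cvg_cst].
have [A A0 HA] := quad_le_dist Uz.
(* Cauchy-Schwarz gives |1 + tz|^2 <= (1 + |z|^2)(1 + t^2), and [quad_le_dist] bounds the last
   factor by A |t - z|^2. *)
exists (normc schwarz_const * Num.sqrt ((1 + normc z ^+ 2) * A)) => t.
rewrite normcM ler_wpM2l ?normc_ge0// normcM normcV.
have d0 : 0 < normc (t%:C - z) by rewrite normc_gt0 real_sub_neq0.
rewrite ler_pdivrMr// -(@ler_pXn2r _ 2)// ?nnegrE ?normc_ge0// ?mulr_ge0 ?sqrtr_ge0 ?normc_ge0//.
have A1 : 0 <= (1 + normc z ^+ 2) * A by rewrite mulr_ge0 ?addr_ge0 ?sqr_ge0 ?(ltW A0).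
rewrite exprMn sqr_sqrtr// -mulrA.
apply: (@le_trans _ _ ((1 + normc z ^+ 2) * (1 + t ^+ 2))); last first.
  by rewrite ler_wpM2l// addr_ge0// sqr_ge0.
apply: (@le_trans _ _ ((1 + `|t| * normc z) ^+ 2)).
  rewrite lerXn2r// ?nnegrE ?normc_ge0// ?addr_ge0 ?mulr_ge0 ?normc_ge0//.
  by apply: le_trans (normcD_le _ _) _; rewrite normc1 normcM normcR.
have E : `|t| ^+ 2 = t ^+ 2 := real_normK (num_real t).
rewrite -E -subr_ge0.
have -> : (1 + normc z ^+ 2) * (1 + `|t| ^+ 2) - (1 + `|t| * normc z) ^+ 2 = (`|t| - normc z) ^+ 2 by ring.
exact: sqr_ge0.
Qed.

Lemma normc_quad t : normc (1 + t%:C ^+ 2 : CC R) = 1 + t ^+ 2.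
Proof.
have -> : (1 + t%:C ^+ 2 : CC R) = (1 + t ^+ 2)%:C by rewrite rmorphD rmorphXn rmorph1.
by rewrite normcR ger0_norm// addr_ge0// sqr_ge0.
Qed.

Lemma bounded_schwarz_kernel' z : upper_half_plane z -> bounded_cts (schwarz_kernel' z).
Proof.
move=> Uz; split.
  move=> t; apply: cvgM; first exact: cvg_cst.
  apply: cvgM; last first.
    apply: cvgV; first by rewrite expf_neq0// real_sub_neq0.
    by apply: cvgM; apply: cvgB; solve [exact: continuous_realC|exact: cvg_cst].
  apply: cvgD; first exact: cvg_cst.
  by apply: cvgM; exact: continuous_realC.
have [A A0 HA] := quad_le_dist Uz.
exists (normc schwarz_const * A) => t.
have d0 : 0 < normc (t%:C - z) by rewrite normc_gt0 real_sub_neq0.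
rewrite normcM ler_wpM2l ?normc_ge0// normcM normcV normcX normc_quad.
by rewrite ler_pdivrMr ?exprn_gt0.
Qed.

(** The first-order remainder in closed form. Its factor (w - z)^2 comes with a quotient bounded
    uniformly in t, so the Schwarz integral is differentiated by a plain estimate instead of a limit
    theorem. *)
Lemma schwarz_kernel_diff z w t : upper_half_plane z -> upper_half_plane w ->
  schwarz_kernel w t - schwarz_kernel z t - (w - z) * schwarz_kernel' z t =
  schwarz_const * ((w - z) ^+ 2 * ((1 + t%:C ^+ 2) / ((t%:C - z) ^+ 2 * (t%:C - w)))).
Proof.
move=> /(real_sub_neq0 t) tz /(real_sub_neq0 t) tw; rewrite /schwarz_kernel /schwarz_kernel'.
set c := schwarz_const; set T := t%:C in tz tw *.
have E (X Y Z : CC R) : c * X - c * Y - (w - z) * (c * Z) = c * (X - Y - (w - z) * Z) by ring.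
by rewrite E; congr (_ * _); field; rewrite tz tw.
Qed.

Section Extension.
Variable u : R -> R.
Hypothesis iu : poisson_integrable u.

Let U t := u t / (1 + `|t| ^+ 2).

Definition schwarz z : CC R := wint U (schwarz_kernel z).

Lemma Re_schwarz z : upper_half_plane z ->
  complex.Re (schwarz z) = poisson_extension u (complex.Im z) (complex.Re z).
Proof.
move=> Uz; rewrite /schwarz /wint /= /poisson_extension; apply: eq_Rintegral => t _.
have t0 : 1 + t ^+ 2 != 0 by rewrite gt_eqF// ltr_pwDl// sqr_ge0.
suff -> : complex.Re (schwarz_kernel z t) = (1 + t ^+ 2) * poisson_kernel (complex.Im z) (complex.Re z - t).
  by rewrite /U (real_normK (num_real t)); field.
have tz := real_sub_neq0 t Uz.
pose x := complex.Re z; pose y := complex.Im z; set D := (x - t) ^+ 2 + y ^+ 2.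
have y0 : 0 < y := Uz.
have D0 : D != 0 by rewrite gt_eqF// ltr_wpDl ?sqr_ge0 ?exprn_gt0.
rewrite /schwarz_kernel; have -> : (t%:C - z)^-1 = D^-1%:C * ((t - x) +i* y).
  apply: (mulfI tz); rewrite mulfV//.
  have K : (t%:C - z) * ((t - x) +i* y) = D%:C.
    by apply: complexP; rewrite !creimE /= /D -/x -/y; ring.
  by rewrite mulrCA K -rmorphM mulVf.
rewrite /poisson_kernel -/x -/y -/D /schwarz_const !creimE /= -/x -/y.
by move: (pi_gt0 R); move: (pi : R) => q q0; field; rewrite D0 gt_eqF.
Qed.

Lemma holomorphic_schwarz : holomorphic schwarz.
Proof.
move=> z Uz; have y0 : 0 < complex.Im z := Uz; set y := complex.Im z in y0.
have iU : mu.-integrable setT (EFin \o U) by exact: iu.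
apply/derivable_cderiv; exists (wint U (schwarz_kernel' z)) => e e0.
have [A A0 HA] := quad_le_dist Uz.
have [d2 d20 Hd2] := (nbhsCP _ _).1 (open_upper_half_plane Uz).
set I := \int[mu]_t `|U t|; have I0 : 0 <= I by exact: Rintegral_ge0.
set B := 2 * (normc schwarz_const * (A * (2 / y)) * I).
have B0 : 0 <= B by rewrite !mulr_ge0 ?normc_ge0 ?invr_ge0 ?(ltW A0) ?(ltW y0).
(* The radius y/2 keeps |t - w| >= y/2 for real t, [d2] keeps w in the half-plane, and e / (B + 1)
   turns the remainder B |w - z|^2 into at most e |w - z|. *)
exists (Num.min (Num.min (y / 2) d2) (e / (B + 1))).
  by rewrite !lt_min d20 !divr_gt0// ltr_wpDl.
move=> w; rewrite !lt_min => /andP[/andP[wy /Hd2 Uw]].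
rewrite ltr_pdivlMr ?ltr_wpDl// => we.
have bz := bounded_schwarz_kernel Uz; have bw := bounded_schwarz_kernel Uw.
have b' := bounded_schwarz_kernel' Uz.
rewrite /schwarz -(wintB iU bw bz) [X in _ - X]mulrC -(wintZ iU _ b').
rewrite -(wintB iU (bounded_ctsB bw bz) (bounded_ctsZ (w - z) b')).
set N := normc (w - z) in we *.
have N0 : 0 <= N := normc_ge0 _.
have H t : normc (schwarz_kernel w t - schwarz_kernel z t - (w - z) * schwarz_kernel' z t) <=
    normc schwarz_const * (N ^+ 2 * (A * (2 / y))).
  rewrite schwarz_kernel_diff// normcM ler_wpM2l ?normc_ge0// normcM normcX -/N.
  rewrite ler_wpM2l ?sqr_ge0// normcM normcV normcM normcX normc_quad.
  have d0 : 0 < normc (t%:C - z) by rewrite normc_gt0 real_sub_neq0.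
  have d1 : y / 2 <= normc (t%:C - w).
    have := Im_le_dist t Uz; have := normcB_ge (t%:C - z) (w - z).
    have -> : t%:C - z - (w - z) = t%:C - w by ring.
    have yE : y = complex.Im z by []; move: wy; rewrite yE; lra.
  have d2' : 0 < normc (t%:C - w) by apply: lt_le_trans d1; rewrite divr_gt0.
  rewrite invfM mulrA; apply: ler_pM.
  - by rewrite divr_ge0 ?exprn_ge0 ?normc_ge0// addr_ge0// sqr_ge0.
  - by rewrite invr_ge0 normc_ge0.
  - by rewrite ler_pdivrMr ?exprn_gt0.
  by rewrite -[2 / y]invf_div lef_pV2 ?posrE ?divr_gt0.
apply: le_trans (wint_le iU _ H) _.
  exact: bounded_ctsB (bounded_ctsB bw bz) (bounded_ctsZ (w - z) b').
have -> : 2 * (normc schwarz_const * (N ^+ 2 * (A * (2 / y))) * I) = B * N * N.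
  by rewrite /B; ring.
rewrite ler_wpM2r// (le_trans _ (ltW we))// mulrC ler_wpM2l//; lra.
Qed.

End Extension.

Lemma unimodular_cexp (c : CC R) : normc c = 1 -> exists a : R, cexp (0 +i* a) = c.
Proof.
case: c => a b /(congr1 (fun r => r ^+ 2)); rewrite sqr_normcE /= expr1n => ab.
have a1 : -1 <= a <= 1.
  by rewrite -ler_norml -(@ler_pXn2r _ 2)// ?nnegrE// real_normK ?num_real// expr1n -ab lerDl sqr_ge0.
have bE : 1 - a ^+ 2 = b ^+ 2 by rewrite -ab addrC addKr.
have [b0|b0] := leP 0 b.
  exists (acos a); rewrite /cexp /= expR0 mul1r acosK ?sin_acos ?in_itv//.
  by rewrite bE sqrtr_sqr ger0_norm.
exists (- acos a); rewrite /cexp /= expR0 mul1r cosN sinN acosK ?sin_acos ?in_itv//.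
by rewrite bE sqrtr_sqr ltr0_norm// opprK.
Qed.

(** The Schwarz integral S has real part log|F|, so F / e^S is holomorphic of modulus one, hence
    constant; an argument of that constant corrects the imaginary part of S. *)
Lemma poisson_log_branch F u : holomorphic F -> (forall z, upper_half_plane z -> F z != 0) ->
  poisson_integrable u ->
  (forall z, upper_half_plane z ->
    ln (normc (F z)) = poisson_extension u (complex.Im z) (complex.Re z)) ->
  exists L, log_branch F L.
Proof.
move=> hF F0 iu Fu; set S := schwarz u; have hS : holomorphic S by exact: holomorphic_schwarz.
pose G z := F z / cexp (S z).
have hG : holomorphic G.
  move=> z Uz; apply: derivableM; first exact: hF.
  by apply: derivableV; [exact: cexp_neq0|apply: derivable_cexp; exact: hS].
have G1 z : upper_half_plane z -> normc (G z) = 1.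
  move=> Uz; rewrite normcM normcV normc_cexp Re_schwarz// -Fu// lnK ?mulfV//.
    by rewrite normc_eq0 F0.
  by rewrite posrE normc_gt0 F0.
pose z0 : CC R := 0 +i* 1.
have U0 : upper_half_plane z0 by rewrite /upper_half_plane /=.
have [a Ha] := unimodular_cexp (G1 _ U0).
exists (fun z => S z + (0 +i* a)); split.
  by move=> z Uz; apply: derivableD; [exact: hS|exact: derivable_cst].
move=> z Uz; rewrite cexpD Ha (unimodular_cst hG G1 U0 Uz) /G mulrC divfK//.
exact: cexp_neq0.
Qed.

End SchwarzIntegral.

(** * Weights and the maximal function *)

Section MaximalBounds.
Variable R : realType.
Local Notation mu := (@lebesgue_measure R).
Implicit Types (x y t a alpha m : R) (z : CC R) (f h w u : R -> R).

(* [logw t = ln |i + t|] *)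
Definition logw t : R := ln (1 + t ^+ 2) / 2.

Lemma logw_ge0 t : 0 <= logw t.
Proof. by rewrite /logw divr_ge0// ln_ge0// lerDl sqr_ge0. Qed.

Lemma continuous_logw : continuous logw.
Proof.
move=> t; apply: cvgM; last exact: cvg_cst.
apply: (@continuous_comp _ _ _ (fun t => 1 + t ^+ 2) (@ln R)).
  by apply: cvgD; [exact: cvg_cst|exact: exprn_continuous].
by apply: continuous_ln; rewrite ltr_pwDl// sqr_ge0.
Qed.

Lemma logw_ge n t : 4 ^+ n <= `|t| -> n%:R * ln 4 <= logw t.
Proof.
move=> tn; have n0 : 0 < (4 : R) ^+ n by rewrite exprn_gt0.
have -> : n%:R * ln 4 = ln ((4 ^+ n) ^+ 2) / 2 :> R.
  by rewrite lnXn// lnXn// -[X in X / 2]mulr_natr -[X in X * 2]mulr_natl mulfK.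
rewrite /logw ler_pM2r ?invr_gt0//; rewrite ler_ln ?posrE ?exprn_gt0 ?ltr_pwDl ?sqr_ge0//.
rewrite -(real_normK (num_real t)); apply: (@le_trans _ _ (`|t| ^+ 2)); last by rewrite lerDr.
by rewrite lerXn2r// nnegrE ?normr_ge0// ltW.
Qed.

Lemma logw_decay f (K A : R) : 0 <= K -> 0 <= A -> measurable_fun setT f -> (forall t, 0 <= f t) ->
  (forall n, \int[mu]_(t in ball (0%R : R) (4 ^+ n)%R) (f t)%:E <= (K * A ^+ n)%:E)%E ->
  exists2 m, 0 <= m & (\int[mu]_t (f t * expR (- m * logw t))%:E < +oo)%E.
Proof.
move=> K0 A0 mf f0 fK; have l4 : 0 < ln 4 :> R by rewrite ln_gt0//; lra.
(* With m ln 4 = 2A the weight is at most e^(-2An) for |t| >= 4^n, which beats A^n: A e^(-2A) <= 1/2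
   because e^(2A) >= 1 + 2A. The first constant e^(2A) compensates the exponent n + 1. *)
pose m : R := 2 * A / ln 4; have ml : m * ln 4 = 2 * A by rewrite /m divfK// gt_eqF.
have m0 : 0 <= m by rewrite divr_ge0// ?mulr_ge0// ltW.
exists m => //; under eq_integral do rewrite mulrC.
apply: (@le_lt_trans _ _ ((2 * (expR (2 * A) * K))%:E)%E); last exact: ltry.
apply: (@integral_layer_le _ _ f 0 1 (expR (2 * A)) (expR (- (2 * A))) K A) => //.
- rewrite expRN mulrC ler_pdivrMr ?expR_gt0//.
  by have := expR_ge1Dx (2 * A); lra.
- apply: measurableT_comp => //; apply: measurable_funM => //.
  by apply: continuous_measurable_fun; exact: continuous_logw.
- move=> t; rewrite expR_ge0 ler_expR/=.
  by have := mulr_ge0 m0 (logw_ge0 t); rewrite mulNr; lra.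
- move=> n t; rewrite mulr1 subr0 => /logw_ge tn.
  rewrite -expRM_natl -expRD ler_expR.
  have : m * (n%:R * ln 4) <= m * logw t by rewrite ler_wpM2l.
  have -> : m * (n%:R * ln 4) = n%:R * (2 * A) by rewrite -ml; ring.
  by rewrite mulNr -[n.+1%:R]natr1; lra.
- by move=> n; rewrite mulr1.
Qed.

Lemma cone_dist alpha x z t : 0 < tan alpha -> cone alpha x z ->
  (t - x) ^+ 2 <= 2 * (1 + tan alpha ^+ 2) * ((complex.Re z - t) ^+ 2 + complex.Im z ^+ 2).
Proof.
move=> T0 [y0]; move: (tan alpha) T0 => T T0; move: (complex.Re z) (complex.Im z) y0 => X y y0.
rewrite ltr_norml => /andP[h1 h2].
have : (x - X) ^+ 2 <= T ^+ 2 * y ^+ 2.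
  have : 0 <= (T * y - (x - X)) * (T * y + (x - X)) by rewrite mulr_ge0//; lra.
  by rewrite !expr2; lra.
have := sqr_ge0 (X - t + (x - X)); have := sqr_ge0 (X - t - (x - X)).
have := sqr_ge0 (T * (X - t)); have := sqr_ge0 y.
by rewrite !expr2; lra.
Qed.

Lemma integral_ball_le_HL h x (r : R) : 0 < r ->
  (\int[mu]_(t in ball x r) `|(h t)%:E| <= (2 * r)%:E * HL_maximal h x)%E.
Proof.
move=> r0; have : (iavg h (ball x r) <= HL_maximal h x)%E.
  by apply: ereal_sup_ubound; exists r => //=; rewrite in_itv/= r0.
have r20 : 0 < r *+ 2 by rewrite pmulrn_lgt0.
rewrite /iavg lebesgue_measure_ball ?(ltW r0)// inver gt_eqF// => H.
have -> : (2 * r)%:E = (r *+ 2)%:E by rewrite mulr_natl.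
by rewrite muleC -lee_pdivrMr// muleC.
Qed.

(** The layers are centred at the vertex x and not at Re z, so that their integrals are those in the
    maximal function at x; [cone_dist] moves the decay of the kernel from one centre to the
    other. *)
Lemma cone_poisson_le_HL alpha h x z : 0 < tan alpha -> cone alpha x z ->
  measurable_fun setT h -> (forall t, 0 <= h t) -> (0 <= HL_maximal h x)%E ->
  (\int[mu]_t (poisson_kernel (complex.Im z) (complex.Re z - t) * h t)%:E <=
   (128 * (1 + tan alpha ^+ 2) / pi)%:E * HL_maximal h x)%E.
Proof.
move=> T0 xz mh h0 HL0; have y0 := xz.1.
have dist t := cone_dist t T0 xz.
have HLb := fun r => @integral_ball_le_HL h x r.
have mP := continuous_measurable_fun (continuous_poisson_kernel (x := complex.Re z) y0).
move: HL0 HLb; case: (HL_maximal h x) => [a| |] //; last first.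
  rewrite gt0_muley ?leey// lte_fin divr_gt0 ?pi_gt0// mulr_gt0// ltr_pwDl// sqr_ge0//.
rewrite lee_fin => a0 HLb.
have p0 := pi_gt0 R.
have B0 : 0 < 1 + tan alpha ^+ 2 by rewrite ltr_pwDl// sqr_ge0.
move: dist y0 mP; move: (complex.Re z) (complex.Im z) => X y dist y0 mP.
(* For |t - x| >= 4^n y, [cone_dist] gives P <= 2 (1 + tan^2) / (pi y 16^n) = c 16^-(n+1). The balls
   give K = 2ya with ratio 4, and 2cK is the asserted constant. *)
pose c := 32 * (1 + tan alpha ^+ 2) / (pi * y).
have -> : ((128 * (1 + tan alpha ^+ 2) / pi)%:E * a%:E = (2 * (c * (2 * y * a)))%:E)%E.
  rewrite -EFinM /c; congr EFin; move: p0; move: (pi : R) => p p0.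
  by field; rewrite !gt_eqF.
have c0 : 0 < c by rewrite divr_gt0// mulr_gt0.
have k0 : 0 < 16^-1 :> R by rewrite invr_gt0.
apply: (@integral_layer_le _ _ h x y c 16^-1 (2 * y * a) 4) => //.
- by rewrite !mulr_ge0// ltW.
- lra.
- move=> t; rewrite ltW ?poisson_kernel_gt0//=.
  apply: (@le_trans _ _ (pi^-1 * y^-1)).
    rewrite /poisson_kernel ler_pM2l ?invr_gt0// ler_pdivrMr; last first.
      by rewrite ltr_wpDl ?sqr_ge0 ?exprn_gt0.
    have e : y^-1 * y ^+ 2 = y by rewrite expr2 mulKf ?gt_eqF.
    by rewrite -[leLHS]e ler_wpM2l ?invr_ge0 ?(ltW y0)// lerDr sqr_ge0.
  rewrite -invfM /c ler_peMl ?invr_ge0 ?mulr_ge0 ?(ltW p0) ?(ltW y0)//.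
  by have := sqr_ge0 (tan alpha); lra.
- move=> n t nt.
  have D0 : 0 < (X - t) ^+ 2 + y ^+ 2 by rewrite ltr_wpDl ?sqr_ge0 ?exprn_gt0.
  have n0 : 0 < (16 : R) ^+ n by rewrite exprn_gt0.
  have -> : c * 16^-1 ^+ n.+1 = pi^-1 * (2 * (1 + tan alpha ^+ 2) / (y * 16 ^+ n)).
    rewrite /c [16^-1 ^+ _]exprS exprVn; move: p0 n0; move: (pi : R) (16 ^+ n) => p e p0 e0.
    by field; rewrite !gt_eqF.
  rewrite /poisson_kernel ler_pM2l ?invr_gt0// ler_pdivlMr ?mulr_gt0// mulrAC ler_pdivrMr//.
  apply: le_trans (dist t); rewrite mulrA mulrC -expr2.
  have -> : (16 : R) ^+ n = (4 ^+ n) ^+ 2 by rewrite -exprM mulnC exprM; congr (_ ^+ _); ring.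
  rewrite -exprMn -[leRHS](real_normK (num_real _)) lerXn2r// nnegrE ?normr_ge0//.
  by rewrite mulr_ge0// ?exprn_ge0// ltW.
- move=> n; under eq_integral do rewrite -[(h _)%:E]gee0_abs ?lee_fin//.
  apply: (le_trans (HLb _ _)); first by rewrite mulr_gt0// exprn_gt0.
  by rewrite -EFinM lee_fin; lra.
Qed.

(** * The Hardy-Littlewood maximal function on L^2 *)

Lemma sum_levels_le (e a : R) N : 0 < e -> 0 <= a ->
  \sum_(0 <= n < N) e * 2 ^+ n * (e * 2 ^+ n < a)%R%:R <= 2 * a.
Proof.
move=> e0 a0.
(* The second bound makes the induction close: when the level e 2^N is below a, adding it to a sum
   of at most e 2^N stays below 2a. *)
suff : \sum_(0 <= n < N) e * 2 ^+ n * (e * 2 ^+ n < a)%R%:R <= Num.min (2 * a) (e * 2 ^+ N).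
  by rewrite le_min => /andP[].
elim: N => [|N]; first by rewrite big_geq// le_min mulr_ge0// expr0 mulr1 ltW.
rewrite big_nat_recr//= !le_min => /andP[h1 h2].
have E : e * 2 ^+ N.+1 = e * 2 ^+ N + e * 2 ^+ N by rewrite exprS; ring.
have e1 : 0 <= e * 2 ^+ N by rewrite mulr_ge0 ?exprn_ge0// ltW.
by case: ltP => h3; rewrite /= ?mulr1 ?mulr0 ?addr0 E; apply/andP; split; lra.
Qed.

Lemma sqr_integrable_locally h : measurable_fun setT h -> (forall t, 0 <= h t) ->
  (\int[mu]_t (h t ^+ 2)%:E < +oo)%E -> locally_integrable setT h.
Proof.
move=> mh h0 h2; split => //; first exact: openT.
move=> K _ cK; have mK := compact_measurable cK.
have m2 : measurable_fun K (fun t => (h t ^+ 2)%:E).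
  by apply/measurable_EFinP; apply: measurable_funX; exact: measurable_funTS.
apply: (@le_lt_trans _ _ (\int[mu]_(t in K) (1%:E + (h t ^+ 2)%:E))%E).
  apply: ge0_le_integral => //.
  - by apply/measurable_EFinP; apply: measurableT_comp => //; exact: measurable_funTS.
  - exact: emeasurable_funD.
  - move=> t _; rewrite ger0_norm// -EFinD lee_fin.
    by have := sqr_ge0 (h t - 1); have := h0 t; rewrite !expr2; lra.
rewrite ge0_integralD//; last by move=> t _; rewrite lee_fin sqr_ge0.
rewrite integral_cst// mul1e lte_add_pinfty//; first exact: compact_finite_measure.
apply: le_lt_trans h2; apply: ge0_subset_integral => //.
  by apply/measurable_EFinP; apply: measurable_funX.
by move=> t _; rewrite lee_fin sqr_ge0.
Qed.

Lemma measurable_truncated h (a : R) : measurable_fun setT h ->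
  measurable_fun setT (fun t => h t * (a < h t)%R%:R).
Proof.
move=> mh; apply: measurable_funM => //.
rewrite (_ : (fun t => _) = \1_[set t | a < h t]); last first.
  by apply/funext => t; rewrite indicE; congr ((nat_of_bool _)%:R); apply/idP/idP; rewrite inE.
apply: measurable_indic; rewrite -[X in measurable X]setTI.
exact: (measurable_fun_ltr (measurable_cst a) mh).
Qed.

(** Pointwise h <= h 1_{h > a} + a, and the constant a has mean a on every ball. *)
Lemma HL_le_truncated h x (a : R) : measurable_fun setT h -> (forall t, 0 <= h t) -> 0 <= a ->
  (HL_maximal h x <= HL_maximal (fun t => (h t * (a < h t)%R%:R)%R) x + a%:E)%E.
Proof.
move=> mh h0 a0; apply: ge_ereal_sup => _ [r /= + <-]; rewrite in_itv/= andbT => r0.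
have mg := measurable_truncated a mh; set g := fun t => _ in mg *.
have r20 : 0 < r *+ 2 by rewrite pmulrn_lgt0.
have mB := measurable_ball x r.
have : (iavg g (ball x r) <= HL_maximal g x)%E.
  by apply: ereal_sup_ubound; exists r => //=; rewrite in_itv/= r0.
move=> /(leeD2r a%:E); apply: le_trans.
rewrite /iavg lebesgue_measure_ball ?(ltW r0)// inver gt_eqF//.
have J : (\int[mu]_(t in ball x r) `|(h t)%:E| <=
    \int[mu]_(t in ball x r) `|(g t)%:E| + (a * (r *+ 2))%:E)%E.
  rewrite EFinM -(lebesgue_measure_ball x (ltW r0)) -integral_cst// -ge0_integralD//; last first.
    by apply/measurable_EFinP; apply: measurableT_comp => //; exact: measurable_funTS.
  apply: ge0_le_integral => //.
  - by apply/measurable_EFinP; apply: measurableT_comp => //; exact: measurable_funTS.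
  - apply: emeasurable_funD; last exact: measurable_cst.
    by apply/measurable_EFinP; apply: measurableT_comp => //; exact: measurable_funTS.
  - move=> t _; rewrite -EFinD lee_fin /g normrM (ger0_norm (h0 t)).
    by case: ltP => /=; rewrite ?normr1 ?normr0 ?mulr1 ?mulr0 ?lerDl ?add0r.
apply: le_trans (lee_wpmul2l _ J) _; first by rewrite lee_fin invr_ge0 ltW.
by rewrite ge0_muleDr ?integral_ge0 ?lee_fin ?mulr_ge0 ?(ltW r20)// -EFinM mulrCA mulVf ?gt_eqF// mulr1.
Qed.

(** Marcinkiewicz's refinement of the weak type bound: the values of h up to l/2 raise the maximal
    function by at most l/2, so the part above l/2 must do the rest. The weak type constant is 3,
    whence 3 / (l/2) = 6/l. *)
Lemma maximal_tail h (l : R) : measurable_fun setT h -> (forall t, 0 <= h t) ->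
  (\int[mu]_t (h t ^+ 2)%:E < +oo)%E -> 0 < l ->
  (mu [set x | (l%:E < HL_maximal h x)%E] <=
   (6 / l)%:E * \int[mu]_t (h t * (l / 2 < h t)%R%:R)%:E)%E.
Proof.
move=> mh h0 h2 l0; set g := fun t => h t * (l / 2 < h t)%R%:R.
have l20 : 0 < l / 2 by rewrite divr_gt0.
have mg := measurable_truncated (l / 2) mh.
have g0 t : 0 <= g t by rewrite /g mulr_ge0.
have lh := sqr_integrable_locally mh h0 h2.
have lg : locally_integrable setT g.
  apply: sqr_integrable_locally => //; apply: le_lt_trans h2; apply: ge0_le_integral => //.
  - by move=> t _; rewrite lee_fin sqr_ge0.
  - by apply/measurable_EFinP; apply: measurable_funX.
  - by apply/measurable_EFinP; apply: measurable_funX.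
  - by move=> t _; rewrite lee_fin /g; case: ltP; rewrite /= ?mulr1 ?mulr0 ?expr0n ?sqr_ge0.
apply: (@le_trans _ _ (mu [set x | ((l / 2)%:E < HL_maximal g x)%E])).
  apply: le_measure.
  - rewrite inE -[X in measurable X]setTI; apply: emeasurable_fun_o_infty => //.
    exact: measurable_HL_maximal.
  - rewrite inE -[X in measurable X]setTI; apply: emeasurable_fun_o_infty => //.
    exact: measurable_HL_maximal.
  - move=> x /= /lt_le_trans/(_ (HL_le_truncated x mh h0 (ltW l20))).
    by rewrite -lteBlDr// -EFinB -/g; congr (_%:E < _)%E; lra.
apply: (le_trans (maximal_inequality lg l20)).
rewrite (_ : 3 / (l / 2) = 6 / l); last by field; rewrite gt_eqF.
apply: lee_wpmul2l; first by rewrite lee_fin divr_ge0// ltW.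
by under eq_integral do rewrite gee0_abs ?lee_fin//.
Qed.

(* Chop the range of the maximal function at the levels e 2^n. *)
Lemma maximal_square_above h (e : R) : measurable_fun setT h -> (forall t, 0 <= h t) ->
  (\int[mu]_t (h t ^+ 2)%:E < +oo)%E -> 0 < e ->
  (\int[mu]_(x in [set x | (e%:E < HL_maximal h x)%E]) (HL_maximal h x * HL_maximal h x) <=
   96%:E * \int[mu]_t (h t ^+ 2)%:E)%E.
Proof.
move=> mh h0 h2 e0; have lh := sqr_integrable_locally mh h0 h2.
have M0 := HL_maximalT_ge0 lh; have mM := measurable_HL_maximal lh.
have tail := fun l l0 => @maximal_tail h l mh h0 h2 l0.
move: M0 mM tail; move: (HL_maximal h) => M M0 mM tail.
pose l n : R := e * 2 ^+ n; have l0 n : 0 < l n by rewrite mulr_gt0// exprn_gt0.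
pose E n : set R := [set x | ((l n)%:E < M x)%E].
have mE n : measurable (E n).
  by rewrite -[X in measurable X]setTI; apply: emeasurable_fun_o_infty.
(* If l_m < M <= l_(m+1) = 2 l_m, the term of index m alone dominates M^2. *)
pose s n x : \bar R := ((4 * l n ^+ 2)%:E * (\1_(E n) x)%:E)%E.
have s0 n x : (0 <= s n x)%E by apply: mule_ge0; rewrite lee_fin//; apply: mulr_ge0 => //; exact: sqr_ge0.
have ms n : measurable_fun setT (s n).
  by apply: emeasurable_funM => //; apply/measurable_EFinP; exact: measurable_indic.
(* The tail bound at level l_n multiplied by 4 l_n^2: 4 l_n^2 * 6 / l_n = 24 l_n. *)
pose p n t : \bar R := (24 * (l n * (h t * (l n / 2 < h t)%R%:R)))%:E.
have p0 n t : (0 <= p n t)%E by rewrite lee_fin !mulr_ge0// ltW.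
have mp n : measurable_fun setT (p n).
  apply/measurable_EFinP; apply: measurable_funM => //; apply: measurable_funM => //.
  exact: measurable_truncated.
have mS : measurable_fun setT (fun x => \sum_(n <oo) s n x)%E.
  exact: (@ge0_emeasurable_sum _ _ _ setT s xpredT).
have mP : measurable_fun setT (fun x => \sum_(n <oo) p n x)%E.
  exact: (@ge0_emeasurable_sum _ _ _ setT p xpredT).
have eE : [set x | (e%:E < M x)%E] = E 0%N by rewrite /E /l expr0 mulr1.
have term n x : E n x -> ((4 * l n ^+ 2)%:E <= \sum_(n <oo) s n x)%E.
  move=> Enx; apply: le_trans (nneseries_lim_ge n.+1 _) => //.
  rewrite big_nat_recr//=; apply: le_trans (leeDr _ _); last by apply: sume_ge0 => i _.
  by rewrite /s indicE mem_set// mule1.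
apply: (@le_trans _ _ (\int[mu]_x (\sum_(n <oo) s n x))%E).
  rewrite eE; apply: (@le_trans _ _ (\int[mu]_(x in E 0%N) (\sum_(n <oo) s n x))%E); last first.
    apply: ge0_subset_integral => //; first exact: mE.
    by move=> x _; exact: nneseries_ge0.
  apply: ge0_le_integral => //.
  - exact: mE.
  - by move=> x _; rewrite mule_ge0.
  - by apply: emeasurable_funM; exact: measurable_funTS.
  - exact: measurable_funTS.
  move=> x E0x.
  have big b : exists n, b <= l n.
    exists (Num.trunc (b / e)).+1; rewrite /l mulrC -ler_pdivrMr//.
    by rewrite (le_trans (ltW (truncnS_gt _)))// -natrX ler_nat ltnW// ltn_expl.
  case Mx: (M x) => [a| |]; last by have := M0 x; rewrite Mx.
    case: (ex_minnP (big a)) => -[|m] am min.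
      by move: E0x; rewrite /E /= Mx lte_fin ltNge am.
    have lm : l m < a by rewrite ltNge; apply/negP => /min; rewrite ltnn.
    apply: le_trans (term m _ _); last by rewrite /E /= Mx lte_fin.
    rewrite -EFinM lee_fin -expr2.
    have -> : 4 * l m ^+ 2 = l m.+1 ^+ 2 by rewrite /l [2 ^+ m.+1]exprS; ring.
    by rewrite lerXn2r// nnegrE ltW// (lt_trans (l0 m)).
  (* Where M is infinite every level is passed, so the terms 4 l_n^2 of the series are unbounded. *)
  rewrite mulyy leye_eq; apply/eqP; apply/eqyP => b b0.
  have [n bn] := big (b + 1); apply: le_trans (term n _ _); last by rewrite /E /= Mx ltry.
  rewrite lee_fin; have : 0 <= l n * (l n - (b + 1)) by rewrite mulr_ge0 ?subr_ge0// ltW.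
  have := l0 n; have := sqr_ge0 (l n - 1); rewrite !expr2; nra.
rewrite integral_nneseries//.
have step n : (\int[mu]_x s n x <= \int[mu]_t p n t)%E.
  rewrite /s ge0_integralZl//; last 2 first.
  - by apply/measurable_EFinP; apply: measurable_indic; exact: mE.
  - by rewrite lee_fin; apply: mulr_ge0 => //; exact: sqr_ge0.
  rewrite integral_indic//; last exact: mE.
  rewrite setIT.
  have -> : (\int[mu]_t p n t = (24 * l n)%:E * \int[mu]_t (h t * (l n / 2 < h t)%R%:R)%:E)%E.
    rewrite -ge0_integralZl//; last 3 first.
    - by apply/measurable_EFinP; exact: measurable_truncated.
    - by move=> t _; rewrite lee_fin mulr_ge0.
    - by rewrite lee_fin mulr_ge0// ltW.
    by apply: eq_integral => t _; rewrite /p -EFinM; congr EFin; ring.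
  apply: le_trans (lee_wpmul2l _ (tail _ (l0 n))) _.
    by rewrite lee_fin; apply: mulr_ge0 => //; exact: sqr_ge0.
  rewrite muleA -EFinM (_ : 4 * l n ^+ 2 * (6 / l n) = 24 * l n)//.
  by have := l0 n; move: (l n) => r r0; field; rewrite gt_eqF.
apply: (@le_trans _ _ (\sum_(n <oo) (\int[mu]_t p n t))%E).
  apply: lee_nneseries; last by move=> n _; exact: step.
  by move=> n _ _; exact: integral_ge0.
rewrite -integral_nneseries// -ge0_integralZl//; last 2 first.
- by apply/measurable_EFinP; exact: measurable_funX.
- by move=> t _; rewrite lee_fin sqr_ge0.
apply: ge0_le_integral => //.
- by move=> t _; exact: nneseries_ge0.
- by apply: emeasurable_funM => //; apply/measurable_EFinP; exact: measurable_funX.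
move=> t _; apply: lime_le; first by apply: is_cvg_nneseries => n _ _.
apply: nearW => N; rewrite sumEFin -EFinM lee_fin -mulr_sumr.
have -> : \sum_(0 <= i < N) l i * (h t * (l i / 2 < h t)%R%:R) =
    h t * \sum_(0 <= n < N) e * 2 ^+ n * (e * 2 ^+ n < 2 * h t)%R%:R.
  rewrite mulr_sumr; apply: eq_bigr => n _; rewrite mulrCA; congr (_ * (_ * _)).
  by rewrite ltr_pdivrMr// [h t * 2]mulrC.
(* The levels below 2h sum to at most 4h, and 24 * 4 = 96. *)
have : h t * (\sum_(0 <= n < N) e * 2 ^+ n * (e * 2 ^+ n < 2 * h t)%R%:R) <= h t * (2 * (2 * h t)).
  by apply: ler_wpM2l => //; apply: sum_levels_le => //; rewrite mulr_ge0.
by move: (\sum_(0 <= n < N) _) => S; rewrite expr2; lra.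
Qed.

(** The bound of [maximal_square_above] is independent of e, so it survives monotone convergence
    over the sets {M > 1/(n+1)}, outside whose union M vanishes. *)
Lemma HL_maximal_square_integrable h : measurable_fun setT h -> (forall t, 0 <= h t) ->
  (\int[mu]_t (h t ^+ 2)%:E < +oo)%E ->
  (\int[mu]_x (HL_maximal h x * HL_maximal h x) < +oo)%E.
Proof.
move=> mh h0 h2; have lh := sqr_integrable_locally mh h0 h2.
have M0 := HL_maximalT_ge0 lh; have mM := measurable_HL_maximal lh.
have lev := fun e => @maximal_square_above h e mh h0 h2.
move: M0 mM lev; move: (HL_maximal h) => M M0 mM lev.
pose E n : set R := [set x | ((n.+1%:R^-1)%:E < M x)%E].
have mE n : measurable (E n).
  by rewrite -[X in measurable X]setTI; apply: emeasurable_fun_o_infty.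
have mMM : measurable_fun setT (fun x => M x * M x)%E by exact: emeasurable_funM.
have -> : (\int[mu]_x (M x * M x) = \int[mu]_(x in \bigcup_n E n) (M x * M x))%E.
  rewrite [RHS]integral_mkcond; apply: eq_integral => x _.
  rewrite patchE; case: ifPn => //; rewrite notin_setE => xE.
  suff -> : M x = 0%E by rewrite mule0.
  apply/eqP; rewrite eq_le M0 andbT leNgt; apply/negP => Mx; apply: xE.
  case Ma: (M x) => [a| |]; rewrite Ma in Mx => //.
    have a0 : 0 < a by [].
    exists (Num.trunc a^-1) => //; rewrite /E /= Ma lte_fin -[ltRHS]invrK ltf_pV2 ?posrE ?invr_gt0//.
    exact: truncnS_gt.
  by exists 0%N; rewrite // /E /= Ma ltry.
have cv : (\int[mu]_(x in E n) (M x * M x))%E @[n --> \oo] -->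
    (\int[mu]_(x in \bigcup_n E n) (M x * M x))%E.
  apply: ge0_nondecreasing_set_cvg_integral => //.
  - move=> m n mn; rewrite subsetEset => x; rewrite /E /=; apply: le_lt_trans.
    by rewrite lee_fin lef_pV2 ?posrE// ler_nat.
  - by move=> n; exact: measurable_funTS.
  - by move=> n x _; exact: mule_ge0.
have F : (96%:E * \int[mu]_t (h t ^+ 2)%:E < +oo)%E.
  by rewrite lte_mul_pinfty.
apply: le_lt_trans F; apply: (cvge_le _ cv).
by apply: nearW => n; apply: lev; rewrite invr_gt0.
Qed.

(** The condition reads W_n S_n^a <= C (2 * 4^n)^(1 + a). Either factor is bounded below
    independently of n, so this upper bound on the product bounds the other factor geometrically;
    the computation is linear in logarithms. *)
Lemma dual_average_growth (a w0 s0 C : R) (W S : nat -> \bar R) :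
  0 < a -> 0 < w0 -> 0 < s0 -> (forall n, w0%:E <= W n)%E -> (forall n, s0%:E <= S n)%E ->
  (forall n, ((2 * 4 ^+ n)^-1)%:E * W n * poweR (((2 * 4 ^+ n)^-1)%:E * S n) a <= C%:E)%E ->
  (exists K A, [/\ 0 <= K, 0 <= A & forall n, (W n <= (K * A ^+ n)%:E)%E]) /\
  (exists K A, [/\ 0 <= K, 0 <= A & forall n, (S n <= (K * A ^+ n)%:E)%E]).
Proof.
move=> a0 w00 s00 wW sS H.
have l0 n : 0 < 2 * 4 ^+ n :> R by rewrite mulr_gt0// exprn_gt0.
have li0 n : 0 < (2 * 4 ^+ n)^-1 :> R by rewrite invr_gt0.
have lnl n : ln (2 * 4 ^+ n) = ln 2 + n%:R * ln 4 :> R.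
  by rewrite lnM ?posrE ?exprn_gt0// lnXn// mulr_natl.
(* Neither factor can be infinite: multiplied by the other, which is positive, it would exceed C. *)
have real n : exists x y, [/\ W n = x%:E /\ S n = y%:E, 0 < x, 0 < y, w0 <= x /\ s0 <= y &
    ln x + a * ln y <= ln C + (1 + a) * (ln 2 + n%:R * ln 4)].
  have W0 : (0 < W n)%E by apply: lt_le_trans (wW n); rewrite lte_fin.
  have S0 : (0 < S n)%E by apply: lt_le_trans (sS n); rewrite lte_fin.
  have p0 : (0 < poweR ((2 * 4 ^+ n)^-1%:E * S n) a)%E by rewrite poweR_gt0 ?mule_gt0 ?lte_fin.
  have q0 : (0 < (2 * 4 ^+ n)^-1%:E * W n)%E by rewrite mule_gt0 ?lte_fin.
  have := H n; have := wW n; have := sS n; move: W0 S0 p0 q0.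
  case: (W n) => [x| |] //; last by move=> _ _ p0; rewrite gt0_muley ?lte_fin// gt0_mulye.
  case: (S n) => [y| |] //; last first.
    by move=> _ _ _ q0; rewrite gt0_muley ?lte_fin// poweRyr ?gt_eqF// gt0_muley.
  rewrite !lte_fin !lee_fin => x0 y0 _ _ sy wx xy.
  exists x, y; split => //.
  have u0 : 0 < (2 * 4 ^+ n)^-1 * x by rewrite mulr_gt0.
  have v0 : 0 < (2 * 4 ^+ n)^-1 * y by rewrite mulr_gt0.
  have pv0 : 0 < powR ((2 * 4 ^+ n)^-1 * y) a by rewrite powR_gt0.
  have C0 : 0 < C by apply: lt_le_trans xy; rewrite mulr_gt0.
  move: xy; rewrite -ler_ln ?posrE ?mulr_gt0// lnM ?posrE// ln_powR !lnM ?posrE// lnV ?posrE//.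
  by rewrite lnl; lra.
split.
- exists (expR (ln C + (1 + a) * ln 2 - a * ln s0)), (expR ((1 + a) * ln 4)).
  split; rewrite ?expR_ge0// => n; have [x [y [[-> _] x0 y0 [_ sy] h]]] := real n.
  rewrite lee_fin -expRM_natl -expRD -[leLHS]lnK ?posrE// ler_expR.
  have : a * ln s0 <= a * ln y by rewrite ler_pM2l// ler_ln ?posrE.
  by lra.
- exists (expR (a^-1 * (ln C + (1 + a) * ln 2 - ln w0))), (expR (a^-1 * ((1 + a) * ln 4))).
  split; rewrite ?expR_ge0// => n; have [x [y [[_ ->] x0 y0 [wx _] h]]] := real n.
  rewrite lee_fin -expRM_natl -expRD -[leLHS]lnK ?posrE// ler_expR.
  rewrite mulrCA -mulrDr -(ler_pM2l a0) mulVKf ?gt_eqF//.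
  have : ln w0 <= ln x by rewrite ler_ln ?posrE.
  by lra.
Qed.

Lemma integral_expR_gt0 u : measurable_fun setT u ->
  exists2 c : R, 0 < c & (c%:E <= \int[mu]_(t in ball (0%R : R) 1) (expR (u t))%:E)%E.
Proof.
move=> mu_; set I := (\int[mu]_(t in _) _)%E.
have mB := measurable_ball (0 : R) 1.
have me : measurable_fun (ball (0 : R) 1) (fun t => (expR (u t))%:E).
  by apply/measurable_EFinP; apply: measurableT_comp => //; exact: measurable_funTS.
have I0 : (0 <= I)%E by apply: integral_ge0 => t _; rewrite lee_fin expR_ge0.
have : I != 0%E.
  apply/eqP => Iz.
  have : (\int[mu]_(t in ball (0%R : R) 1) `|(expR (u t))%:E| = 0)%E.
    by rewrite -Iz; apply: eq_integral => t _; rewrite gee0_abs// lee_fin expR_ge0.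
  move=> /(ae_eq_integral_abs mu mB me) [N [mN N0 BN]].
  have : (mu (ball (0%R : R) 1%R) <= mu N)%E.
    apply: le_measure; rewrite ?inE// => t Bt; apply: BN => /= /(_ Bt) /eqP.
    by rewrite eqe gt_eqF// expR_gt0.
  by rewrite N0 lebesgue_measure_ball// lee_fin; lra.
case: I I0 => [c|_ _|//].
  by rewrite lee_fin eqe => c0 c1; exists c => //; rewrite lt_def c1.
by exists 1 => //; rewrite leey.
Qed.

(** The exponential forms agree almost everywhere with w and its dual power and are positive at
    every point, which yields the lower bounds on the unit ball that [dual_average_growth] asks
    for. *)
Lemma muckenhoupt_growth (r : R) w : 1 < r -> muckenhoupt r w ->
  (exists K A, [/\ 0 <= K, 0 <= A & forall n,
     (\int[mu]_(t in ball (0%R : R) (4 ^+ n)%R) (expR (ln (w t)))%:E <= (K * A ^+ n)%:E)%E]) /\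
  (exists K A, [/\ 0 <= K, 0 <= A & forall n,
     (\int[mu]_(t in ball (0%R : R) (4 ^+ n)%R) (expR (- (r - 1)^-1 * ln (w t)))%:E <=
      (K * A ^+ n)%:E)%E]).
Proof.
move=> r1 [[[mw _ _] wpos] [C HC]].
have a0 : 0 < r - 1 by rewrite subr_gt0.
have mln : measurable_fun setT (fun t => ln (w t)).
  by apply: measurableT_comp => //; exact: measurable_ln.
have mq : measurable_fun setT (fun t => - (r - 1)^-1 * ln (w t)) by exact: measurable_funM.
have [w0 w00 hw0] := integral_expR_gt0 mln.
have [s0 s00 hs0] := integral_expR_gt0 mq.
have sub (f : R -> R) (c : R) n : measurable_fun setT f ->
    (c%:E <= \int[mu]_(t in ball (0%R : R) 1) (expR (f t))%:E)%E ->
    (c%:E <= \int[mu]_(t in ball (0%R : R) (4 ^+ n)%R) (expR (f t))%:E)%E.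
  move=> mf h; apply: (le_trans h); apply: ge0_subset_integral => //.
  - exact: measurable_ball.
  - exact: measurable_ball.
  - by apply/measurable_EFinP; apply: measurableT_comp => //; exact: measurable_funTS.
  - by apply: le_ball; apply: exprn_ege1; lra.
apply: (@dual_average_growth (r - 1) w0 s0 C _ _ a0 w00 s00) => n;
  [exact: (sub _ _ n mln hw0)|exact: (sub _ _ n mq hs0)|].
have n0 : 0 < (4 : R) ^+ n by rewrite exprn_gt0.
have := HC (- 4 ^+ n) (4 ^+ n); rewrite /average gt0_cp// => /(_ isT).
have -> : `]- 4 ^+ n, 4 ^+ n[%classic = ball (0 : R) (4 ^+ n) by rewrite ball_itv sub0r add0r.
have -> : 4 ^+ n - - 4 ^+ n = 2 * 4 ^+ n :> R by rewrite opprK mulrDl mul1r.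
have mB := measurable_ball (0 : R) (4 ^+ n).
rewrite (@ae_eq_integral _ _ _ mu _ (fun t => (expR (ln (w t)))%:E) (EFin \o w))//; last 3 first.
- by apply/measurable_EFinP; exact: measurable_funTS.
- by apply/measurable_EFinP; apply: measurableT_comp => //; exact: measurable_funTS.
- by apply: ae_imp wpos => t wt _ /=; rewrite lnK.
rewrite (@ae_eq_integral _ _ _ mu _ (fun t => (expR (- (r - 1)^-1 * ln (w t)))%:E)
  (fun t => (powR (w t) (- (r - 1)^-1))%:E))//.
- by apply/measurable_EFinP; apply: measurable_funTS; exact: (measurableT_comp (measurable_powR _) mw).
- by apply/measurable_EFinP; apply: measurableT_comp => //; exact: measurable_funTS.
- by apply: ae_imp wpos => t wt _ /=; rewrite /powR gt_eqF.
Qed.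

End MaximalBounds.

(** * From the Smirnov condition to the Hardy condition *)

Section SmirnovToHardy.
Variable R : realType.
Local Notation mu := (@lebesgue_measure R).
Implicit Types (x y t a alpha m : R) (z w : CC R) (f g F G P : CC R -> CC R).

(** For fixed z the set of x whose cone contains z is open. This makes the maximal function of an
    arbitrary F measurable. *)
Lemma lower_semicontinuous_nt_maximal alpha F : lower_semicontinuous (nt_maximal alpha F).
Proof.
apply/lower_semicontinuousP => a; rewrite openE => x /= /ereal_sup_gt[_ [z [y0 xz] <-] az].
have d0 : 0 < tan alpha * complex.Im z - `|x - complex.Re z| by rewrite subr_gt0.
exists (tan alpha * complex.Im z - `|x - complex.Re z|) => // t; rewrite /ball /= => xt.
apply: lt_le_trans az (nt_maximal_ge _ _); split => //.
by have := ler_distD x t (complex.Re z); rewrite (distrC t x); lra.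
Qed.

Lemma measurable_nt_maximal alpha F : measurable_fun setT (nt_maximal alpha F).
Proof.
by apply: lower_semicontinuous_measurable; exact: lower_semicontinuous_nt_maximal.
Qed.

Lemma ln_normc_addi_real t : ln (normc ('i%C + t%:C : CC R)) = logw t.
Proof.
rewrite /logw; set r := normc _.
have r0 : 0 < r.
  by rewrite /r normc_gt0; apply/eqP => /(congr1 (@complex.Im R));
    rewrite !creimE /= addr0 => /eqP; rewrite oner_eq0.
have -> : 1 + t ^+ 2 = r ^+ 2 by rewrite /r sqr_normcE !creimE /= add0r addr0 expr1n addrC.
by rewrite lnXn// -[X in X / 2]mulr_natr mulfK.
Qed.

Lemma expR_half_logw_le_growth t : expR (2^-1 * logw t) <= growth t.
Proof.
have g0 : 0 < growth t by apply: lt_le_trans (growth_ge1 t).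
have T0 : 0 < 2 + `|t| by have := normr_ge0 t; lra.
rewrite -[leRHS]lnK ?posrE// ler_expR /logw /growth.
have -> : ln (Num.sqrt (2 + `|t|)) = 2^-1 * ln (2 + `|t|).
  rewrite -{2}(sqr_sqrtr (ltW T0)) lnXn ?sqrtr_gt0//.
  by rewrite -[X in _ * X]mulr_natl mulKf.
rewrite ler_pM2l ?invr_gt0// ler_pdivrMr//.
have -> : ln (2 + `|t|) * 2 = ln ((2 + `|t|) ^+ 2) by rewrite lnXn// mulr_natr.
rewrite ler_ln ?posrE ?exprn_gt0 ?ltr_pwDl ?sqr_ge0//.
by rewrite -(real_normK (num_real t)); have := normr_ge0 t; rewrite !expr2; lra.
Qed.

(** The power (i + w)^(-e) is holomorphic and bounded by 1 on the closed half-plane, so Poisson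
    majorization applies to it; e -> 0 gives the inequality for the negatives of both logarithms. *)
Lemma poisson_logw z : upper_half_plane z ->
  mu.-integrable setT (EFin \o (fun t =>
    poisson_kernel (complex.Im z) (complex.Re z - t) * logw t)) /\
  \int[mu]_t (poisson_kernel (complex.Im z) (complex.Re z - t) * logw t) <= ln (normc ('i%C + z)).
Proof.
move=> Uz; have y0 : 0 < complex.Im z := Uz.
have P0 t := poisson_kernel_gt0 (complex.Re z - t) y0.
have mP := continuous_measurable_fun (continuous_poisson_kernel (x := complex.Re z) y0).
have ml : measurable_fun setT (@logw R) by apply: continuous_measurable_fun; exact: continuous_logw.
have mNl : measurable_fun setT (fun t : R => - logw t) by exact: measurable_funN.
have d0 : 0 < 2^-1 :> R by rewrite invr_gt0.
set X := complex.Re z in P0 mP *; set y := complex.Im z in y0 P0 mP *.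
have i1 : mu.-integrable setT (EFin \o (fun t => poisson_kernel y (X - t) * expR (2^-1 * - logw t))).
  apply: le_integrable (integrable_poisson_kernel X y0) => //.
    apply/measurable_EFinP; apply: measurable_funM => //; apply: measurableT_comp => //.
    exact: measurable_funM.
  move=> t _ /=; rewrite lee_fin [leLHS]ger0_norm; last first.
    by apply: mulr_ge0; [exact: ltW|exact: expR_ge0].
  rewrite ger0_norm ?(ltW (P0 t))//.
  rewrite ler_piMr ?(ltW (P0 t))// -[leRHS]expR0 ler_expR mulrN oppr_le0.
  by apply: mulr_ge0; [exact: ltW|exact: logw_ge0].
have i2 : mu.-integrable setT (EFin \o (fun t => poisson_kernel y (X - t) * expR (- 2^-1 * - logw t))).
  have ig := integrable_RZ (poisson_const X y) (@integrable_growth R).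
  apply: le_integrable ig => //.
    apply/measurable_EFinP; apply: measurable_funM => //; apply: measurableT_comp => //.
    exact: measurable_funM.
  move=> t _ /=; rewrite lee_fin [leLHS]ger0_norm; last first.
    by apply: mulr_ge0; [exact: ltW|exact: expR_ge0].
  apply: le_trans (ler_norm _); rewrite mulrNN.
  rewrite [leRHS](_ : _ = growth t * (poisson_const X y / (1 + t ^+ 2))); last by rewrite mulrCA.
  rewrite mulrC.
  apply: ler_pM; [exact: expR_ge0|exact: ltW| |].
    exact: expR_half_logw_le_growth.
  exact: poisson_kernel_le.
have il := integrable_of_exp y0 d0 mNl i1 i2.
split.
  move: (integrable_RZ (-1) il); congr (_.-integrable _ _); apply/funext => t /=.
  by rewrite mulN1r mulrN opprK.
rewrite -lerN2.
have -> : - (\int[mu]_t (poisson_kernel y (X - t) * logw t)) =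
    \int[mu]_t (poisson_kernel y (X - t) * - logw t).
  have -> : (\int[mu]_t (poisson_kernel y (X - t) * logw t)) =
      \int[mu]_t (-1 * (poisson_kernel y (X - t) * - logw t)).
    by apply: eq_Rintegral => t _; rewrite mulN1r mulrN opprK.
  by rewrite RintegralZl// mulN1r opprK.
apply: (poisson_log_le y0 d0 mNl i1 i2) => e /andP[e0 _].
pose h w := cexp ((- e)%:C * clog (w + 'i%C)).
have Ui w : 0 <= complex.Im w -> upper_half_plane (w + 'i%C).
  by move=> w0; rewrite /upper_half_plane /= cimD /=; lra.
have nh w : normc (h w) = expR (e * - ln (normc ('i%C + w))).
  by rewrite /h normc_cexp creM /= mul0r subr0 mulNr mulrN addrC.
have := @normc_poisson_le R h z y0; rewrite nh; set Q := (\int[mu]_t _)%E => HQ.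
have -> : (\int[mu]_t (poisson_kernel y (X - t) * expR (e * - logw t))%:E)%E = Q.
  by apply: eq_integral => t _; rewrite nh ln_normc_addi_real.
apply: HQ => [w w0|eps eps0].
  apply: derivable_cexp; apply: derivable_scale; apply: derivable_shiftc.
  by apply: holomorphic_clog; exact: Ui.
exists 1 => w w0; rewrite nh; apply: ler_wpDr; first by rewrite mulr_ge0 ?normc_ge0// ltW.
rewrite -[leRHS]expR0 ler_expR mulrN oppr_le0; apply: mulr_ge0; first exact: ltW.
rewrite addrC ln_ge0//; apply: le_trans (Im_le_normc _); rewrite cimD /=.
by apply: le_trans (ler_norm _); lra.
Qed.

Lemma smirnov_hardy1 alpha m (b : R -> R) (l p G : CC R -> CC R) :
  0 < alpha < pi / 2 -> 0 <= m -> holomorphic l -> holomorphic p ->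
  (forall z, upper_half_plane z -> G z = cexp (l z - p z)) ->
  (forall z, upper_half_plane z -> complex.Re (p z) = m * ln (normc ('i%C + z))) ->
  measurable_fun setT b ->
  (forall z, upper_half_plane z -> mu.-integrable setT (EFin \o (fun t =>
     poisson_kernel (complex.Im z) (complex.Re z - t) * b t))) ->
  (forall z, upper_half_plane z ->
     complex.Re (l z) = \int[mu]_t (poisson_kernel (complex.Im z) (complex.Re z - t) * b t)) ->
  (\int[mu]_t (expR (b t) * expR (- m * logw t))%:E < +oo)%E ->
  hardy1 alpha G.
Proof.
move=> ha m0 hl hp GE pE mb ib lE fin; have T0 := tan_cone_gt0 ha.
have ml : measurable_fun setT (@logw R) by apply: continuous_measurable_fun; exact: continuous_logw.
(* Half of the logarithm of the boundary modulus of [G], so that h = e^k is square integrable by the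
   last hypothesis. *)
pose k t := 2^-1 * (b t + - m * logw t).
have mk : measurable_fun setT k.
  by apply: measurable_funM => //; apply: measurable_funD => //; exact: measurable_funM.
pose h t := expR (k t).
have mh : measurable_fun setT h by exact: measurableT_comp.
have h0 t : 0 <= h t by exact: expR_ge0.
have h2 : (\int[mu]_t (h t ^+ 2)%:E < +oo)%E.
  move: fin; under eq_integral do rewrite -expRD.
  congr (_ < _)%E; apply: eq_integral => t _.
  by rewrite /h /k -expRM_natl; congr ((expR _)%:E); rewrite mulVKf.
have lh := sqr_integrable_locally mh h0 h2.
have HL0 := HL_maximalT_ge0 lh.
set c : R := 128 * (1 + tan alpha ^+ 2) / pi.
have c0 : 0 <= c.
  by rewrite /c divr_ge0 ?pi_ge0// mulr_ge0// addr_ge0// sqr_ge0.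
have bound z x : cone alpha x z ->
    ((normc (G z))%:E <= (c ^+ 2)%:E * (HL_maximal h x * HL_maximal h x))%E.
  move=> xz; have Uz : upper_half_plane z := xz.1.
  have y0 : 0 < complex.Im z := Uz.
  have [iw wle] := poisson_logw Uz.
  have Pk (q t : R) : 2^-1 * (q * b t + - m * (q * logw t)) = q * k t by rewrite /k; ring.
  have ik : mu.-integrable setT (EFin \o (fun t =>
      poisson_kernel (complex.Im z) (complex.Re z - t) * k t)).
    move: (integrable_RZ 2^-1 (integrable_RD (ib z Uz) (integrable_RZ (- m) iw))).
    by congr (_.-integrable _ _); apply/funext => t /=; rewrite Pk.
  have Ik : \int[mu]_t (poisson_kernel (complex.Im z) (complex.Re z - t) * k t) =
      2^-1 * (complex.Re (l z) - m * \int[mu]_t (poisson_kernel (complex.Im z) (complex.Re z - t) * logw t)).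
    rewrite lE// -mulNr -RintegralZl// -RintegralD//; last 2 first.
    - exact: ib.
    - exact: integrable_RZ.
    rewrite -RintegralZl//; last exact: (integrable_RD (ib z Uz) (integrable_RZ (- m) iw)).
    by apply: eq_Rintegral => t _; rewrite Pk.
  have J := poisson_jensen y0 mk ik.
  have M := cone_poisson_le_HL T0 xz mh h0 (HL0 x).
  have {}J := le_trans J M.
  have e0 := expR_ge0 (\int[mu]_t (poisson_kernel (complex.Im z) (complex.Re z - t) * k t)).
  (* Replacing log|i + z| by the smaller Poisson integral of [logw] enlarges the right side because
     m >= 0. *)
  have : normc (G z) <= expR (\int[mu]_t (poisson_kernel (complex.Im z) (complex.Re z - t) * k t)) ^+ 2.
    rewrite GE// normc_cexp -expRM_natl ler_expR creD creN pE// Ik mulVKf//.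
    by rewrite lerD2l lerN2 ler_wpM2l.
  rewrite -lee_fin => /le_trans; apply.
  rewrite expr2 EFinM; apply: le_trans (lee_pmul _ _ J J) _; rewrite ?lee_fin//.
  by rewrite -/c expr2 EFinM muleACA.
split.
  move=> z Uz; have /nbhsCP[d d0 Ud] := open_upper_half_plane Uz.
  apply: (@derivable_near R (fun w => cexp (l w - p w)) G z d d0) => [w /Ud Uw|].
    by rewrite GE.
  apply: derivable_cexp; apply: derivableB; [exact: hl|exact: hp].
have mM := measurable_HL_maximal lh.
apply/integrableP; split; first exact: measurable_nt_maximal.
under eq_integral do rewrite gee0_abs ?nt_maximal_ge0//.
apply: (@le_lt_trans _ _ (\int[mu]_x ((c ^+ 2)%:E * (HL_maximal h x * HL_maximal h x)))%E).
  apply: ge0_le_integral => //.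
  - by move=> x _; exact: nt_maximal_ge0.
  - exact: measurable_nt_maximal.
  - by apply: emeasurable_funM => //; exact: emeasurable_funM.
  - by move=> x _; apply: ge_ereal_sup => _ [z xz <-]; exact: bound.
rewrite ge0_integralZl//; last 3 first.
- exact: emeasurable_funM.
- by move=> x _; exact: mule_ge0.
- by rewrite lee_fin sqr_ge0.
by rewrite lte_mul_pinfty ?lee_fin ?sqr_ge0// HL_maximal_square_integrable.
Qed.

Lemma smirnov_hardy alpha F (Fbd : R -> R) : 0 < alpha < pi / 2 ->
  holomorphic F -> (forall z, upper_half_plane z -> F z != 0) ->
  {ae mu, forall x, nt_limit (fun z => normc (F z)) x (Fbd x)} ->
  muckenhoupt_infty Fbd -> smirnov_type F ->
  exists m s q : R, exists Pm Ps Fq : CC R -> CC R,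
    [/\ [/\ 0 <= m, 0 <= s & 0 < q],
        [/\ real_power (fun z => 'i%C + z) m Pm, real_power (fun z => 'i%C + z) s Ps
          & real_power F (- q) Fq],
        hardy1 alpha (fun z => F z / Pm z) & hardy1 alpha (fun z => Fq z / Ps z)].
Proof.
move=> ha hF hF0 hlim [r r1 hA] [u [hu iu Fu]].
have [wF _] := hA; have mF := weight_measurable wF; have [_ Fpos] := wF.
have mln : measurable_fun setT (fun t => ln (Fbd t)) by apply: measurableT_comp => //; exact: measurable_ln.
(* Both limits exist along the vertical sequence, where the limit is unique. *)
have uF : {ae mu, forall x, u x = ln (Fbd x)}.
  apply: ae_imp2 hu (ae_imp2 (fun t (a : nt_limit _ t _) (b : 0 < Fbd t) => conj a b) hlim Fpos).
  move=> x /nt_limit_vertical h1 [/nt_limit_vertical h2 Fx].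
  have h3 := cvg_comp _ _ h2 (continuous_ln Fx).
  exact: (@cvg_unique _ (@Rhausdorff R) _ _ _ _ h1 h3).
(* The Smirnov condition provides measurability only for u / (1 + t^2). *)
have mu_ : measurable_fun setT u.
  have /measurable_EFinP m1 := measurable_int _ iu.
  have -> : u = (fun t => u t / (1 + `|t| ^+ 2) * (1 + `|t| ^+ 2)).
    by apply/funext => t; rewrite divfK// gt_eqF// ltr_pwDl// sqr_ge0.
  apply: measurable_funM => //; apply: measurable_funD => //; apply: measurable_funX.
  by apply: continuous_measurable_fun; exact: norm_continuous.
have iPu z : upper_half_plane z -> mu.-integrable setT (EFin \o (fun t =>
    poisson_kernel (complex.Im z) (complex.Re z - t) * u t)).
  move=> Uz; have y0 : 0 < complex.Im z := Uz.
  have ic := integrable_RZ (poisson_const (complex.Re z) (complex.Im z)) iu.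
  apply: le_integrable ic => //.
    apply/measurable_EFinP; apply: measurable_funM => //.
    by apply: continuous_measurable_fun; exact: continuous_poisson_kernel.
  move=> t _ /=; have D0 : 0 < 1 + t ^+ 2 by rewrite ltr_pwDl// sqr_ge0.
  rewrite lee_fin [X in X <= _]normrM (real_normK (num_real t)) mulrCA [leRHS]normrM [leRHS]mulrC.
  apply: ler_wpM2r => //; apply: le_trans (ler_norm _).
  rewrite ger0_norm; first exact: poisson_kernel_le.
  exact: ltW (poisson_kernel_gt0 _ _).
have [L [hL FL]] := poisson_log_branch hF hF0 iu Fu.
have ReL z : upper_half_plane z -> complex.Re (L z) =
    \int[mu]_t (poisson_kernel (complex.Im z) (complex.Re z - t) * u t).
  by move=> Uz; rewrite -[RHS]Fu// -FL// normc_cexp expRK.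
(* Since z + i lies in the half-plane, this is a logarithm of i + z, and its multiples give the
   powers [Pm] and [Ps]. *)
pose L1 z := clog (z + 'i%C : CC R).
have Ui z : upper_half_plane z -> upper_half_plane (z + 'i%C).
  by rewrite /upper_half_plane /= cimD /=; lra.
have hL1 : holomorphic L1.
  by move=> z Uz; apply: derivable_shiftc; apply: holomorphic_clog; exact: Ui.
have pow a : real_power (fun z => 'i%C + z) a (fun z => cexp (a%:C * L1 z)).
  exists L1 => //; split => // z Uz; rewrite cexp_clog; first by rewrite addrC.
  exact: Ui.
have ReL1 a z : upper_half_plane z -> complex.Re (a%:C * L1 z) = a * ln (normc ('i%C + z)).
  by move=> Uz; rewrite creM /= mul0r subr0 addrC.
have hscale a (f : CC R -> CC R) : holomorphic f -> holomorphic (fun z => a%:C * f z).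
  by move=> hf z Uz; apply: derivable_scale; exact: hf.
have cdiv (z w : CC R) : cexp z / cexp w = cexp (z - w).
  have w0 := cexp_neq0 w; rewrite -[z in LHS](subrK w) [X in X / _]cexpD.
  exact: (mulfK w0).
have [[K1 [A1 [K10 A10 g1]]] [K2 [A2 [K20 A20 g2]]]] := muckenhoupt_growth r1 hA.
set q := (r - 1)^-1 in g2; have q0 : 0 < q by rewrite invr_gt0 subr_gt0.
have mql : measurable_fun setT (fun t => - q * ln (Fbd t)) by exact: measurable_funM.
have ml : measurable_fun setT (@logw R) by apply: continuous_measurable_fun; exact: continuous_logw.
(* Transfers the weighted integrals from ln |F~|, where the growth bounds hold, to the function [u]
   that is represented by its Poisson integral. *)
have aeI (e : R) (v1 v2 : R -> R) : measurable_fun setT v1 -> measurable_fun setT v2 ->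
    {ae mu, forall t, v1 t = v2 t} ->
    (\int[mu]_t (expR (v1 t) * expR (- e * logw t))%:E =
     \int[mu]_t (expR (v2 t) * expR (- e * logw t))%:E)%E.
  have mexp (v : R -> R) : measurable_fun setT v ->
      measurable_fun setT (fun t => (expR (v t) * expR (- e * logw t))%:E).
    move=> mv; apply/measurable_EFinP; apply: measurable_funM; first exact: measurableT_comp.
    by apply: measurableT_comp => //; exact: measurable_funM.
  move=> m1 m2 v12; apply: ae_eq_integral; [exact: measurableT|exact: mexp|exact: mexp|].
  by apply: ae_imp v12 => t + _; move=> ->.
have [|t|m m0 fm] := logw_decay K10 A10 _ _ g1; [exact: measurableT_comp|exact: expR_ge0|].
have [|t|s s0 fs] := logw_decay K20 A20 _ _ g2; [exact: measurableT_comp|exact: expR_ge0|].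
exists m, s, q, (fun z => cexp (m%:C * L1 z)), (fun z => cexp (s%:C * L1 z)),
  (fun z => cexp ((- q)%:C * L z)).
split.
- by split; [exact: m0|exact: s0|exact: q0].
- by split; [exact: pow|exact: pow|exists L].
- apply: (@smirnov_hardy1 alpha m u L (fun z => m%:C * L1 z) _ ha m0 hL (hscale m _ hL1)).
  + by move=> z Uz; rewrite -cdiv FL.
  + exact: ReL1.
  + exact: mu_.
  + exact: iPu.
  + exact: ReL.
  + by rewrite (aeI m u _ mu_ mln uF).
- apply: (@smirnov_hardy1 alpha s (fun t => - q * u t) (fun z => (- q)%:C * L z) (fun z => s%:C * L1 z) _ ha s0
    (hscale (- q) _ hL) (hscale s _ hL1)).
  + by move=> z Uz; rewrite -cdiv.
  + exact: ReL1.
  + exact: measurable_funM.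
  + move=> z Uz; move: (integrable_RZ (- q) (iPu z Uz)).
    by congr (_.-integrable _ _); apply/funext => t /=; rewrite mulrCA.
  + move=> z Uz; rewrite creM /= mul0r subr0 ReL// -RintegralZl//; last exact: iPu.
    by apply: eq_Rintegral => t _; rewrite mulrCA.
  + rewrite (aeI s _ (fun t => - q * ln (Fbd t)) _ mql)//; first exact: measurable_funM.
    by apply: ae_imp uF => t ->.
Qed.

End SmirnovToHardy.

Theorem theorem4p3 (R : realType) (alpha : R) (halpha : 0 < alpha < pi / 2)
    (F : CC R -> CC R) (Fbd : R -> R)
    (hF : holomorphic F)
    (hF0 : forall z, upper_half_plane z -> F z != 0)
    (hlim : {ae (@lebesgue_measure R), forall x : R,
               nt_limit (fun z => normc (F z)) x (Fbd x)})
    (hA : muckenhoupt_infty Fbd) :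
  smirnov_type F <->
  exists m s q : R, exists Pm Ps Fq : CC R -> CC R,
    [/\ [/\ 0 <= m, 0 <= s & 0 < q],
        [/\ real_power (fun z => 'i%C + z) m Pm,
            real_power (fun z => 'i%C + z) s Ps
          & real_power F (- q) Fq],
        hardy1 alpha (fun z => F z / Pm z)
      & hardy1 alpha (fun z => Fq z / Ps z)].
Proof.
split=> [hS|]; first exact: smirnov_hardy halpha hF hF0 hlim hA hS.
move=> [m [s [q [Pm [Ps [Fq [[m0 s0 q0] [hPm hPs hFq] h1 h2]]]]]]].
have [r _ [wF _]] := hA.
exact: hardy_smirnov halpha hlim wF m0 s0 q0 hPm hPs hFq h1 h2.
Qed.
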